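(* For every $\ell,d\in\mathbb{N}$ there exists $k\in\mathbb{N}$, depending only on $\ell$ and $d$, such that the following holds. Let $(X,\mathcal{X},\mu)$ be a Lebesgue probability space. For $i=1,\ldots,\ell$ let $T_i\colon X\to X$ be an invertible measure preserving transformation, let $f_i\in L^\infty(\mu)$, and let $p_i\in\mathbb{Z}[t]$ be a non-constant polynomial, such that $p_i-p_j$ is non-constant for $i\neq j$ and the maximum degree of $p_1,\ldots,p_\ell$ is $d$. (The transformations are not assumed to commute.) Let $b\colon\mathbb{N}\to\mathbb{N}$ be a sequence such that $b(N)\to\infty$ and $b(N)/N^{1/d}\to0$ as $N\to\infty$. If $|\!|\!|f_i|\!|\!|_{k,T_i}=0$ for some $i\in\{1,\ldots,\ell\}$, then the averages $$\frac1N\sum_{m=1}^N\Big|\frac{1}{b(N)}\sum_{n=1}^{b(N)}f_1\big(T_1^{m+p_1(n)}x\big)\cdots f_\ell\big(T_\ell^{m+p_\ell(n)}x\big)\Big|^2$$ converge pointwise to $0$ as $N\to\infty$, i.e. for $\mu$-almost every $x\in X$ they converge to $0$.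
   Context: $\mathbb{N}=\{1,2,\ldots\}$. Seminorms. Let $T$ be an invertible measure preserving transformation of a Lebesgue probability space $(X,\mathcal{X},\mu)$, let $\mathcal{I}=\{A\in\mathcal{X}:\mu(T^{-1}A\triangle A)=0\}$, and let $\mu=\int\mu_x\,d\mu(x)$ be the ergodic decomposition of $\mu$ with respect to $T$, i.e. $x\mapsto\mu_x$ is a regular version of the conditional measures with respect to $\mathcal{I}$, so that $\mathbb{E}_\mu(f|\mathcal{I})(x)=\int f\,d\mu_x$ for $\mu$-a.e. $x$ for every bounded measurable $f$. For $f\in L^\infty(\mu)$ write $T^nf=f\circ T^n$ and define inductively $$|\!|\!|f|\!|\!|_{1}=\Big\|\int f\,d\mu_x\Big\|_{L^2(\mu)},\qquad |\!|\!|f|\!|\!|_{k+1}^{2^{k+1}}=\lim_{N\to\infty}\frac1N\sum_{n=1}^N|\!|\!|\bar f\cdot T^nf|\!|\!|_{k}^{2^k}.$$ (The limits are known to exist, and $|\!|\!|\cdot|\!|\!|_k$ is a seminorm on $L^\infty(\mu)$.) One writes $|\!|\!|\cdot|\!|\!|_{k,T}$ to indicate the transformation. *)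

(* Defs.v *)
From HB Require Import structures.
From mathcomp Require Import all_boot all_order all_algebra.
From mathcomp Require Import all_classical all_reals all_analysis.
From mathcomp Require Import measurable_realfun complex.

Set Implicit Arguments.
Unset Strict Implicit.
Unset Printing Implicit Defensive.

Import Order.TTheory GRing.Theory Num.Theory.
Import numFieldNormedType.Exports.

Local Open Scope classical_set_scope.
Local Open Scope ring_scope.

(* The model space: the interval [0, s] with Lebesgue measure, together with
   countably many atoms of masses a_0, a_1, ..., placed at -1, -2, ... *)
Definition interval_with_atoms (R : realType)
    (nu : probability (measurableTypeR R) R) : Prop :=
  exists (s : R) (a : nat -> R),
    [/\ 0 <= s, forall n, 0 <= a n &
        forall B : set (measurableTypeR R), measurable B ->
          nu B = (lebesgue_measure (`[0%R, s] `&` B)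
                  + \sum_(0 <= n <oo) (a n)%:E * \d_((- n.+1%:R)%R : R) B)%E].

(* Isomorphism modulo null sets with such a model.  Images are only required to
   be measurable for the completion of [nu], so that the definition covers both
   complete spaces and standard Borel spaces that are not completed. *)
Definition lebesgue_space (R : realType) (dX : measure_display)
    (X : measurableType dX) (mu : probability X R) : Prop :=
  exists (nu : probability (measurableTypeR R) R)
         (X0 : set X) (Y0 : set (measurableTypeR R))
         (phi : X -> measurableTypeR R),
    interval_with_atoms nu /\
    [/\ measurable X0, mu (~` X0) = 0%E, measurable Y0 & nu (~` Y0) = 0%E] /\
    [/\ set_bij X0 Y0 phi,
        measurable_fun X0 phi,
        forall A, measurable A -> A `<=` X0 ->
          completed_algebra_gen nu (phi @` A) &
        forall B, measurable B -> mu (X0 `&` phi @^-1` B) = nu B].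

Record invertible_mpt (R : realType) (dX : measure_display)
    (X : measurableType dX) (mu : probability X R) := InvertibleMpt {
  mpt_fun :> X -> X;
  mpt_inv : X -> X;
  mpt_funK : cancel mpt_fun mpt_inv;
  mpt_invK : cancel mpt_inv mpt_fun;
  measurable_mpt_fun : measurable_fun setT mpt_fun;
  measurable_mpt_inv : measurable_fun setT mpt_inv;
  mpt_preserving : forall A, measurable A -> mu (mpt_fun @^-1` A) = mu A
}.

Definition mpt_iter (R : realType) (dX : measure_display)
    (X : measurableType dX) (mu : probability X R) (T : invertible_mpt mu)
    (z : int) (x : X) : X :=
  match z with
  | Posz n => iter n T x
  | Negz n => iter n.+1 (mpt_inv T) x
  end.

Definition invariant_sets (R : realType) (dX : measure_display)
    (X : measurableType dX) (mu : probability X R) (T : invertible_mpt mu) :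
    set (set X) :=
  [set A | measurable A /\ mu ((T @^-1` A) `+` A) = 0%E].

(* A regular version x |-> mu_x of the conditional measures of mu with respect
   to the invariant sigma-algebra.  When the sigma-algebra of X is complete, the
   mu_x cannot in general be defined on all of it, so they live on a
   sub-sigma-algebra <<s base>> that agrees with it up to mu-null sets; for a
   standard Borel space one can take base := measurable. *)
Record ergodic_decomposition (R : realType) (dX : measure_display)
    (X : measurableType dX) (mu : probability X R) (T : invertible_mpt mu) :=
  ErgodicDecomposition {
  erg_base : set (set X);
  erg_meas :> X -> probability (g_sigma_algebraType erg_base) R;
  erg_base_measurable : erg_base `<=` measurable;
  erg_base_dense : forall A : set X, measurable A ->
    exists B C : set X, [/\ <<s erg_base>> B, <<s erg_base>> C,
      B `<=` A, A `<=` C & mu (C `\` B) = 0%E];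
  erg_invariant : forall A : set X, <<s erg_base>> A ->
    measurable_fun [set: g_sigma_algebraType (invariant_sets T)]
      (fun x : g_sigma_algebraType (invariant_sets T) => erg_meas x A);
  erg_conditional : forall A B : set X, <<s erg_base>> A ->
    invariant_sets T B -> (\int[mu]_(x in B) erg_meas x A = mu (A `&` B))%E
}.

Definition complex_Linfty (R : realType) (dX : measure_display)
    (X : measurableType dX) (mu : probability X R) (f : X -> R[i]) : Prop :=
  (fun x => complex.Re (f x)) \in Lfun mu +oo%E /\
  (fun x => complex.Im (f x)) \in Lfun mu +oo%E.

Definition complex_integral (R : realType) (dX : measure_display)
    (X : measurableType dX) (mu : probability X R) (f : X -> R[i]) : R[i] :=
  Complex (\int[mu]_x complex.Re (f x)) (\int[mu]_x complex.Im (f x)).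

(* |||f|||_k for k >= 1; the value at k = 0 is a dummy. *)
Fixpoint ergodic_seminorm (R : realType) (dX : measure_display)
    (X : measurableType dX) (mu : probability X R) (T : invertible_mpt mu)
    (D : ergodic_decomposition T) (k : nat) (f : X -> R[i]) : R :=
  match k with
  | 0 => 0
  | k'.+1 =>
    if k' is 0 then
      fine ('N[mu]_2%:E[EFin \o (fun x =>
        ComplexField.Normc.normc (complex_integral (D x) f))])%E
    else
      limn (fun N : nat => N%:R^-1 * \sum_(1 <= n < N.+1)
        ergodic_seminorm D k' (fun x => conjc (f x) * f (iter n T x))
          ^+ (2 ^ k'))
      `^ ((2 ^ k)%:R^-1)
  end.

(* Main.v *)
(* For fixed [x] put [u_i m := f_i (T_i^m x)].  The averages only involve the
   sequences [u_i], indexed by the same group of integers, so commutation of the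
   transformations plays no role and the statement becomes one about bounded
   sequences, provided that the seminorm of [f_i] controls the orbits of almost
   every point.

   A sequence has local seminorms, defined like the ergodic ones from averages
   of its multiplicative derivatives [u (m + h) * conj (u (m + h'))].  Birkhoff's
   theorem, applied to the countably many iterated derivatives of [f], shows that
   for almost every [x] the innermost averages converge, to integrals with
   respect to the ergodic component of [x].  The outer limits then exist for
   every such sequence: the cube averages are realised by shift-invariant
   finitely additive means, to which von Neumann's argument applies.  By dominated
   convergence the power [2^k] of the ergodic seminorm is the integral over [x]
   of the local one, so if the former vanishes, so does the latter almost
   everywhere.

   For bounded sequences one runs the polynomial exhaustion technique.  Van der
   Corput's inequality in [n] produces products along [p_i (n + h)] and
   [p_i (n + h')]; since [b N ^ d = o(N)], the average over [m <= N] may be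
   translated by a polynomial of degree at most [d] in [n], after which the
   factors independent of [n] are removed by Cauchy-Schwarz in [m].  Iterating,
   one reaches linear polynomials, where the averages are bounded by a local
   seminorm of the distinguished sequence. *)

Require Import Defs.
From HB Require Import structures.
From mathcomp Require Import all_boot all_order all_algebra.
From mathcomp Require Import all_classical all_reals all_analysis.
From mathcomp Require Import measurable_realfun complex.
From mathcomp Require Import ring lra zify.

Set Implicit Arguments.
Unset Strict Implicit.
Unset Printing Implicit Defensive.

Import Order.TTheory GRing.Theory Num.Theory.
Import numFieldNormedType.Exports.

Local Open Scope classical_set_scope.
Local Open Scope ring_scope.

(** The induction keeps the distinguished polynomial of maximal degree, so that all polynomials are
    linear once it is. If its degree is smaller at the start, the conjugate of the inner average is
    treated as one more bounded sequence and a polynomial of maximal degree is subtracted from all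
    the others. That extra sequence depends on [N], which is why the undistinguished factors are
    families indexed by [N].

    Monotonicity of the seminorms in their order is replaced by stating each claim for all orders
    beyond a threshold: in the linear case constant factors pad the product to the required length,
    and the finitely many thresholds met in one step of the induction are merged by a maximum. The
    order obtained thus depends on the number of factors and the degree only.

    On the measure side there are two obstacles. The ergodic components measure only a smaller
    sigma-algebra, so functions are first changed on a null set. The local seminorms are limits that
    exist only almost everywhere, so they are integrated through measurable versions that are
    bounded at every point. *)

Notation nc := ComplexField.Normc.normc.
Notation Re := complex.Re.
Notation Im := complex.Im.

(** * Averages and invariant means *)

Section ComplexModulus.
Variable R : realType.
Implicit Types (x y : R[i]) (r : R).

Lemma nc_norm x : nc x = `|x : Rcomplex R|.
Proof. by []. Qed.

Lemma nc_ge0 x : 0 <= nc x.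
Proof. by rewrite nc_norm. Qed.

Lemma nc_sqr x : nc x ^+ 2 = Re x ^+ 2 + Im x ^+ 2.
Proof. by case: x => a b /=; rewrite sqr_sqrtr// addr_ge0 ?sqr_ge0. Qed.

Lemma ncM x y : nc (x * y) = nc x * nc y.
Proof. exact: ComplexField.Normc.normcM. Qed.

Lemma ncD x y : nc (x + y) <= nc x + nc y.
Proof. exact: le_normcD. Qed.

Lemma ncJ x : nc (conjc x) = nc x.
Proof. by case: x => a b /=; rewrite sqrrN. Qed.

Lemma ncC r : nc (r%:C%C) = `|r|.
Proof. by rewrite /= expr0n addr0 sqrtr_sqr. Qed.

Lemma nc1 : nc (1 : R[i]) = 1.
Proof. exact: ComplexField.Normc.normc1. Qed.

Lemma nc_Re x : `|Re x| <= nc x.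
Proof.
rewrite -(ler_pXn2r (n := 2))// ?nnegrE ?nc_ge0//.
by rewrite real_normK ?num_real// nc_sqr lerDl sqr_ge0.
Qed.

Lemma nc_Im x : `|Im x| <= nc x.
Proof.
rewrite -(ler_pXn2r (n := 2))// ?nnegrE ?nc_ge0//.
by rewrite real_normK ?num_real// nc_sqr lerDr sqr_ge0.
Qed.

Lemma ReD x y : Re (x + y) = Re x + Re y.
Proof. by case: x; case: y. Qed.

Lemma ImD x y : Im (x + y) = Im x + Im y.
Proof. by case: x; case: y. Qed.

Lemma ReJ x : Re (conjc x) = Re x.
Proof. by case: x. Qed.

Lemma ImJ x : Im (conjc x) = - Im x.
Proof. by case: x. Qed.

Lemma ReM x y : Re (x * y) = Re x * Re y - Im x * Im y.
Proof. by case: x; case: y. Qed.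

Lemma ImM x y : Im (x * y) = Re x * Im y + Im x * Re y.
Proof. by case: x; case: y. Qed.

Lemma natC n : (n%:R : R[i]) = (n%:R : R)%:C%C.
Proof. by rewrite rmorph_nat. Qed.

Lemma natVC n : ((n%:R : R[i])^-1) = ((n%:R : R)^-1)%:C%C.
Proof. by rewrite natC fmorphV. Qed.

Lemma Re_sum I (s : seq I) (P : pred I) (F : I -> R[i]) :
  Re (\sum_(i <- s | P i) F i) = \sum_(i <- s | P i) Re (F i).
Proof. by apply: (big_morph _ ReD). Qed.

Lemma Im_sum I (s : seq I) (P : pred I) (F : I -> R[i]) :
  Im (\sum_(i <- s | P i) F i) = \sum_(i <- s | P i) Im (F i).
Proof. by apply: (big_morph _ ImD). Qed.

Lemma Re_natVM n x : Re (n%:R^-1 * x) = n%:R^-1 * Re x.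
Proof. by rewrite natVC ReM /= mul0r subr0. Qed.

Lemma Im_natVM n x : Im (n%:R^-1 * x) = n%:R^-1 * Im x.
Proof. by rewrite natVC ImM /= mul0r addr0. Qed.

Lemma nc_natVM n x : nc (n%:R^-1 * x) = n%:R^-1 * nc x.
Proof. by rewrite ncM natVC ncC ger0_norm// invr_ge0. Qed.

Lemma nc_sum I (s : seq I) (P : pred I) (F : I -> R[i]) :
  nc (\sum_(i <- s | P i) F i) <= \sum_(i <- s | P i) nc (F i).
Proof.
elim/big_rec2 : _ => [|i a b _ h]; first by rewrite ComplexField.Normc.normc0.
by rewrite (le_trans (ncD _ _))// lerD2l.
Qed.

Lemma nc_prod_le1 I (s : seq I) (P : pred I) (F : I -> R[i]) :
  (forall i, P i -> nc (F i) <= 1) -> nc (\prod_(i <- s | P i) F i) <= 1.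
Proof.
move=> h; elim/big_rec : _ => [|i a Pi ha]; first by rewrite nc1.
by rewrite ncM mulr_ile1 ?nc_ge0// h.
Qed.

Lemma nc_sqrE x : ((nc x) ^+ 2)%:C%C = x * conjc x.
Proof.
apply/eqP; rewrite eq_complex nc_sqr; case: x => a b /=.
by apply/andP; split; apply/eqP; ring.
Qed.

Lemma nc_distC x y : nc (x - y) = nc (y - x).
Proof. by rewrite -opprB normcN. Qed.

End ComplexModulus.

Section Cesaro.
Variable R : realType.

Definition cesaro (a : nat -> R) (N : nat) : R :=
  N%:R^-1 * \sum_(1 <= n < N.+1) a n.

Lemma cesaroD a b N : cesaro (fun n => a n + b n) N = cesaro a N + cesaro b N.
Proof. by rewrite /cesaro big_split /= mulrDr. Qed.

Lemma cesaroZ c a N : cesaro (fun n => c * a n) N = c * cesaro a N.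
Proof. by rewrite /cesaro -mulr_sumr mulrCA. Qed.

Lemma cesaroN a N : cesaro (fun n => - a n) N = - cesaro a N.
Proof. by rewrite /cesaro sumrN mulrN. Qed.

Lemma cesaroB a b N : cesaro (fun n => a n - b n) N = cesaro a N - cesaro b N.
Proof. by rewrite cesaroD cesaroN. Qed.

Lemma sum_nat_cst N (c : R) : \sum_(1 <= n < N.+1) c = N%:R * c.
Proof. by rewrite big_const_nat iter_addr_0 subn1 /= mulr_natl. Qed.

Lemma cesaro_cst c N : (0 < N)%N -> cesaro (fun=> c) N = c.
Proof. by move=> N0; rewrite /cesaro sum_nat_cst mulKf// pnatr_eq0 -lt0n. Qed.

Lemma ler_cesaro a b N : (forall n, (0 < n <= N)%N -> a n <= b n) ->
  cesaro a N <= cesaro b N.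
Proof.
move=> h; rewrite ler_wpM2l ?invr_ge0//.
by rewrite !big_nat ler_sum// => n; exact: h.
Qed.

Lemma cesaro_ge0 a N : (forall n, (0 < n <= N)%N -> 0 <= a n) -> 0 <= cesaro a N.
Proof.
move=> h; rewrite mulr_ge0 ?invr_ge0// big_nat sumr_ge0// => n; exact: h.
Qed.

Lemma cesaro_norm a N : `|cesaro a N| <= cesaro (fun n => `|a n|) N.
Proof.
by rewrite normrM ger0_norm ?invr_ge0// ler_wpM2l ?invr_ge0// ler_norm_sum.
Qed.

Lemma cesaro_norm_le M a N : 0 <= M -> (forall n, (0 < n <= N)%N -> `|a n| <= M) ->
  `|cesaro a N| <= M.
Proof.
move=> M0 h; rewrite (le_trans (cesaro_norm _ _))//.
rewrite (le_trans (ler_cesaro h))//.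
case: (posnP N) => [->|N0]; last by rewrite cesaro_cst.
by rewrite /cesaro invr0 mul0r.
Qed.

Lemma cesaroC (F : nat -> nat -> R) N M :
  cesaro (fun n => cesaro (F n) M) N = cesaro (fun m => cesaro (F^~ m) N) M.
Proof.
rewrite /cesaro -mulr_sumr exchange_big mulrCA; congr (_ * _).
by rewrite mulr_sumr.
Qed.

(** Nonnegativity of a variance; at [N = 0] both sides vanish because [0^-1 = 0]. *)
Lemma cesaro_sqr a N : cesaro a N ^+ 2 <= cesaro (fun n => a n ^+ 2) N.
Proof.
case: N => [|N]; first by rewrite /cesaro invr0 !mul0r expr0n.
set A := cesaro a _.
have : 0 <= cesaro (fun n => (a n - A) ^+ 2) N.+1.
  by apply: cesaro_ge0 => n _; rewrite sqr_ge0.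
have -> : (fun n => (a n - A) ^+ 2) =
    (fun n => a n ^+ 2 + (- (2 * A) * a n + A ^+ 2)).
  by apply/funext => n; ring.
rewrite cesaroD cesaroD cesaroZ cesaro_cst// -/A => h.
rewrite -subr_ge0 (le_trans h)// le_eqVlt; apply/orP; left; apply/eqP.
by ring.
Qed.

End Cesaro.

Section Shift.
Variables (R : realType) (V : normedZmodType R).

(** Each unit shift changes the sum by two boundary terms. Values in a normed module cover real
    sequences and, through [Rcomplex], complex ones. *)
Lemma sum_shift_le (B : R) (a : nat -> V) j N : (forall n, `|a n| <= B) ->
  `|\sum_(1 <= n < N.+1) a (n + j)%N - \sum_(1 <= n < N.+1) a n| <= j%:R * 2 * B.
Proof.
move=> aB; elim: j => [|j ih].
  under eq_bigr do rewrite addn0.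
  by rewrite subrr normr0 !mul0r.
have step : \sum_(1 <= n < N.+1) a (n + j.+1)%N - \sum_(1 <= n < N.+1) a (n + j)%N
    = a (N.+1 + j)%N - a j.+1.
  rewrite -sumrB (telescope_sumr_eq (fun k => a (k + j)%N))// => k _.
  by rewrite addSnnS.
rewrite -[X in `|X|](subrKA (\sum_(1 <= n < N.+1) a (n + j)%N)) step.
rewrite (le_trans (ler_normD _ _))// -natr1 !mulrDl mul1r addrC lerD//.
by rewrite (le_trans (ler_normB _ _))// mulr_natl mulr2n lerD.
Qed.

End Shift.

Lemma ncsum_shift_le (R : realType) (B : R) (a : nat -> R[i]) j N :
  (forall n, nc (a n) <= B) ->
  nc (\sum_(1 <= n < N.+1) a (n + j)%N - \sum_(1 <= n < N.+1) a n) <= j%:R * 2 * B.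
Proof. exact: (@sum_shift_le _ (Rcomplex R)). Qed.

Lemma cesaro_shift (R : realType) (B : R) (a : nat -> R) j N :
  (forall n, `|a n| <= B) ->
  `|cesaro (fun n => a (n + j)%N) N - cesaro a N| <= j%:R * 2 * B / N%:R.
Proof.
move=> aB; rewrite -mulrBr normrM [leRHS]mulrC ger0_norm ?invr_ge0//.
by apply: ler_wpM2l; rewrite ?invr_ge0// sum_shift_le.
Qed.

Lemma cvg_nat_inv (R : realType) (c : R) : c / n%:R @[n --> \oo] --> (0 : R).
Proof.
rewrite -[X in _ --> X](mulr0 c); apply: cvgMr.
rewrite -(@cvg_shiftS R). exact: cvg_harmonic.
Qed.

Lemma near_nat_inv (R : realType) (c e : R) : 0 < e ->
  \forall n \near \oo, c / n%:R <= e.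
Proof.
move=> e0; have /cvgr0Pnorm_le/(_ _ e0) := @cvg_nat_inv R c.
apply: filterS => n; exact: le_trans (ler_norm _).
Qed.

Section Mean.
Variable R : realType.

Definition bdd Y (F : Y -> R) := exists M, forall y, `|F y| <= M.

Lemma bddD Y (F G : Y -> R) : bdd F -> bdd G -> bdd (fun y => F y + G y).
Proof.
move=> [M hM] [N hN]; exists (M + N) => y.
by rewrite (le_trans (ler_normD _ _))// lerD.
Qed.

Lemma bddM Y (F G : Y -> R) : bdd F -> bdd G -> bdd (fun y => F y * G y).
Proof. by move=> [M hM] [N hN]; exists (M * N) => y; rewrite normrM ler_pM. Qed.

Lemma bdd_cst Y c : bdd (fun _ : Y => c).
Proof. by exists `|c|. Qed.

Lemma bddZ Y c (F : Y -> R) : bdd F -> bdd (fun y => c * F y).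
Proof. exact/bddM/bdd_cst. Qed.

Lemma bddN Y (F : Y -> R) : bdd F -> bdd (fun y => - F y).
Proof. by case=> M hM; exists M => y; rewrite normrN. Qed.

Lemma bdd_comp Y Z (h : Z -> Y) (F : Y -> R) : bdd F -> bdd (fun z => F (h z)).
Proof. by move=> [M hM]; exists M => z. Qed.

Lemma bdd_sum Y I (s : seq I) (F : I -> Y -> R) : (forall i, bdd (F i)) ->
  bdd (fun y => \sum_(i <- s) F i y).
Proof.
move=> h; elim: s => [|i s ih].
  by under eq_fun do rewrite big_nil; exact: bdd_cst.
by under eq_fun do rewrite big_cons; exact: bddD.
Qed.

Lemma bdd_cesaro Y (F : nat -> Y -> R) N : (forall i, bdd (F i)) ->
  bdd (fun y => cesaro (F^~ y) N).
Proof. by move=> h; apply: bddZ; exact: bdd_sum. Qed.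

(** A finitely additive substitute for an invariant probability measure: no sigma-algebra on [Y] is
    needed, and [L] is constrained on bounded functions only. *)
Record is_mean Y (S : Y -> Y) (L : (Y -> R) -> R) : Prop := IsMean {
  mean1 : L (fun=> 1) = 1;
  meanD : forall F G, bdd F -> bdd G -> L (fun y => F y + G y) = L F + L G;
  meanZ : forall c F, bdd F -> L (fun y => c * F y) = c * L F;
  mean_ge0 : forall F, bdd F -> (forall y, 0 <= F y) -> 0 <= L F;
  meanS : forall F, bdd F -> L (fun y => F (S y)) = L F }.

Section MeanTheory.
Variables (Y : Type) (S : Y -> Y) (L : (Y -> R) -> R) (mL : is_mean S L).

Lemma mean_cst c : L (fun=> c) = c.
Proof.
rewrite -[RHS]mulr1 -(mean1 mL) -(meanZ mL); last exact: bdd_cst.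
by congr L; apply/funext => y; rewrite mulr1.
Qed.

Lemma meanB F G : bdd F -> bdd G -> L (fun y => F y - G y) = L F - L G.
Proof.
move=> bF bG; rewrite (meanD mL)//; last exact: bddN.
congr (_ + _); rewrite -[RHS]mulN1r -(meanZ mL)//.
by congr L; apply/funext => y; rewrite mulN1r.
Qed.

Lemma le_mean F G : bdd F -> bdd G -> (forall y, F y <= G y) -> L F <= L G.
Proof.
move=> bF bG h; rewrite -subr_ge0 -meanB//; apply: (mean_ge0 mL).
  by apply: bddD => //; exact: bddN.
by move=> y; rewrite subr_ge0.
Qed.

Lemma mean_norm_le F M : (forall y, `|F y| <= M) -> `|L F| <= M.
Proof.
move=> h; have bF : bdd F by exists M.
rewrite ler_norml; apply/andP; split.
  rewrite -(mean_cst (- M)); apply: le_mean => //; first exact: bdd_cst.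
  by move=> y; have := h y; rewrite ler_norml => /andP[].
rewrite -(mean_cst M); apply: le_mean => //; first exact: bdd_cst.
by move=> y; rewrite (le_trans (ler_norm _)).
Qed.

Lemma mean_sum I (s : seq I) (F : I -> Y -> R) : (forall i, bdd (F i)) ->
  L (fun y => \sum_(i <- s) F i y) = \sum_(i <- s) L (F i).
Proof.
move=> h; elim: s => [|i s ih].
  by under eq_fun do rewrite big_nil; rewrite mean_cst big_nil.
under eq_fun do rewrite big_cons.
by rewrite big_cons (meanD mL)//; [rewrite ih | exact: bdd_sum].
Qed.

Lemma mean_cesaro (F : nat -> Y -> R) N : (forall i, bdd (F i)) ->
  L (fun y => cesaro (F^~ y) N) = cesaro (fun n => L (F n)) N.
Proof.
by move=> h; rewrite (meanZ mL) ?mean_sum//; exact: bdd_sum.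
Qed.

Lemma mean_iter n F : bdd F -> L (fun y => F (iter n S y)) = L F.
Proof.
move=> bF; elim: n => [//|n ih]; rewrite -[RHS]ih -[RHS](meanS mL).
  by congr L; apply/funext => y; rewrite iterSr.
exact: bdd_comp.
Qed.

Section Ergodic.
Variables (F : Y -> R) (B : R) (FB : forall y, `|F y| <= B).

Let B0 : Y -> 0 <= B. Proof. by move=> y; exact: le_trans (FB y). Qed.

Let E (G : Y -> R) N y := cesaro (fun n => G (iter n S y)) N.

Let E_le G N : (forall y, `|G y| <= B) -> forall y, `|E G N y| <= B.
Proof. by move=> h y; apply: cesaro_norm_le => //; exact: B0. Qed.

Let q G := L (fun y => G y ^+ 2).

Let bdd_sqr (G : Y -> R) : bdd G -> bdd (fun y => G y ^+ 2).
Proof. by move=> bG; apply: bddM. Qed.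

Let q_E G N : (forall y, `|G y| <= B) -> (0 < N)%N -> q (E G N) <= q G.
Proof.
move=> GB N0; have bG : bdd G by exists B.
have bi i : bdd (fun y => G (iter i S y) ^+ 2) by apply/bdd_sqr/bdd_comp.
rewrite /q (@le_trans _ _ (L (fun y => cesaro (fun n => G (iter n S y) ^+ 2) N)))//.
  apply: le_mean; first by apply: bdd_sqr; exists B; exact: E_le.
  - exact: bdd_cesaro.
  - by move=> y; exact: cesaro_sqr.
rewrite mean_cesaro//.
under [X in cesaro X _]eq_fun do rewrite (mean_iter _ (bdd_sqr bG)).
by rewrite cesaro_cst.
Qed.

Let q_close G H d : (forall y, `|G y| <= B) -> (forall y, `|H y| <= B) ->
  (forall y, `|G y - H y| <= d) -> q G <= q H + 2 * B * d.
Proof.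
move=> GB HB GH.
have bG : bdd (fun y => G y ^+ 2) by apply: bdd_sqr; exists B.
have bH : bdd (fun y => H y ^+ 2) by apply: bdd_sqr; exists B.
rewrite -lerBlDl -meanB//.
apply: (le_trans (ler_norm _)); apply: mean_norm_le => y.
rewrite subr_sqr mulrC normrM ler_pM//.
by rewrite (le_trans (ler_normD _ _))// mulr_natl mulr2n lerD.
Qed.

(** Functions whose ergodic averages agree with those of [F] up to [O(1/N)]. The class contains the
    averages of [F] and their midpoints, and replaces the closed convex hull of the orbit in von
    Neumann's proof, so that no completion is required. *)
Let shadow c G := (forall y, `|G y| <= B) /\
  forall N y, `|E G N y - E F N y| <= c / N%:R.

Let shadow_E M : (0 < M)%N -> shadow (M%:R * 2 * B) (E F M).
Proof.
move=> M0; split; first exact: E_le.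
move=> N y; rewrite /E cesaroC -[X in _ - X](cesaro_cst _ M0) -cesaroB.
have B0' := B0 y.
apply: cesaro_norm_le => [|m /andP[m0 mM]]; first by rewrite !mulr_ge0 ?invr_ge0.
under eq_fun do rewrite -iterD addnC.
rewrite (le_trans (cesaro_shift m N (B := B) _))//.
by rewrite ler_wpM2r ?invr_ge0// !ler_wpM2r// ler_nat.
Qed.

Let shadow_q c G N : shadow c G -> (0 < N)%N ->
  q (E F N) <= q G + 2 * B * (c / N%:R).
Proof.
move=> [GB h] N0.
apply: (@le_trans _ _ (q (E G N) + 2 * B * (c / N%:R))).
  apply: q_close; try exact: E_le.
  by move=> y; rewrite distrC.
by rewrite lerD2r q_E.
Qed.

Let d := inf [set q (E F M) | M in [set M | (0 < M)%N]].

Let has_inf_d : has_inf [set q (E F M) | M in [set M | (0 < M)%N]].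
Proof.
split; first by exists (q (E F 1)), 1%N.
exists 0 => _ [M M0 <-]; apply: (mean_ge0 mL).
  by apply: bdd_sqr; exists B; exact: E_le.
by move=> y; exact: sqr_ge0.
Qed.

(** Averaging does not increase [q], and the averages of a shadow approach those of [F]. *)
Let d_le c G : shadow c G -> d <= q G.
Proof.
move=> sG; apply/ler_addgt0Pr => e e0.
have [N [N0 hN]] : exists N, (0 < N)%N /\ 2 * B * c / N%:R <= e.
  have [N _ h] := near_nat_inv (2 * B * c) e0.
  by exists N.+1; split => //; apply: h => /=.
apply: (@le_trans _ _ (q (E F N))).
  by apply: ge_inf; [exact: has_inf_d.2 | exists N].
by rewrite (le_trans (shadow_q sG N0))// mulrA lerD2l.
Qed.

(** One nearly minimal average [E F M] controls all later ones, because it is itself a shadow. *)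
Let d_ge e : 0 < e -> \forall N \near \oo, (0 < N)%N /\ q (E F N) <= d + e.
Proof.
move=> e0; have e20 : 0 < e / 2 by rewrite divr_gt0.
have [_ [M M0 <-] hM] := inf_adherent e20 has_inf_d.
near=> N; have N0 : (0 < N)%N by near: N; exists 1%N.
split=> //.
rewrite (le_trans (shadow_q (shadow_E M0) N0))//.
have : 2 * B * (M%:R * 2 * B) / N%:R <= e / 2.
  by near: N; exact: near_nat_inv.
rewrite -/d in hM; rewrite !mulrA => h; lra.
Unshelve. all: by end_near. Qed.

Let q_par U V : bdd U -> bdd V ->
  q (fun y => 2^-1 * U y + 2^-1 * V y) =
  2^-1 * q U + 2^-1 * q V - 4^-1 * q (fun y => U y - V y).
Proof.
move=> bU bV; have bUV : bdd (fun y => U y - V y) by apply/bddD => //; exact: bddN.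
rewrite /q -!(meanZ mL) -?(meanD mL) -?meanB;
  do ?[exact: bdd_sqr|apply: bddD|apply: bddZ] => //.
by congr L; apply/funext => y; field.
Qed.

(** Parallelogram identity: the midpoint of two averages is a shadow, so its [q] cannot fall below
    [d]. *)
Let q_diff N M e : (0 < N)%N -> (0 < M)%N -> q (E F N) <= d + e ->
  q (E F M) <= d + e -> q (fun y => E F N y - E F M y) <= 4 * e.
Proof.
move=> N0 M0 hN hM.
have [NB sN] := shadow_E N0; have [MB sM] := shadow_E M0.
pose G y := 2^-1 * E F N y + 2^-1 * E F M y.
have sG : shadow (2^-1 * (N%:R * 2 * B) + 2^-1 * (M%:R * 2 * B)) G.
  split=> [y|K y].
    rewrite (le_trans (ler_normD _ _))// !(normrM 2^-1) ger0_norm ?invr_ge0//.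
    by have := NB y; have := MB y; lra.
  rewrite /E cesaroD (cesaroZ 2^-1) [X in _ + X - _](cesaroZ 2^-1) -/(E (E F N) K y) -/(E (E F M) K y) -/(E F K y).
  have := sN K y; have := sM K y; rewrite !ler_norml mulrDl.
  rewrite -!(mulrA 2^-1); lra.
have := d_le sG.
have bE K : bdd (E F K) by exists B; exact: E_le.
rewrite /G q_par//; lra.
Qed.

(** The averages [E F N] are Cauchy for the quadratic form [q], and pairing with [F] turns this into
    a Cauchy sequence of numbers. *)
Lemma mean_ergodic :
  cvgn (cesaro (fun n => L (fun y => F y * F (iter n S y)))).
Proof.
(* The sign of [B] is read off at a point of [Y]; without points all functions coincide and every
   mean is that of [0]. *)
have [y0|noY] := pselect (exists y : Y, True); last first.
  have cst0 (G : Y -> R) : L G = 0.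
    rewrite -[RHS](mean_cst 0); congr L; apply/funext => y.
    by exfalso; apply: noY; exists y.
  apply: (cvgP 0); rewrite [X in X @ _](_ : _ = cst 0); first exact: cvg_cst.
  by apply/funext => n; rewrite /cesaro big1 ?mulr0// => i _; exact: cst0.
have {y0}B0' : 0 <= B by case: y0 => y _; exact: B0.
have bF : bdd F by exists B.
have bFi n : bdd (fun y => F (iter n S y)) by exact: bdd_comp.
have bE K : bdd (E F K) by exists B; exact: E_le.
have cE N : cesaro (fun n => L (fun y => F y * F (iter n S y))) N =
    L (fun y => F y * E F N y).
  rewrite -mean_cesaro; last by move=> n; exact: bddM.
  by congr L; apply/funext => y; rewrite -cesaroZ.
apply/cauchy_cvgP; apply: cauchy_exP => e e0.
(* The weight in [F D <= t F^2 / 2 + D^2 / (2 t)], small enough for the first term to be at most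
   [e / 4]; the second is then [e / 4] by [key]. *)
pose t := e / 2 / (B ^+ 2 + 1).
have B21 : 0 < B ^+ 2 + 1 by rewrite ltr_wpDl ?sqr_ge0.
have t0 : 0 < t by rewrite !divr_gt0.
have te : 0 < t * (e / 2) / 4 by rewrite divr_gt0// mulr_gt0// divr_gt0.
have [N0 _ hN0] := d_ge te.
exists (cesaro (fun n => L (fun y => F y * F (iter n S y))) N0).
exists N0 => // N /hN0[N_gt0 hN].
have [N0_gt0 h0] := hN0 _ (leqnn N0).
rewrite /= /ball /= !cE -meanB; try exact: bddM.
have key : q (fun y => E F N0 y - E F N y) <= t * (e / 2).
  by have := q_diff N0_gt0 N_gt0 h0 hN; lra.
have bD : bdd (fun y => E F N0 y - E F N y).
  by apply: bddD => //; exact: bddN.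
have bFD : bdd (fun y => F y * (E F N0 y - E F N y)) by exact: bddM.
(* The signs [s = 1] and [s = -1] give the two halves of the bound on the absolute value. *)
have bnd s : s ^+ 2 = 1 ->
    s * L (fun y => F y * (E F N0 y - E F N y)) <= e / 2.
  move=> s1; rewrite -(meanZ mL)//.
  apply: (@le_trans _ _ (t * B ^+ 2 / 2 + (2 * t)^-1 * (t * (e / 2)))).
    rewrite -{1}(mean_cst (t * B ^+ 2 / 2)).
    apply: (le_trans _ (lerD (lexx _) (ler_wpM2l _ key))); last first.
      by rewrite invr_ge0 mulr_ge0// ltW.
    rewrite -(meanZ mL) -?(meanD mL) ?mean_cst//;
      [|exact: bdd_cst|exact/bddZ/bdd_sqr|exact: bdd_sqr].
    apply: le_mean; [exact/bddZ|apply: bddD; [exact: bdd_cst|exact/bddZ/bdd_sqr]|].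
    move=> y; set D := _ - _.
    have F2 : F y ^+ 2 <= B ^+ 2.
      by rewrite -real_normK ?num_real// lerXn2r ?nnegrE.
    have : 0 <= (t * F y - s * D) ^+ 2 by exact: sqr_ge0.
    have -> : (t * F y - s * D) ^+ 2 =
        2 * t * (t * F y ^+ 2 / 2 + (2 * t)^-1 * D ^+ 2 - s * (F y * D))
        + (s ^+ 2 - 1) * D ^+ 2.
      by field; rewrite gt_eqF.
    rewrite s1 subrr mul0r addr0 pmulr_rge0; last by rewrite mulr_gt0.
    rewrite subr_ge0 => /le_trans; apply; rewrite lerD2r.
    by rewrite ler_wpM2r// ler_wpM2l// ltW.
  have -> : (2 * t)^-1 * (t * (e / 2)) = e / 4 by field; rewrite gt_eqF.
  have : t * B ^+ 2 <= e / 2.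
    by rewrite /t mulrAC ler_pdivrMr// ler_wpM2l ?divr_ge0 ?ltW// ltrDl.
  lra.
have h1 := bnd 1 (expr1n _ _); have h2 := bnd (-1) (sqrr_sign _ 1).
rewrite (@le_lt_trans _ _ (e / 2))//; last by rewrite ltr_pdivrMr// ltr_pMr// ltr1n.
under [X in `|L X|]eq_fun do rewrite -mulrBr.
by rewrite ler_norml; lra.
Qed.

End Ergodic.
End MeanTheory.
End Mean.

(** * Means built from ultrafilter limits *)

Section UltraLimit.
Variables (R : realType) (U : set_system nat).
Context {UU : UltraFilter U}.
Hypothesis UN : \oo `<=` U.

Definition ulim (a : nat -> R) : R := lim (a @ U).

(** The limit is the supremum of the levels that [a] reaches [U]-almost everywhere; the ultrafilter
    property is what keeps [a] from exceeding it. *)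
Lemma ultra_cvg (a : nat -> R) : bdd a -> cvg (a @ U).
Proof.
move=> [M aM]; pose A := [set r | U [set n | r <= a n]].
have UT : U setT by exact: filterT.
have hA : has_sup A.
  split.
    exists (- M); rewrite /A /=; apply: filterS UT => n _ /=.
    by have := aM n; rewrite ler_norml => /andP[].
  exists M => r; rewrite /A /= => Ur.
  have [n /= rn] := filter_ex Ur.
  by rewrite (le_trans rn)// (le_trans (ler_norm _)).
apply: (cvgP (sup A)); apply/cvgrPdist_le => e e0.
have [r Ar hr] := sup_adherent e0 hA.
have Ue : U [set n | a n < sup A + e].
  have [//|h] := in_ultra_setVsetC [set n | a n < sup A + e] UU.
  have /(ub_le_sup hA.2) : A (sup A + e).
    by apply: filterS h => n /= /negP; rewrite -leNgt.
  by rewrite gerDl leNgt e0.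
have : U [set n | r <= a n] by [].
apply: filterS2 Ue => n /= h1 h2.
rewrite ler_norml; apply/andP; split.
  by rewrite lerBrDr addrC -lerBrDr opprK ltW.
by rewrite lerBlDr -lerBlDl ltW// (lt_le_trans hr).
Qed.

Lemma ulim_cvgn a l : a n @[n --> \oo] --> l -> ulim a = l.
Proof.
move=> al; apply: cvg_lim => //.
by apply: cvg_trans al; apply: cvg_fmap2.
Qed.

Lemma ulimD a b : bdd a -> bdd b -> ulim (fun n => a n + b n) = ulim a + ulim b.
Proof. by move=> /ultra_cvg ha /ultra_cvg hb; exact: limD. Qed.

Lemma ulimZ c a : bdd a -> ulim (fun n => c * a n) = c * ulim a.
Proof. by move=> /ultra_cvg ha; apply: cvg_lim => //; exact: cvgMr. Qed.

Lemma ulim_ge0 a : bdd a -> (forall n, 0 <= a n) -> 0 <= ulim a.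
Proof. by move=> /ultra_cvg ha h; apply: limr_ge => //; exact: nearW. Qed.

End UltraLimit.

Section MeanConstructions.
Variables (R : realType) (U : set_system nat).
Context {UU : UltraFilter U}.
Hypothesis UN : \oo `<=` U.

Lemma bdd_cesaro_seq (a : nat -> R) : bdd a -> bdd (cesaro a).
Proof.
move=> [M aM]; exists M => N; apply: cesaro_norm_le => //.
by rewrite (le_trans _ (aM 0%N)).
Qed.

Lemma bdd_mean Y S L I (F : I -> Y -> R) M : is_mean S L ->
  (forall i y, `|F i y| <= M) -> bdd (fun i => L (F i)).
Proof. by move=> mL h; exists M => i; exact: mean_norm_le mL _ _ _. Qed.

Lemma bdd_near0 (a : nat -> R) : bdd a -> ulim U (fun n => a n / n%:R) = 0.
Proof.
move=> [M aM]; apply: ulim_cvgn => //.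
apply: (@squeeze_cvgr _ _ _ _ (fun n => - (M / n%:R)) (fun n => M / n%:R)).
- apply: nearW => n; have := aM n.
  by rewrite -ler_norml normrM (ger0_norm (x := _^-1))// => ?; rewrite ler_wpM2r.
- by rewrite -oppr0; apply: cvgN; exact: cvg_nat_inv.
- exact: cvg_nat_inv.
Qed.

Lemma ulim_cesaro_shift (a : nat -> R) : bdd a ->
  ulim U (cesaro (fun n => a n.+1)) = ulim U (cesaro a).
Proof.
move=> ba; have [M aM] := ba.
have b1 : bdd (fun n => a n.+1) by exact: bdd_comp.
apply/subr0_eq; rewrite -mulN1r -ulimZ; last exact: bdd_cesaro_seq.
rewrite -ulimD; [|exact: bdd_cesaro_seq|by apply: bddZ; exact: bdd_cesaro_seq].
rewrite -[RHS](@bdd_near0 (fun N => a N.+1 - a 1%N)); last first.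
  by apply: bddD => //; exact: bdd_cst.
congr ulim; apply/funext => N.
rewrite mulN1r /cesaro -mulrBr mulrC; congr (_ * _).
by rewrite -sumrB (telescope_sumr_eq a).
Qed.

Definition int_mean (w : int -> R) := ulim U (cesaro (fun n => w n%:Z)).

Lemma int_mean_is_mean : is_mean (fun m : int => m + 1) int_mean.
Proof.
split => [|F G bF bG|c F bF|F bF F0|F bF].
- rewrite /int_mean; apply: ulim_cvgn => //.
  apply: (@cvg_trans _ ((fun=> 1) @ \oo)); last exact: cvg_cst.
  by apply: near_eq_cvg; near=> n; rewrite cesaro_cst//; near: n; exists 1%N.
- rewrite -ulimD; try by apply/bdd_cesaro_seq/bdd_comp.
  by congr ulim; apply/funext => N; exact: cesaroD.
- rewrite -ulimZ; last by apply/bdd_cesaro_seq/bdd_comp.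
  by congr ulim; apply/funext => N; exact: cesaroZ.
- apply: ulim_ge0; first by apply/bdd_cesaro_seq/bdd_comp.
  by move=> n; exact: cesaro_ge0.
- rewrite -[RHS](ulim_cesaro_shift (a := fun n => F n%:Z)); last exact: bdd_comp.
  congr ulim; apply/funext => N; congr cesaro; apply/funext => n.
  by rewrite -addn1 PoszD.
Unshelve. all: by end_near. Qed.

Lemma prod_mean Y S L : @is_mean R Y S L ->
  is_mean (fun y : Y * Y => (S y.1, S y.2))
    (fun F => L (fun y' => L (fun y => F (y, y')))).
Proof.
move=> mL.
have b1 (F : Y * Y -> R) y' : bdd F -> bdd (fun y => F (y, y')) by exact: bdd_comp.
have b2 (F : Y * Y -> R) : bdd F -> bdd (fun y' => L (fun y => F (y, y'))).
  by move=> [M FM]; apply: (bdd_mean (M := M) mL) => *; exact: FM.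
split => [|F G bF bG|c F bF|F bF F0|F bF].
- by rewrite !(mean1 mL).
- rewrite -(meanD mL); try exact: b2.
  by congr L; apply/funext => y'; rewrite (meanD mL)//; exact: b1.
- rewrite -(meanZ mL); try exact: b2.
  by congr L; apply/funext => y'; rewrite (meanZ mL)//; exact: b1.
- apply: (mean_ge0 mL); first exact: b2.
  by move=> y'; apply: (mean_ge0 mL); first exact: b1.
- rewrite -[RHS](meanS mL); last exact: b2.
  congr L; apply/funext => y' /=.
  by rewrite -[RHS](meanS mL)//; exact: b1.
Qed.

(** The analogue of the self-joinings behind cube measures: means on the graphs of [iter n S],
    averaged over [n]. Relative products over invariant functions would need conditional
    expectations, which a finitely additive mean does not offer. *)
Lemma graph_mean Y S L : @is_mean R Y S L ->
  is_mean (fun y : Y * Y => (S y.1, S y.2))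
    (fun F => ulim U (cesaro (fun n => L (fun y => F (y, iter n S y))))).
Proof.
move=> mL.
have b1 (F : Y * Y -> R) n : bdd F -> bdd (fun y => F (y, iter n S y)).
  by exact: bdd_comp.
have b2 (F : Y * Y -> R) : bdd F ->
    bdd (cesaro (fun n => L (fun y => F (y, iter n S y)))).
  move=> [M FM]; apply: bdd_cesaro_seq.
  by apply: (bdd_mean (M := M) mL) => *; exact: FM.
split => [|F G bF bG|c F bF|F bF F0|F bF].
- rewrite (mean1 mL); exact: (mean1 int_mean_is_mean).
- rewrite -ulimD; try exact: b2.
  congr ulim; apply/funext => N; rewrite -cesaroD; congr cesaro.
  by apply/funext => n; rewrite (meanD mL)//; exact: b1.
- rewrite -ulimZ; try exact: b2.
  congr ulim; apply/funext => N; rewrite -cesaroZ; congr cesaro.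
  by apply/funext => n; rewrite (meanZ mL)//; exact: b1.
- apply: ulim_ge0; first exact: b2.
  move=> N; apply: cesaro_ge0 => n _.
  by apply: (mean_ge0 mL); first exact: b1.
- congr ulim; apply/funext => N; congr cesaro; apply/funext => n.
  rewrite -[RHS](meanS mL); last exact: b1.
  by congr L; apply/funext => y /=; rewrite -iterSr -iterS.
Qed.

End MeanConstructions.

(** * Local seminorms of a sequence *)

Section LocalSeminorm.
Variable R : realType.
Implicit Types u v : int -> R[i].

Definition le1 u := forall m, nc (u m) <= 1.

Definition conju u : int -> R[i] := fun m => conjc (u m).
Definition shiftu (h : int) u : int -> R[i] := fun m => u (m + h).
Definition delta (h h' : int) u : int -> R[i] := fun m => u (m + h) * conjc (u (m + h')).

(* [lseminorm k u] plays the role of the [2^(k+1)]-th power of the seminorm of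
   order [k+1] of the sequence [u]. *)
Fixpoint lseminorm (k : nat) u : R :=
  match k with
  | 0 => limn (cesaro (fun n => Re (u n%:Z))) ^+ 2
         + limn (cesaro (fun n => Im (u n%:Z))) ^+ 2
  | k.+1 => limn (cesaro (fun n => lseminorm k (delta n%:Z 0 u)))
  end.

(* Only the innermost averages are required to converge; the limits defining
   [lseminorm] at the higher levels then exist, see [lseminorm_cvg]. *)
Fixpoint good (k : nat) u : Prop :=
  match k with
  | 0 => cvgn (cesaro (fun n => Re (u n%:Z))) /\ cvgn (cesaro (fun n => Im (u n%:Z)))
  | k.+1 => forall h h', good k (delta h h' u)
  end.

Lemma le1_delta h h' u : le1 u -> le1 (delta h h' u).
Proof. by move=> u1 m; rewrite ncM ncJ mulr_ile1 ?nc_ge0. Qed.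

Lemma delta0 (n : int) u : delta n 0 u = fun m => conjc (u m) * shiftu n u m.
Proof. by apply/funext => m; rewrite /delta addr0 mulrC. Qed.

Lemma bddRe Y (t : Y -> R[i]) : (forall y, nc (t y) <= 1) -> bdd (fun y => Re (t y)).
Proof. by move=> h; exists 1 => y; rewrite (le_trans (nc_Re _)). Qed.

Lemma bddIm Y (t : Y -> R[i]) : (forall y, nc (t y) <= 1) -> bdd (fun y => Im (t y)).
Proof. by move=> h; exists 1 => y; rewrite (le_trans (nc_Im _)). Qed.

(* [t] stands for the [2^(k+1)]-fold tensor power of [u], with conjugations. *)
Definition cube_model k Y (S : Y -> Y) (L : (Y -> R) -> R)
    (t : (int -> R[i]) -> Y -> R[i]) : Prop :=
  [/\ is_mean S L,
      forall u v y, t (fun m => conjc (u m) * v m) y = conjc (t u y) * t v y,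
      forall u (n : nat) y, t (shiftu n%:Z u) y = t u (iter n S y),
      forall u, le1 u -> forall y, nc (t u y) <= 1 &
      forall u, le1 u -> good k u -> lseminorm k u = L (fun y => Re (t u y))].

Lemma cube_model_delta k Y S L t u n : @cube_model k Y S L t -> le1 u -> good k.+1 u ->
  lseminorm k (delta n%:Z 0 u) =
    L (fun y => Re (t u y) * Re (t u (iter n S y))) +
    L (fun y => Im (t u y) * Im (t u (iter n S y))).
Proof.
move=> [mL tM tS t1 tL] u1 gu.
rewrite (tL _ (le1_delta _ _ u1) (gu _ _)).
have bR := bddRe (t1 _ u1); have bI := bddIm (t1 _ u1).
rewrite -(meanD mL);
  [|by apply: bddM => //; exact: (bdd_comp (iter n S) bR)
   |by apply: bddM => //; exact: (bdd_comp (iter n S) bI)].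
congr L; apply/funext => y; rewrite delta0 tM tS ReM ReJ ImJ; ring.
Qed.

(** In the model the averages become correlation averages of [Re (t u)] and [Im (t u)], to which
    [mean_ergodic] applies. *)
Lemma cube_model_cvg k Y S L t u : @cube_model k Y S L t -> le1 u -> good k.+1 u ->
  cvgn (cesaro (fun n => lseminorm k (delta n%:Z 0 u))).
Proof.
move=> ct u1 gu; have [mL _ _ t1 _] := ct.
have hR y : `|Re (t u y)| <= 1 by rewrite (le_trans (nc_Re _)) ?t1.
have hI y : `|Im (t u y)| <= 1 by rewrite (le_trans (nc_Im _)) ?t1.
have cR := mean_ergodic mL hR; have cI := mean_ergodic mL hI.
rewrite [X in cvgn X](_ : _ =
    (cesaro (fun n => L (fun y => Re (t u y) * Re (t u (iter n S y)))) \+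
    cesaro (fun n => L (fun y => Im (t u y) * Im (t u (iter n S y)))))).
  exact: is_cvgD.
apply/funext => N /=; rewrite -cesaroD; congr cesaro; apply/funext => n.
exact: (cube_model_delta n ct).
Qed.

(** At level 0 the squared modulus of a mean is a double mean on pairs of integers; each further
    level is a graph mean on pairs of points of the previous model. *)
Lemma cube_mean k : exists (Y : Type) (S : Y -> Y) (L : (Y -> R) -> R)
    (t : (int -> R[i]) -> Y -> R[i]), cube_model k S L t.
Proof.
have [U [UU UN]] := ultraFilterLemma (eventually_filter).
elim: k => [|k [Y [S [L [t ct]]]]].
- have mL : is_mean (fun m : int => m + 1) (int_mean (R := R) U).
    exact: int_mean_is_mean.
  exists (int * int)%type, (fun y => (y.1 + 1, y.2 + 1)),
    (fun F => int_mean U (fun y' => int_mean U (fun y => F (y, y')))),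
    (fun u y => u y.1 * conjc (u y.2)); split.
  + exact: (prod_mean mL).
  + by move=> u v [m m'] /=; rewrite !rmorphM/= !conjcK; ring.
  + move=> u n [m m'] /=; rewrite /shiftu.
    have -> : iter n (fun y : int * int => (y.1 + 1, y.2 + 1)) (m, m') =
        (m + n%:Z, m' + n%:Z).
      elim: n => [|n ih]; first by rewrite !addr0.
      by rewrite iterS ih /= -!addrA -PoszD addn1.
    by [].
  + by move=> u u1 y; rewrite ncM ncJ mulr_ile1 ?nc_ge0.
  + move=> u u1 [cR cI] /=.
    have bR := bddRe u1; have bI := bddIm u1.
    have eR : int_mean U (fun m => Re (u m)) = limn (cesaro (fun n => Re (u n%:Z))).
      exact: ulim_cvgn.
    have eI : int_mean U (fun m => Im (u m)) = limn (cesaro (fun n => Im (u n%:Z))).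
      exact: ulim_cvgn.
    rewrite -eR -eI.
    have e1 y' : int_mean U (fun y => Re (u y * conjc (u y'))) =
        int_mean U (fun m => Re (u m)) * Re (u y') +
        int_mean U (fun m => Im (u m)) * Im (u y').
      rewrite [X in _ = X + _]mulrC [X in _ = _ + X]mulrC.
      rewrite -!(meanZ mL)// -(meanD mL); try exact: bddZ.
      congr (int_mean U _); apply/funext => m.
      by rewrite ReM ReJ ImJ; ring.
    rewrite [X in _ = int_mean U X](funext e1).
    by rewrite (meanD mL) ?(meanZ mL)//; exact: bddZ.
- have [mL tM tS t1 tL] := ct.
  exists (Y * Y)%type, (fun y => (S y.1, S y.2)),
    (fun F => ulim U (cesaro (fun n => L (fun y => F (y, iter n S y))))),
    (fun u y => conjc (t u y.1) * t u y.2); split.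
  + exact: (graph_mean UN mL).
  + by move=> u v [m m'] /=; rewrite !tM !rmorphM/=; ring.
  + move=> u n [m m'] /=.
    have -> : iter n (fun y : Y * Y => (S y.1, S y.2)) (m, m') =
        (iter n S m, iter n S m').
      by elim: n => [//|n ih]; rewrite iterS ih.
    by rewrite !tS.
  + by move=> u u1 y; rewrite ncM ncJ mulr_ile1 ?nc_ge0 ?t1.
  + move=> u u1 gu /=.
    have e' n : L (fun y => Re (conjc (t u y) * t u (iter n S y))) =
        lseminorm k (delta n%:Z 0 u).
      rewrite (tL _ (le1_delta _ _ u1) (gu _ _)).
      by congr L; apply/funext => y; rewrite delta0 tM tS.
    under [in RHS]eq_fun do rewrite e'.
    (* The model of the previous level shows that the averages converge, so the ultrafilter limit is
       the ordinary one. *)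
    symmetry; apply: ulim_cvgn => //.
    exact: (cube_model_cvg ct).
Qed.

Lemma lseminorm_cvg k u : le1 u -> good k.+1 u ->
  cvgn (cesaro (fun n => lseminorm k (delta n%:Z 0 u))).
Proof. by have [Y [S [L [t ct]]]] := cube_mean k; exact: (cube_model_cvg ct). Qed.

Lemma lseminorm_ge0 k u : le1 u -> good k u -> 0 <= lseminorm k u.
Proof.
elim: k u => [|k ih] u u1 gu; first by rewrite addr_ge0 ?sqr_ge0.
apply: limr_ge; first exact: lseminorm_cvg.
apply: nearW => N; apply: cesaro_ge0 => n _.
by apply: ih; [exact: le1_delta|exact: gu].
Qed.

Lemma lseminorm_le1 k u : le1 u -> good k u -> lseminorm k u <= 1.
Proof.
move=> u1 gu; have [Y [S [L [t [mL _ _ t1 ->//]]]]] := cube_mean k.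
rewrite (le_trans (ler_norm _))//; apply: (mean_norm_le mL) => y.
by rewrite (le_trans (nc_Re _)) ?t1.
Qed.

Lemma delta_shift h h' c u : delta h h' (shiftu c u) = shiftu c (delta h h' u).
Proof.
by apply/funext => m; rewrite /delta /shiftu (addrAC m h) (addrAC m h').
Qed.

Lemma delta_conj h h' u : delta h h' (conju u) = conju (delta h h' u).
Proof. by apply/funext => m; rewrite /delta /conju rmorphM. Qed.

Lemma delta_swap h h' u : delta h h' u = conju (delta h' h u).
Proof. by apply/funext => m; rewrite /delta /conju rmorphM/= conjcK mulrC. Qed.

Lemma delta_shift0 h h' u : delta h h' u = shiftu h' (delta (h - h') 0 u).
Proof. by apply/funext => m; rewrite /delta /shiftu addr0 -addrA subrKC. Qed.

Lemma le1_shift c u : le1 u -> le1 (shiftu c u). Proof. by move=> h m; exact: h. Qed.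

Lemma cesaro_ishift (w : int -> R) (c : int) : bdd w ->
  (fun N => cesaro (fun n => w (n%:Z + c)) N - cesaro (fun n => w n%:Z) N) @ \oo --> (0 : R).
Proof.
have pos (v : int -> R) (j : nat) : bdd v ->
    (fun N => cesaro (fun n => v (n%:Z + j%:Z)) N - cesaro (fun n => v n%:Z) N)
    @ \oo --> (0 : R).
  move=> [M wM].
  apply: (@squeeze_cvgr _ _ _ _ (fun n => - (j%:R * 2 * M / n%:R)) (fun n => j%:R * 2 * M / n%:R)).
  - apply: nearW => N; rewrite -ler_norml.
    under [X in cesaro X _ - _]eq_fun do rewrite -PoszD.
    exact: (cesaro_shift j N (a := fun n => v n%:Z)).
  - by rewrite -oppr0; apply: cvgN; exact: cvg_nat_inv.
  - exact: cvg_nat_inv.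
case: c => [j|j]; first exact: pos.
move=> bw; have /(pos _ j.+1) : bdd (fun m => w (m + Negz j)) by exact: bdd_comp.
move=> /cvgN; rewrite oppr0; apply: cvg_trans; apply: near_eq_cvg.
apply: nearW => N; rewrite /= opprB; congr (_ - cesaro _ _).
by apply/funext => n; congr w; rewrite NegzE addrK.
Qed.

Lemma cesaro_ishift_cvg (w : int -> R) (c : int) (l : R) : bdd w ->
  cesaro (fun n => w n%:Z) @ \oo --> l ->
  cesaro (fun n => w (n%:Z + c)) @ \oo --> l.
Proof.
move=> /(cesaro_ishift c) h1 h2; have /(_ _) {h1 h2} := cvgD h1 h2; rewrite add0r => h.
apply: cvg_trans h; apply: near_eq_cvg; apply: nearW => N /=.
by rewrite subrK.
Qed.

Lemma good_shift k c u : le1 u -> good k u -> good k (shiftu c u).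
Proof.
elim: k u => [|k ih] u u1 /=; last first.
  by move=> gu h h'; rewrite delta_shift; apply: ih => //; exact: le1_delta.
have bR := bddRe u1; have bI := bddIm u1.
by move=> [/(cesaro_ishift_cvg c bR)/cvgP ? /(cesaro_ishift_cvg c bI)/cvgP].
Qed.

Lemma lseminorm_shift k c u : le1 u -> good k u -> lseminorm k (shiftu c u) = lseminorm k u.
Proof.
elim: k u => [|k ih] u u1 gu /=; last first.
  congr (limn (cesaro _)); apply/funext => n.
  by rewrite delta_shift (ih _ (le1_delta _ _ u1) (gu _ _)).
have bR := bddRe u1; have bI := bddIm u1; case: gu.
by move=> /(cesaro_ishift_cvg c bR)/cvg_lim-> // /(cesaro_ishift_cvg c bI)/cvg_lim->.
Qed.

Lemma lseminorm_conj k u : good k u -> lseminorm k (conju u) = lseminorm k u.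
Proof.
elim: k u => [|k ih] u gu /=; last first.
  congr (limn (cesaro _)); apply/funext => n.
  by rewrite delta_conj (ih _ (gu _ _)).
congr (_ + _); first by congr (limn (cesaro _) ^+ 2); apply/funext => n; rewrite ReJ.
rewrite [X in limn X](_ : _ = fun N => - cesaro (fun n => Im (u n%:Z)) N); last first.
  apply/funext => N; rewrite -cesaroN; congr cesaro; apply/funext => n.
  by rewrite /conju ImJ.
by rewrite limN ?sqrrN//; case: gu.
Qed.

(** Shift and conjugation invariance. The double averages over [h] and [h'] produced by van der
    Corput thereby reduce to averages over a distance. *)
Lemma lseminorm_delta k (h h' : int) u : le1 u -> good k.+1 u ->
  lseminorm k (delta h h' u) = lseminorm k (delta `|h - h'|%N%:Z 0 u).
Proof.
move=> u1 gu; have D1 a b : le1 (delta a b u) by exact: le1_delta.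
have [hh|hh] := leP h' h.
  rewrite delta_shift0 (lseminorm_shift _ (D1 _ _) (gu _ _)).
  by rewrite gez0_abs// subr_ge0.
rewrite delta_swap (lseminorm_conj (gu _ _)).
rewrite delta_shift0 (lseminorm_shift _ (D1 _ _) (gu _ _)).
by rewrite -abszN opprB gez0_abs// subr_ge0 ltW.
Qed.

Definition scaleu (c : R) u : int -> R[i] := fun m => c%:C%C * u m.

Let conjcM (x y : R[i]) : conjc (x * y) = conjc x * conjc y.
Proof. exact: rmorphM. Qed.

Lemma delta_scale h h' c u : delta h h' (scaleu c u) = scaleu (c ^+ 2) (delta h h' u).
Proof.
apply/funext => m; rewrite /delta /scaleu.
by rewrite conjcM (conjc_real c) (rmorphXn (real_complex R)) /=; ring.
Qed.

Lemma good_scale k c u : good k u -> good k (scaleu c u).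
Proof.
elim: k c u => [|k ih] c u /=; last by move=> gu h h'; rewrite delta_scale; exact: ih.
move=> [cR cI]; split.
  rewrite [X in cvgn X](_ : _ = fun N => c * cesaro (fun n => Re (u n%:Z)) N).
    exact: is_cvgMr.
  apply/funext => N; rewrite -cesaroZ; congr cesaro; apply/funext => n.
  by rewrite ReM /= mul0r subr0.
rewrite [X in cvgn X](_ : _ = fun N => c * cesaro (fun n => Im (u n%:Z)) N).
  exact: is_cvgMr.
apply/funext => N; rewrite -cesaroZ; congr cesaro; apply/funext => n.
by rewrite ImM /= mul0r addr0.
Qed.

Lemma lseminorm_scale k c u : le1 u -> good k u ->
  lseminorm k (scaleu c u) = c ^+ (2 ^ k.+1) * lseminorm k u.
Proof.
elim: k c u => [|k ih] c u u1 gu /=; last first.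
  rewrite -(cvg_lim _ (cvgMr (lseminorm_cvg u1 gu)))//.
  congr (limn _); apply/funext => N; rewrite -cesaroZ; congr cesaro.
  apply/funext => n; rewrite delta_scale (ih _ _ (le1_delta _ _ u1) (gu _ _)).
  by rewrite -exprM -expnS.
case: gu => cR cI.
have -> : cesaro (fun n => Re (scaleu c u n)) = fun N => c * cesaro (fun n => Re (u n%:Z)) N.
  apply/funext => N; rewrite -cesaroZ; congr cesaro; apply/funext => n.
  by rewrite ReM /= mul0r subr0.
have -> : cesaro (fun n => Im (scaleu c u n)) = fun N => c * cesaro (fun n => Im (u n%:Z)) N.
  apply/funext => N; rewrite -cesaroZ; congr cesaro; apply/funext => n.
  by rewrite ImM /= mul0r addr0.
rewrite (cvg_lim _ (cvgMr cR))// (cvg_lim _ (cvgMr cI))//.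
by rewrite expn1; ring.
Qed.

End LocalSeminorm.

(** * Van der Corput's inequality and the linear case *)

Section VanDerCorput.
Variable R : realType.

Definition ccesaro (a : nat -> R[i]) (N : nat) : R[i] :=
  N%:R^-1 * \sum_(1 <= n < N.+1) a n.

Lemma Re_ccesaro a N : Re (ccesaro a N) = cesaro (fun n => Re (a n)) N.
Proof. by rewrite Re_natVM Re_sum. Qed.

Lemma nc_ccesaro a N : nc (ccesaro a N) <= cesaro (fun n => nc (a n)) N.
Proof. by rewrite nc_natVM ler_wpM2l ?invr_ge0// nc_sum. Qed.

Lemma nc_ccesaro_le (M : R) a N : 0 <= M ->
  (forall n, (0 < n <= N)%N -> nc (a n) <= M) -> nc (ccesaro a N) <= M.
Proof.
move=> M0 h; rewrite (le_trans (nc_ccesaro _ _))//.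
rewrite (le_trans (ler_norm _))//; apply: cesaro_norm_le => // n hn.
by rewrite ger0_norm ?nc_ge0// h.
Qed.

Lemma ccesaroZ c a N : ccesaro (fun n => c * a n) N = c * ccesaro a N.
Proof. by rewrite /ccesaro -mulr_sumr mulrCA. Qed.

Lemma ccesaroB a b N : ccesaro (fun n => a n - b n) N = ccesaro a N - ccesaro b N.
Proof. by rewrite /ccesaro sumrB mulrBr. Qed.

Lemma ccesaro_cst c N : (0 < N)%N -> ccesaro (fun=> c) N = c.
Proof.
move=> N0; rewrite /ccesaro big_const_nat iter_addr_0 subn1 /= -(mulr_natl c).
by rewrite mulKf// pnatr_eq0 -lt0n.
Qed.

Lemma ccesaroC (F : nat -> nat -> R[i]) N M :
  ccesaro (fun n => ccesaro (F n) M) N = ccesaro (fun m => ccesaro (F^~ m) N) M.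
Proof.
rewrite /ccesaro -mulr_sumr exchange_big mulrCA; congr (_ * _).
by rewrite mulr_sumr.
Qed.

Lemma conj_ccesaro a N : conjc (ccesaro a N) = ccesaro (fun n => conjc (a n)) N.
Proof.
rewrite /ccesaro natVC (rmorphM (@conjc R)) /= oppr0; congr (_ * _).
exact: (rmorph_sum (@conjc R)).
Qed.

Definition sqavg (N b : nat) (v : nat -> int -> R[i]) : R :=
  cesaro (fun m => nc (ccesaro (fun n => v n m%:Z) b) ^+ 2) N.

Lemma sqavg_ge0 N b v : 0 <= sqavg N b v.
Proof. by apply: cesaro_ge0 => m _; exact: sqr_ge0. Qed.

(** The correlation of two shifted copies after [m] has been translated by [- c n]; the freedom in
    [c] is what makes chosen factors independent of [n]. *)
Definition correl (N b : nat) (v w : nat -> int -> R[i]) (c : nat -> int) : R :=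
  nc (ccesaro (fun m => ccesaro (fun n =>
    v n (m%:Z - c n) * conjc (w n (m%:Z - c n))) b) N).

Lemma cesaro_ishift_le (w : int -> R) (c : int) N : (forall m, `|w m| <= 1) ->
  `|cesaro (fun n => w (n%:Z + c)) N - cesaro (fun n => w n%:Z) N|
  <= `|c|%N%:R * 2 / N%:R.
Proof.
have pos (v : int -> R) (j : nat) : (forall m, `|v m| <= 1) ->
    `|cesaro (fun n => v (n%:Z + j%:Z)) N - cesaro (fun n => v n%:Z) N|
    <= j%:R * 2 / N%:R.
  move=> v1; under [X in cesaro X _ - _]eq_fun do rewrite -PoszD.
  by have := @cesaro_shift R 1 (fun n => v n%:Z) j N (fun n => v1 _); rewrite mulr1.
case: c => [j|j] w1; first exact: pos.
have := pos (fun m => w (m + Negz j)) j.+1 (fun m => w1 _).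
rewrite distrC; congr (`|_ - cesaro _ _| <= _).
by apply/funext => n; congr w; rewrite NegzE addrK.
Qed.

Lemma nc_sqr_avg (x : nat -> R[i]) H :
  nc (ccesaro x H) ^+ 2 =
  cesaro (fun h => cesaro (fun h' => Re (x h * conjc (x h'))) H) H.
Proof.
have /(congr1 (@complex.Re R)) /= -> := nc_sqrE (ccesaro x H).
rewrite conj_ccesaro -ccesaroZ Re_ccesaro.
rewrite cesaroC; congr cesaro; apply/funext => h'.
rewrite mulrC -ccesaroZ Re_ccesaro; congr cesaro; apply/funext => h.
by rewrite mulrC.
Qed.

(** Passing to windows of length [H] costs [2 H / b], and squaring at most doubles this since both
    averages lie in the unit disc. *)
Lemma vdc_seq (x : nat -> R[i]) b H : (0 < b)%N -> (0 < H)%N ->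
  (forall n, nc (x n) <= 1) ->
  nc (ccesaro x b) ^+ 2 <=
  cesaro (fun n => nc (ccesaro (fun h => x (n + h)%N) H) ^+ 2) b + 4 * H%:R / b%:R.
Proof.
move=> b0 H0 x1.
set A := ccesaro x b.
pose B := ccesaro (fun n => ccesaro (fun h => x (n + h)%N) H) b.
have AB : nc (A - B) <= 2 * H%:R / b%:R.
  rewrite /B ccesaroC -[A](ccesaro_cst _ H0) -ccesaroB nc_ccesaro_le//.
  move=> h /andP[h0 hH]; rewrite nc_distC /A /ccesaro -mulrBr nc_natVM mulrC.
  rewrite ler_wpM2r ?invr_ge0//.
  apply: (le_trans (ncsum_shift_le h b x1)).
  by rewrite mulr1 mulrC ler_wpM2l// ler_nat.
have A1 : nc A <= 1 by rewrite nc_ccesaro_le.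
have B1 : nc B <= 1 by rewrite nc_ccesaro_le// => ? _; rewrite nc_ccesaro_le// => ? _.
have BB : nc B ^+ 2 <= cesaro (fun n => nc (ccesaro (fun h => x (n + h)%N) H) ^+ 2) b.
  apply: (le_trans _ (cesaro_sqr _ _)); rewrite lerXn2r ?nnegrE ?nc_ge0//.
    by apply: cesaro_ge0 => n _; rewrite nc_ge0.
  exact: nc_ccesaro.
apply: (le_trans _ (lerD BB (lexx _))).
have : nc A <= nc (A - B) + nc B by rewrite -{1}(subrK B A) ncD.
have -> : 4 * H%:R / b%:R = 2 * (2 * H%:R / b%:R) :> R by ring.
have A0 := nc_ge0 A; have B0 := nc_ge0 B => hAB.
have {AB}hAB : nc A <= 2 * H%:R / b%:R + nc B by lra.
have D0 : 0 <= 2 * H%:R / b%:R :> R by [].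
rewrite -lerBlDl subr_sqr mulrC.
have [hle|hlt] := leP (nc A) (nc B).
  by apply: (@le_trans _ _ 0); [rewrite mulr_ge0_le0 ?addr_ge0 ?subr_le0|rewrite mulr_ge0].
by apply: ler_pM; [exact: addr_ge0|rewrite subr_ge0 ltW| |]; lra.
Qed.

(** Translating the range of [m] by [c n] loses at most [2 |c n| / N]. For polynomial [c] of degree
    at most [d] this is [O(b^d / N)], and here the growth condition on [b] enters. *)
Lemma avg_translate (N b : nat) (K : R) (y : nat -> int -> R[i]) (c : nat -> int) :
  (0 < b)%N -> (forall n m, nc (y n m) <= 1) ->
  (forall n, (0 < n <= b)%N -> `|c n|%N%:R <= K) ->
  cesaro (fun n => cesaro (fun m => Re (y n m%:Z)) N) b <=
  nc (ccesaro (fun m => ccesaro (fun n => y n (m%:Z - c n)) b) N) + 2 * K / N%:R.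
Proof.
move=> b0 y1 cK.
have {}y1 n m : `|Re (y n m)| <= 1 by rewrite (le_trans (nc_Re _)).
apply: (@le_trans _ _ (cesaro (fun n => cesaro (fun m => Re (y n (m%:Z - c n))) N
     + 2 * K / N%:R) b)).
  apply: ler_cesaro => n hn.
  have := cesaro_ishift_le (- c n) N (y1 n).
  rewrite abszN distrC => /(le_trans (ler_norm _)); rewrite lerBlDl.
  move=> /le_trans; apply; rewrite lerD2l.
  by rewrite ler_wpM2r ?invr_ge0// mulrC ler_wpM2l// cK.
rewrite cesaroD (cesaro_cst _ b0) lerD2r cesaroC.
apply: (le_trans _ (nc_Re _)); rewrite Re_ccesaro.
apply: (le_trans _ (ler_norm _)); apply: ler_cesaro => m _.
by rewrite Re_ccesaro.
Qed.

Lemma vdc_core (N b H : nat) (K : R) (v : nat -> int -> R[i]) (c : nat -> nat -> int) :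
  (0 < b)%N -> (0 < H)%N -> 0 <= K -> (forall n m, nc (v n m) <= 1) ->
  (forall h n, (0 < h <= H)%N -> (0 < n <= b)%N -> `|c h n|%N%:R <= K) ->
  sqavg N b v <=
  cesaro (fun h => cesaro (fun h' => correl N b
    (fun n => v (n + h)%N) (fun n => v (n + h')%N) (c h')) H) H
  + (4 * H%:R / b%:R + 2 * K / N%:R).
Proof.
move=> b0 H0 K0 v1 cK.
pose y h h' n (m : int) : R := Re (v (n + h)%N m * conjc (v (n + h')%N m)).
have y1 h h' n m : `|y h h' n m| <= 1.
  by rewrite (le_trans (nc_Re _))// ncM ncJ mulr_ile1 ?nc_ge0.
apply: (@le_trans _ _ (cesaro (fun m => cesaro (fun n =>
    cesaro (fun h => cesaro (fun h' => y h h' n m%:Z) H) H) b + 4 * H%:R / b%:R) N)).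
  apply: ler_cesaro => m _; apply: (le_trans (vdc_seq b0 H0 _)) => //.
  by rewrite lerD2r; apply: ler_cesaro => n _; rewrite nc_sqr_avg.
rewrite cesaroD addrA addrAC; apply: lerD; last first.
  case: (posnP N) => [->|N0]; last by rewrite cesaro_cst.
  by rewrite /cesaro invr0 mul0r divr_ge0// mulr_ge0.
have -> : cesaro (fun m => cesaro (fun n =>
    cesaro (fun h => cesaro (fun h' => y h h' n m%:Z) H) H) b) N =
    cesaro (fun h => cesaro (fun h' =>
      cesaro (fun n => cesaro (fun m => y h h' n m%:Z) N) b) H) H.
  transitivity (cesaro (fun m => cesaro (fun h => cesaro (fun h' =>
      cesaro (fun n => y h h' n m%:Z) b) H) H) N).
    congr cesaro; apply/funext => m; rewrite cesaroC; congr cesaro.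
    by apply/funext => h; rewrite cesaroC.
  rewrite cesaroC; congr cesaro; apply/funext => h.
  rewrite cesaroC; congr cesaro; apply/funext => h'.
  by rewrite cesaroC.
have KN : 0 <= 2 * K / N%:R by rewrite divr_ge0// mulr_ge0.
rewrite -[X in _ <= _ + X](cesaro_cst _ H0) -cesaroD.
apply: ler_cesaro => h _.
rewrite -[X in _ <= _ + X](cesaro_cst _ H0) -cesaroD.
apply: ler_cesaro => h' hh'.
apply: (@avg_translate N b K
  (fun n m => v (n + h)%N m * conjc (v (n + h')%N m)) (c h')) => // [n m|n hn].
  by rewrite ncM ncJ mulr_ile1 ?nc_ge0.
exact: cK.
Qed.

(* Cauchy-Schwarz in [m] removes every factor that does not depend on [n]. *)
Lemma nc_avg_drop N b (z : nat -> nat -> R[i]) (y : nat -> int -> R[i]) (G : nat -> R[i]) :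
  (forall m, nc (G m) <= 1) ->
  (forall n (m : nat), z n m = G m * y n m%:Z) ->
  nc (ccesaro (fun m => ccesaro (fun n => z n m) b) N) ^+ 2 <= sqavg N b y.
Proof.
move=> G1 zy; apply: (le_trans _ (cesaro_sqr _ _)).
rewrite lerXn2r ?nnegrE ?nc_ge0//; first by apply: cesaro_ge0 => *; rewrite nc_ge0.
apply: (le_trans (nc_ccesaro _ _)); apply: ler_cesaro => m _.
under [X in ccesaro X _]eq_fun do rewrite zy.
by rewrite ccesaroZ ncM ler_piMl ?nc_ge0.
Qed.

Lemma correl_drop N b (v w y : nat -> int -> R[i]) c (G : nat -> R[i]) :
  (forall m, nc (G m) <= 1) ->
  (forall n (m : nat), v n (m%:Z - c n) * conjc (w n (m%:Z - c n)) = G m * y n m%:Z) ->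
  correl N b v w c ^+ 2 <= sqavg N b y.
Proof. exact: nc_avg_drop. Qed.

End VanDerCorput.

Section Scales.
Variables (R : realType) (d : nat) (b : nat -> nat).

Definition scales : Prop := [/\ forall N, (0 < N)%N -> (0 < b N)%N,
  b N @[N --> \oo] --> \oo & (b N)%:R ^+ d / N%:R @[N --> \oo] --> (0 : R)].

Hypothesis hb : scales.

Lemma poly_growth (c : {poly int}) : (size c <= d.+1)%N ->
  exists C : R, 0 <= C /\ forall (n B : nat), (0 < n <= B)%N -> `|c.[n%:Z]|%N%:R <= C * B%:R ^+ d.
Proof.
move=> sc; exists (\sum_(i < size c) (absz (nth 0 c i))%:R); split; first by rewrite sumr_ge0.
move=> n B /andP[n0 nB].
rewrite horner_coef mulr_suml.
have natabs (z : int) : (absz z)%:R = `|z%:~R : R| by rewrite -intr_norm -abszE.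
rewrite natabs rmorph_sum/=.
apply: (le_trans (ler_norm_sum _ _ _)); apply: ler_sum => i _.
rewrite rmorphM/= rmorphXn/= normrM normrX normr_nat natabs ler_wpM2l//.
rewrite (@le_trans _ _ (n%:R ^+ d))//.
  rewrite -!natrX ler_nat leq_pexp2l//.
  by rewrite -ltnS (leq_trans (ltn_ord i)).
by rewrite lerXn2r ?nnegrE// ler_nat.
Qed.

Lemma near_all (P : nat -> nat -> Prop) H : (forall h, \forall N \near \oo, P h N) ->
  \forall N \near \oo, forall h, (h <= H)%N -> P h N.
Proof.
move=> hP; elim: H => [|H ih].
  by apply: filterS (hP 0%N) => N hN h; rewrite leqn0 => /eqP->.
apply: filterS2 ih (hP H.+1) => N h1 h2 h.
by rewrite leq_eqVlt => /predU1P[->//|]; rewrite ltnS; exact: h1.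
Qed.

Lemma near_b_inv (c e : R) : 0 < e -> \forall N \near \oo, c / (b N)%:R <= e.
Proof. by move=> e0; have [_ bN _] := hb; apply: (bN _ (near_nat_inv c e0)). Qed.

Lemma near_bd_inv (c e : R) : 0 < e ->
  \forall N \near \oo, c * ((b N)%:R ^+ d / N%:R) <= e.
Proof.
move=> e0; have [_ _ bN] := hb; have /(_ _) := cvgMr (a := c) bN; rewrite mulr0.
move=> /cvgr0Pnorm_le/(_ _ e0); apply: filterS => N.
exact: le_trans (ler_norm _).
Qed.

(** [H] stays fixed while [N] grows, so both errors of [vdc_core] fall below [e / 2]. *)
Lemma vdc_near (X : nat -> nat -> int -> R[i]) (c : nat -> {poly int}) H e :
  (0 < H)%N -> 0 < e -> (forall N n m, nc (X N n m) <= 1) ->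
  (forall h, (size (c h) <= d.+1)%N) ->
  \forall N \near \oo, sqavg N (b N) (X N) <=
    cesaro (fun h => cesaro (fun h' => correl N (b N)
      (fun n => X N (n + h)%N) (fun n => X N (n + h')%N) (fun n => (c h').[n%:Z])) H) H
    + e.
Proof.
move=> H0 e0 X1 sc.
have [b0 _ _] := hb.
have /choice[C hC] h : exists C : R, 0 <= C /\
    forall n B : nat, (0 < n <= B)%N -> `|(c h).[n%:Z]|%N%:R <= C * B%:R ^+ d.
  exact: poly_growth.
pose C' := \sum_(h < H.+1) C h.
have CC' h : (h <= H)%N -> C h <= C'.
  rewrite -ltnS => hH; rewrite /C' (bigD1 (Ordinal hH))//= lerDl sumr_ge0// => i _.
  by case: (hC i).
have C'0 : 0 <= C' by rewrite sumr_ge0// => i _; case: (hC i).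
have e2 : 0 < e / 2 by rewrite divr_gt0.
have n1 := near_b_inv (4 * H%:R) e2.
have n2 := near_bd_inv (2 * C') e2.
near=> N.
have N0 : (0 < N)%N by near: N; exists 1%N.
apply: (le_trans (@vdc_core _ N (b N) H (C' * (b N)%:R ^+ d) (X N) (fun h n => (c h).[n%:Z]) (b0 _ N0) H0 _ (X1 N) _)).
- by rewrite mulr_ge0 ?exprn_ge0.
- move=> h n /andP[_ hH] hn; have [_ /(_ _ _ hn) /le_trans->//] := hC h.
  by rewrite ler_wpM2r ?exprn_ge0// CC'.
rewrite lerD2l [leRHS]splitr lerD//.
  by near: N; exact: n1.
by rewrite mulrA -mulrA; near: N; exact: n2.
Unshelve. all: by end_near. Qed.

Lemma sqavg_cvg0 (v : nat -> nat -> int -> R[i]) :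
  (forall e, 0 < e -> \forall N \near \oo, sqavg N (b N) (v N) <= e) ->
  sqavg N (b N) (v N) @[N --> \oo] --> (0 : R).
Proof.
move=> h; apply/cvgr0Pnorm_le => e e0; apply: filterS (h _ e0) => N.
by rewrite ger0_norm ?sqavg_ge0.
Qed.

End Scales.

Section PowerMeans.
Variable R : realType.

Lemma cesaro_expn2 (x : nat -> R) N k : (forall n, 0 <= x n) ->
  cesaro x N ^+ (2 ^ k) <= cesaro (fun n => x n ^+ (2 ^ k)) N.
Proof.
move=> x0; elim: k => [|k ih].
  by rewrite expr1; apply: ler_cesaro => n _; rewrite expr1.
rewrite expnSr exprM; apply: (@le_trans _ _ (cesaro (fun n => x n ^+ (2 ^ k)) N ^+ 2)).
  rewrite lerXn2r ?nnegrE ?exprn_ge0 ?cesaro_ge0// => n _.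
  by rewrite exprn_ge0.
apply: (le_trans (cesaro_sqr _ _)); apply: ler_cesaro => n _.
by rewrite exprM.
Qed.

Lemma exprD_le (x e : R) M : 0 <= x <= 1 -> 0 <= e <= 1 ->
  (x + e) ^+ M <= x ^+ M + (M * 2 ^ M)%:R * e.
Proof.
move=> /andP[x0 x1] /andP[e0 e1]; elim: M => [|M ih].
  by rewrite !expr0 mul0n mul0r addr0.
rewrite !exprS.
have h1 : (x + e) * (x + e) ^+ M <= x * (x + e) ^+ M + e * 2 ^+ M.
  rewrite mulrDl lerD2l ler_wpM2l// lerXn2r ?nnegrE ?addr_ge0//; lra.
apply: (le_trans h1); apply: (le_trans (lerD (ler_wpM2l x0 ih) (lexx _))).
rewrite mulrDr -addrA lerD2l.
rewrite mulrA (mulrC e) -mulrDl ler_wpM2r//.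
rewrite mulSn expnS natrD !natrM natrX.
have : x * (M%:R * 2 ^+ M) <= M%:R * 2 ^+ M by rewrite ler_piMl// mulr_ge0// exprn_ge0.
have : 0 <= M%:R * 2 ^+ M :> R by rewrite mulr_ge0// exprn_ge0.
have : 0 <= 2 ^+ M :> R by rewrite exprn_ge0.
lra.
Qed.

Lemma sum_sparse (phi : nat -> R) A H : (0 < A)%N -> (forall n, 0 <= phi n) ->
  \sum_(1 <= t < H.+1) phi (A * t)%N <= \sum_(1 <= s < (A * H).+1) phi s.
Proof.
move=> A0 p0; elim: H => [|H ih]; first by rewrite muln0 !big_geq.
rewrite big_nat_recr//= mulnS (addnC A).
rewrite [leRHS](big_cat_nat (n := (A * H).+1))//=; last by rewrite ltnS leq_addr.
rewrite lerD// -(prednK A0) addnS big_nat_recr ?leq_addr//=.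
by rewrite -addnS lerDr sumr_ge0.
Qed.

Lemma sum_dist_le (psi : nat -> R) H h : (forall n, 0 <= psi n) -> (0 < h <= H)%N ->
  \sum_(1 <= h' < H.+1) psi `|h%:Z - h'%:Z|%N <=
  psi 0%N + 2 * \sum_(1 <= t < H.+1) psi t.
Proof.
move=> p0 /andP[h0 hH].
rewrite (big_cat_nat (n := h))//=; last by rewrite ltnW// ltnS.
rewrite (big_cat_nat (m := h) (n := h.+1))//= big_nat1 subrr absz0 mulr_natl mulr2n.
rewrite addrCA lerD2l; apply: lerD.
  rewrite big_nat_rev /= [leRHS](big_cat_nat (n := h))//=; last by rewrite ltnW// ltnS.
  apply: ler_wpDr; first by rewrite sumr_ge0.
  rewrite !big_nat; apply: ler_sum => t /andP[t0 th].
  rewrite le_eqVlt; apply/orP; left; apply/eqP; congr psi.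
  lia.
have -> : H.+1 = ((H - h).+1 + h)%N by rewrite addSn subnK.
rewrite -{1}[h.+1]add1n big_addn addnK.
rewrite [leRHS](big_cat_nat (n := (H - h).+1))//=; last by rewrite leq_addr.
apply: ler_wpDr; first by rewrite sumr_ge0.
rewrite !big_nat; apply: ler_sum => t /andP[t0 th].
rewrite le_eqVlt; apply/orP; left; apply/eqP; congr psi.
lia.
Qed.

(** Every distance [t > 0] is attained at most twice from a given [h], the diagonal contributes
    [phi 0 / H], and bounding a sum over multiples of [A] by the sum over all integers costs the
    factor [A]. *)
Lemma cesaro_dist_le (phi : nat -> R) A H : (0 < A)%N -> (0 < H)%N ->
  (forall n, 0 <= phi n) ->
  cesaro (fun h => cesaro (fun h' => phi (A * `|h%:Z - h'%:Z|)%N) H) H <=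
  phi 0%N / H%:R + 2 * A%:R * cesaro phi (A * H).
Proof.
move=> A0 H0 p0; rewrite -[leRHS](cesaro_cst _ H0); apply: ler_cesaro => h hh.
have /= := sum_dist_le (fun n => p0 (A * n)%N) hh.
have Hi : 0 <= H%:R^-1 :> R by rewrite invr_ge0.
rewrite muln0 => /(ler_wpM2l Hi)/le_trans; apply.
rewrite mulrDr [X in X + _]mulrC lerD2l /cesaro natrM.
have Ar : A%:R != 0 :> R by rewrite pnatr_eq0 -lt0n.
have Hr : H%:R != 0 :> R by rewrite pnatr_eq0 -lt0n.
have -> : 2 * A%:R * ((A%:R * H%:R)^-1 * \sum_(1 <= n < (A * H).+1) phi n) =
    H%:R^-1 * (2 * \sum_(1 <= n < (A * H).+1) phi n) :> R by field; rewrite Ar Hr.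
by rewrite ler_wpM2l ?invr_ge0// ler_wpM2l// sum_sparse.
Qed.

End PowerMeans.

(** * The linear case *)

Section Linear.
Variables (R : realType) (d : nat) (b : nat -> nat).
Hypotheses (d0 : (0 < d)%N) (hb : scales R d b).

Record bfam := BFam { bval :> nat -> int -> R[i]; bvalP : forall N, le1 (bval N) }.

Definition bdelta h h' (g : bfam) : bfam :=
  BFam (fun N => le1_delta h h' (bvalP g N)).

Lemma le1_one : le1 (fun=> 1 : R[i]). Proof. by move=> m; rewrite nc1. Qed.

Definition bone : bfam := BFam (fun N : nat => le1_one).

Lemma correl_ge0 N c (v w : nat -> int -> R[i]) B : 0 <= correl N B v w c.
Proof. exact: nc_ge0. Qed.

Lemma correl_le1 N c (v w : nat -> int -> R[i]) B :
  (forall n m, nc (v n m) <= 1) -> (forall n m, nc (w n m) <= 1) ->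
  correl N B v w c <= 1.
Proof.
move=> v1 w1; apply: nc_ccesaro_le => // m _; apply: nc_ccesaro_le => // n _.
by rewrite ncM ncJ mulr_ile1 ?nc_ge0.
Qed.

(** One van der Corput step raises the order of the controlling seminorm by one. Power means move
    the exponent inside the averages over [h] and [h'], where the bounds for the derivatives average
    to the next local seminorm. *)
Lemma linear_step (k : nat) (a : int) (C : R) (u : int -> R[i])
    (X : nat -> nat -> int -> R[i]) (c : nat -> {poly int}) :
  a != 0 -> 0 <= C -> le1 u -> good k.+1 u ->
  (forall N n m, nc (X N n m) <= 1) -> (forall h, (size (c h) <= d.+1)%N) ->
  (forall h h' e, 0 < e -> \forall N \near \oo,
    correl N (b N) (fun n => X N (n + h)%N) (fun n => X N (n + h')%N)
      (fun n => (c h').[n%:Z]) ^+ (2 ^ k.+1) <=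
    C * lseminorm k (delta (a * h%:Z) (a * h'%:Z) u) + e) ->
  forall e, 0 < e -> \forall N \near \oo,
    sqavg N (b N) (X N) ^+ (2 ^ k.+1) <=
    C * (2 * `|a|%N%:R) * lseminorm k.+1 u + e.
Proof.
move=> a0 C0 u1 gu X1 sc hyp e e0.
set M := (2 ^ k.+1)%N.
pose phi n := lseminorm k (delta n%:Z 0 u).
have phi0 n : 0 <= phi n by apply: lseminorm_ge0; [exact: le1_delta|exact: gu].
have phi1 : phi 0%N <= 1 by apply: lseminorm_le1; [exact: le1_delta|exact: gu].
have A0 : (0 < `|a|)%N by rewrite absz_gt0.
have phiE h h' : lseminorm k (delta (a * h%:Z) (a * h'%:Z) u) =
    phi (`|a| * `|h%:Z - h'%:Z|)%N.
  by rewrite lseminorm_delta// -mulrBr abszM.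
(* The final [1] keeps [K] positive when [C = 0]. With this [q], the errors from the diagonal and
   from the Cesàro limit together cost at most [e / 4]. *)
pose K := C * (1 + 2 * `|a|%N%:R) + 1.
have K0 : 0 < K by rewrite ltr_wpDl// mulr_ge0// addr_ge0// mulr_ge0.
pose q := e / 4 / K.
have q0 : 0 < q by rewrite !divr_gt0.
have qq : C * q * (1 + 2 * `|a|%N%:R) <= e / 4.
  rewrite mulrAC /q mulrA ler_pdivrMr// mulrC ler_wpM2l ?divr_ge0 ?ltW//.
  by rewrite ltrDl.
have [H [H0 hH1 hH2]] : exists H, [/\ (0 < H)%N, H%:R^-1 <= q &
    cesaro phi (`|a| * H) <= lseminorm k.+1 u + q].
  have c1 := near_nat_inv (1 : R) q0.
  have := lseminorm_cvg u1 gu; move=> /cvgrPdist_le/(_ _ q0) [H1 _ hH1].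
  near \oo => H; exists H; split.
  - by near: H; exists 1%N.
  - by rewrite -div1r; near: H; exact: c1.
  - have HH1 : (H1 <= `|a| * H)%N.
      by apply: (@leq_trans H); [near: H; exists H1|rewrite leq_pmull].
    have /= := hH1 _ HH1; rewrite distrC => /(le_trans (ler_norm _)).
    by rewrite lerBlDl.
(* The van der Corput error: [exprD_le] requires it to be at most [1] and multiplies it by
   [M * 2 ^ M]. *)
pose eta := Num.min 1 (e / 4 / ((M * 2 ^ M)%:R + 1)).
have eta0 : 0 < eta by rewrite lt_min ltr01/= !divr_gt0// ltr_wpDl.
have eta1 : eta <= 1 by rewrite ge_min lexx.
have etaM : (M * 2 ^ M)%:R * eta <= e / 4.
  apply: (@le_trans _ _ ((M * 2 ^ M)%:R * (e / 4 / ((M * 2 ^ M)%:R + 1)))).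
    by rewrite ler_wpM2l// ge_min lexx orbT.
  rewrite mulrA ler_pdivrMr ?ltr_wpDl// mulrC ler_wpM2l ?divr_ge0 ?ltW//.
  by rewrite ltrDl.
have n1 := vdc_near hb H0 eta0 X1 sc.
have e40 : 0 < e / 4 by rewrite divr_gt0.
have n2 := near_all H (fun h => near_all H (fun h' => hyp h h' _ e40)).
apply: filterS2 n1 n2 => N h1 h2.
set S := sqavg _ _ _ in h1 *; set A := cesaro _ _ in h1.
have A00 : 0 <= A by apply: cesaro_ge0 => h _; apply: cesaro_ge0 => h' _; exact: correl_ge0.
have A1 : A <= 1.
  apply: (le_trans (ler_norm _)); apply: cesaro_norm_le => // h _.
  apply: cesaro_norm_le => // h' _.
  by rewrite ger0_norm ?correl_ge0//; exact: correl_le1.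
apply: (@le_trans _ _ ((A + eta) ^+ M)).
  by rewrite lerXn2r ?nnegrE ?sqavg_ge0// addr_ge0// ltW.
apply: (le_trans (exprD_le M _ _)); [by rewrite A00|by rewrite eta1 ltW|].
have : A ^+ M <= C * (1 / H%:R + 2 * `|a|%N%:R * cesaro phi (`|a| * H)) + e / 4.
  apply: (le_trans (cesaro_expn2 _ _ _)).
    by move=> h; apply: cesaro_ge0 => *; exact: correl_ge0.
  apply: (@le_trans _ _ (C * cesaro (fun h => cesaro (fun h' =>
      phi (`|a| * `|h%:Z - h'%:Z|)%N) H) H + e / 4)); last first.
    rewrite lerD2r ler_wpM2l//.
    apply: (le_trans (cesaro_dist_le A0 H0 phi0)).
    by rewrite lerD2r ler_wpM2r// invr_ge0.
  rewrite -cesaroZ -[X in _ + X](cesaro_cst _ H0) -cesaroD.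
  apply: ler_cesaro => h /andP[_ hH].
  apply: (le_trans (cesaro_expn2 _ _ _)); first by move=> h'; exact: correl_ge0.
  rewrite -cesaroZ -[X in _ + X](cesaro_cst _ H0) -cesaroD.
  apply: ler_cesaro => h' /andP[_ hH'].
  by rewrite -phiE; exact: h2.
have : C * (1 / H%:R + 2 * `|a|%N%:R * cesaro phi (`|a| * H)) <=
    C * (q + 2 * `|a|%N%:R * (lseminorm k.+1 u + q)).
  by rewrite ler_wpM2l// div1r lerD// ler_wpM2l// mulr_ge0.
rewrite !mulrDr; rewrite mulrDr in qq; lra.
Unshelve. all: by end_near. Qed.

Definition vlin (u : int -> R[i]) (a : int) (L : seq (int * bfam)) N n m : R[i] :=
  u (m + a * n%:Z) * \prod_(x <- L) x.2 N (m + x.1 * n%:Z).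

Lemma vlin_le1 u a L N n m : le1 u -> nc (vlin u a L N n m) <= 1.
Proof.
move=> u1; rewrite ncM mulr_ile1 ?nc_ge0//.
by apply: nc_prod_le1 => i _; exact: bvalP.
Qed.

Lemma size_lin (a : int) : (size (a%:P * 'X)%R <= d.+1)%N.
Proof.
apply: (leq_trans (size_polyMleq _ _)).
by rewrite size_polyX addn2 /= ltnS (leq_trans (size_polyC_leq1 _)).
Qed.

Lemma horner_lin (a : int) n : (a%:P * 'X).[n] = a * n.
Proof. by rewrite hornerM hornerC hornerX. Qed.

(** Induction on the number of other factors. Translating by [c n], for [c] the slope of one of
    them, makes the derivative of that factor independent of [n], and it is dropped; the other
    slopes still differ from that of [u]. [C] depends on the slopes only, because the induction
    hypothesis is applied to all derivatives of [u]. *)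
Lemma linear_bound r (a : int) (s : seq int) : size s = r -> a != 0 ->
  all (fun c => c != a) s ->
  exists C : R, 0 <= C /\ forall u, le1 u -> good r.+1 u ->
  forall L, map fst L = s -> forall e, 0 < e -> \forall N \near \oo,
    sqavg N (b N) (vlin u a L N) ^+ (2 ^ r.+1) <= C * lseminorm r.+1 u + e.
Proof.
elim: r a s => [|r ih] a [|c s]//= => [_|[sz]] a0.
- exists (1 * (2 * `|a|%N%:R)); split; first by rewrite !mulr_ge0.
  move=> u u1 gu [|//] _.
  apply: (linear_step (c := fun=> a%:P * 'X)) => //.
  + by move=> N n m; exact: vlin_le1.
  + by move=> h; exact: size_lin.
  move=> h h' e e0.
  have [gR gI] : good 0 (delta (a * h) (a * h') u) by exact: gu.
  set w := delta _ _ u in gR gI *.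
  have cw : cesaro (fun n => Re (w n%:Z)) N ^+ 2 + cesaro (fun n => Im (w n%:Z)) N ^+ 2
      @[N --> \oo] --> lseminorm 0 w.
    by apply: cvgD; rewrite /= expr2; under eq_fun do rewrite expr2; exact: cvgM.
  move: cw => /cvgrPdist_le/(_ _ e0) cw.
  near=> N.
  have N0 : (0 < N)%N by near: N; exists 1%N.
  have [b0 _ _] := hb.
  rewrite mul1r expn1.
  (* With no other factor, translation by [a n] removes [n] altogether and leaves an average of a
     derivative of [u]. *)
  have -> : correl N (b N) (fun n => vlin u a [::] N (n + h))
      (fun n => vlin u a [::] N (n + h')) (fun n => (a%:P * 'X).[n%:Z]) =
      nc (ccesaro (fun m => w m%:Z) N).
    congr nc; congr ccesaro; apply/funext => m.
    rewrite -[RHS](ccesaro_cst _ (b0 _ N0)); congr ccesaro; apply/funext => n.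
    rewrite /vlin !big_nil !mulr1 horner_lin /w /delta.
    by congr (u _ * conjc (u _)); rewrite PoszD; ring.
  rewrite nc_sqr Re_ccesaro Im_natVM Im_sum.
  have : `|lseminorm 0 w - (cesaro (fun n => Re (w n%:Z)) N ^+ 2 +
      cesaro (fun n => Im (w n%:Z)) N ^+ 2)| <= e by near: N; exact: cw.
  by rewrite distrC => /(le_trans (ler_norm _)); rewrite lerBlDl.
- move=> /andP[ca sa].
  have [] := ih (a - c) (map (fun x => x - c) s).
  + by rewrite size_map.
  + by rewrite subr_eq0 eq_sym.
  + rewrite all_map; apply: sub_all sa => x /=; apply: contra => /eqP h.
    by rewrite -(subrK c x) h subrK.
  move=> C [C0 hC].
  exists (C * (2 * `|a|%N%:R)); split; first by rewrite !mulr_ge0.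
  move=> u u1 gu [|[c' g] L]//= [-> Ls].
  apply: (linear_step (c := fun=> c%:P * 'X)) => //.
  + by move=> N n m; exact: vlin_le1.
  + by move=> h; exact: size_lin.
  move=> h h' e e0.
  pose L' := [seq (x.1 - c, bdelta (x.1 * h%:Z) (x.1 * h'%:Z) x.2) | x <- L].
  have := hC _ (le1_delta (a * h%:Z) (a * h'%:Z) u1) (gu _ _) L' _ e e0.
  have -> : map fst L' = map (fun x => x - c) s by rewrite -Ls -!map_comp.
  move=> /(_ erefl); apply: filterS => N hN.
  apply: le_trans hN; rewrite expnS exprM lerXn2r ?nnegrE ?sqr_ge0 ?sqavg_ge0//.
  (* The derivative of [g] is the factor without [n]. The square in Cauchy-Schwarz accounts for the
     doubled exponent. *)
  apply: (@correl_drop _ _ _ _ _ _ _ (fun m => bdelta (c * h%:Z) (c * h'%:Z) g N m%:Z)).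
    by move=> m; exact: bvalP.
  move=> n m.
  have e1 (x : int) (t : nat) : m%:Z - c * n%:Z + x * (n%:Z + t%:Z) =
      m%:Z + (x - c) * n%:Z + x * t%:Z by ring.
  rewrite /vlin !big_cons /= /L' big_map horner_lin !PoszD.
  set p1 := \prod_(_ <- L) _; set p2 := \prod_(_ <- L) _; set p3 := \prod_(_ <- L) _.
  have -> : p3 = p1 * conjc p2.
    rewrite /p2 (rmorph_prod (@conjc R)) -big_split /=; apply: eq_bigr => x _.
    by rewrite /= /delta !e1.
  rewrite !(rmorphM (@conjc R)) /= /delta.
  rewrite !e1 subrr mul0r addr0; ring.
Unshelve. all: by end_near. Qed.

Lemma linear_cvg0 r (a : int) (L : seq (int * bfam)) u :
  (size L <= r)%N -> a != 0 -> all (fun x => x.1 != a) L ->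
  le1 u -> good r.+1 u -> lseminorm r.+1 u = 0 ->
  sqavg N (b N) (vlin u a L N) @[N --> \oo] --> (0 : R).
Proof.
move=> sL a0 La u1 gu u0.
(* Constant factors, with a slope different from [a], bring the length to exactly [r]; so every
   order beyond the number of factors is available. *)
pose P := nseq (r - size L) (a + 1, bone).
have vP N : vlin u a L N = vlin u a (L ++ P) N.
  apply/funext => n; apply/funext => m; rewrite /vlin big_cat /= big_nseq.
  by rewrite iter_mulr_1 expr1n mulr1.
have [] := @linear_bound r a (map fst (L ++ P)) _ a0.
- by rewrite size_map size_cat size_nseq subnKC.
- rewrite all_map all_cat; apply/andP; split; first exact: La.
  by rewrite all_nseq /= -subr_eq0 addrAC subrr add0r oner_eq0 orbT.
move=> C [C0 /(_ _ u1 gu _ erefl)]; rewrite u0 mulr0 => h.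
apply: (sqavg_cvg0 (b := b)) => e e0.
have e20 : 0 < e ^+ (2 ^ r.+1) by rewrite exprn_gt0.
apply: filterS (h _ e20) => N; rewrite add0r -vP.
by rewrite ler_pXn2r ?expn_gt0// ?nnegrE ?sqavg_ge0 ?ltW.
Qed.

Definition vpol (u : int -> R[i]) (q : {poly int}) (L : seq ({poly int} * bfam))
    (N n : nat) (m : int) : R[i] :=
  u (m + q.[n%:Z]) * \prod_(x <- L) x.2 N (m + x.1.[n%:Z]).

Lemma vpol_le1 u q L N n m : le1 u -> nc (vpol u q L N n m) <= 1.
Proof.
move=> u1; rewrite ncM mulr_ile1 ?nc_ge0//.
by apply: nc_prod_le1 => i _; exact: bvalP.
Qed.

Definition bshift h (g : bfam) : bfam := BFam (fun N => le1_shift h (bvalP g N)).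

Lemma horner_size2 (q : {poly int}) n : (size q <= 2)%N -> q.[n] = q`_0 + q`_1 * n.
Proof.
move=> sq; rewrite (horner_coef_wide _ sq) big_ord_recr big_ord1 /=.
by rewrite expr0 expr1 mulr1.
Qed.

Lemma coef1_neq0 (q : {poly int}) : (1 < size q <= 2)%N -> q`_1 != 0.
Proof.
case/andP=> q1 q2; have sq : size q = 2 by apply/eqP; rewrite eqn_leq q2.
have q0 : q != 0 by rewrite -size_poly_gt0 sq.
by have := lead_coefE q; rewrite sq /= => <-; rewrite lead_coef_eq0.
Qed.

(** Constant terms are absorbed by shifting the sequences, which does not change the local
    seminorm. *)
Lemma pet_linear r (q : {poly int}) (L : seq ({poly int} * bfam)) u :
  (size L <= r)%N -> (1 < size q <= 2)%N ->
  all (fun x : {poly int} * bfam => (size x.1 <= 2)%N && (1 < size (q - x.1)%R)%N) L ->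
  le1 u -> good r.+1 u -> lseminorm r.+1 u = 0 ->
  sqavg N (b N) (vpol u q L N) @[N --> \oo] --> (0 : R).
Proof.
move=> sL sq qL u1 gu u0.
pose L' := [seq (x.1`_1, bshift x.1`_0 x.2) | x : {poly int} * bfam <- L].
have := @linear_cvg0 r q`_1 L' (shiftu q`_0 u).
have sq2 : (size q <= 2)%N by case/andP: sq.
rewrite size_map => /(_ sL (coef1_neq0 sq)).
have -> : all (fun x => x.1 != q`_1) L'.
  rewrite all_map; apply: sub_all qL => x /= /andP[x2 qx].
  rewrite eq_sym -subr_eq0 -coefB coef1_neq0// qx /=.
  by rewrite (leq_trans (size_polyD _ _))// geq_max sq2 size_polyN.
move=> /(_ isT (le1_shift _ u1) (good_shift _ u1 gu)).
rewrite lseminorm_shift// => /(_ u0) h.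
suff e N : vpol u q L N = vlin (shiftu q`_0 u) q`_1 L' N.
  by under eq_fun do rewrite e.
apply/funext => n; apply/funext => m.
rewrite /vlin /vpol /shiftu big_map (horner_size2 _ sq2); congr (u _ * _); first by ring.
elim: L {sL L' h} qL => [|x L ih] /=; first by rewrite !big_nil.
move=> /andP[/andP[x2 _] /ih {}ih]; rewrite !big_cons ih; congr (_ * _).
by rewrite /shiftu (horner_size2 _ x2); congr (x.2 N _); ring.
Qed.

End Linear.

(** * Polynomial exhaustion *)

Section PolyShift.
Implicit Types (p q : {poly int}) (h : nat).

Definition psh h p : {poly int} := p \Po ('X + (h%:Z)%:P).

Lemma horner_psh h p (n : nat) : (psh h p).[n%:Z] = p.[(n + h)%N%:Z].
Proof. by rewrite /psh horner_comp hornerD hornerX hornerC PoszD. Qed.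

Lemma size_psh h p : size (psh h p) = size p.
Proof. by rewrite size_comp_poly2// size_XaddC. Qed.

Lemma lead_psh h p : lead_coef (psh h p) = lead_coef p.
Proof. by rewrite lead_coef_comp ?size_XaddC// lead_coefXaddC expr1n mulr1. Qed.

Lemma pshB h p q : psh h (p - q) = psh h p - psh h q.
Proof. exact: comp_polyB. Qed.

(** The binomial formula just below the top degree, the place where two shifts of one polynomial
    first differ. *)
Lemma coef_psh h p n : (size p <= n.+2)%N ->
  (psh h p)`_n = p`_n + (n.+1)%:R * h%:Z * p`_n.+1.
Proof.
have top : forall p n, (size p <= n.+1)%N -> (psh h p)`_n = p`_n.
  move=> {}p {}n sp; have [sn|sn] := ltnP n (size p).
    have e : size p = n.+1 by apply/eqP; rewrite eqn_leq sp.
    have := lead_psh h p; rewrite !lead_coefE size_psh e //.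
  by rewrite !nth_default ?size_psh.
elim/poly_ind: p n => [|p c ih] n sp; first by rewrite /psh comp_poly0 !coef0 mulr0 addr0.
have [p0|p0] := eqVneq p 0.
  by rewrite p0 mul0r add0r /psh comp_polyC !coefC /= mulr0 addr0.
have {}sp : (size p <= n.+1)%N.
  by move: sp; rewrite size_MXaddC (negPf p0) /= ltnS.
have e : psh h (p * 'X + c%:P) = psh h p * 'X + h%:Z *: psh h p + c%:P.
  rewrite /psh comp_polyD comp_polyM comp_polyX comp_polyC mulrDr; congr (_ + _ + _).
  by rewrite mulrC mul_polyC.
rewrite e !coefD coefZ !coefMX /= (top _ _ sp) !coefC /=.
case: n sp => [|n] sp /=.
  by rewrite mulr1n; ring.
by rewrite ih// !addr0 -(natr1 n.+1); ring.
Qed.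

Lemma size_polyB_gt p q : (size q < size p)%N -> size (p - q) = size p.
Proof. by move=> h; rewrite size_polyDl// size_polyN. Qed.

Lemma lead_polyB_gt p q : (size q < size p)%N -> lead_coef (p - q) = lead_coef p.
Proof. by move=> h; rewrite lead_coefDl// size_polyN. Qed.

Lemma size_polyB_le p q n : (size p <= n)%N -> (size q <= n)%N -> (size (p - q)%R <= n)%N.
Proof.
by move=> hp hq; rewrite (leq_trans (size_polyD _ _))// geq_max hp size_polyN.
Qed.

Lemma size_polyB_neq p q : size p = size q -> lead_coef p != lead_coef q ->
  size (p - q) = size p /\ lead_coef (p - q) = lead_coef p - lead_coef q.
Proof.
move=> spq lpq; case sp : (size p) => [|n].
  move/eqP: (sp); rewrite size_poly_eq0 => /eqP p0.
  move/eqP: sp; rewrite spq size_poly_eq0 => /eqP q0.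
  by move: lpq; rewrite p0 q0 eqxx.
have lp : p`_n = lead_coef p by rewrite lead_coefE sp.
have lq : q`_n = lead_coef q by rewrite lead_coefE -spq sp.
have c : (p - q)`_n = lead_coef p - lead_coef q by rewrite coefB lp lq.
have s : size (p - q) = n.+1.
  apply/eqP; rewrite eqn_leq size_polyB_le ?sp -?spq ?sp//= ltnNge.
  by apply/negP => /leq_sizeP/(_ n (leqnn _)); rewrite c => /eqP; rewrite subr_eq0 (negPf lpq).
by split=> //; rewrite lead_coefE s.
Qed.

Lemma size_polyB_eq p q : size p = size q -> lead_coef p = lead_coef q ->
  (size (p - q)%R <= (size p).-1)%N.
Proof.
move=> spq lpq; apply/leq_sizeP => j; rewrite leq_eqVlt => /predU1P[<-|hj].
  by rewrite coefB -lead_coefE [X in q`_X.-1]spq -lead_coefE lpq subrr.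
by rewrite coefB !nth_default ?subrr// -?spq; move: hj; case: (size p).
Qed.

Lemma size_psh_diff h h' p : h != h' -> (1 < size p)%N ->
  size (psh h p - psh h' p) = (size p).-1.
Proof.
move=> hh sp; apply/eqP; rewrite eqn_leq.
have -> : (size (psh h p - psh h' p)%R <= (size p).-1)%N.
  by rewrite -(size_psh h p) size_polyB_eq ?size_psh ?lead_psh.
case e : (size p) sp => [|[|n]]//= _.
rewrite ltnNge; apply/negP => /leq_sizeP/(_ n (leqnn _)).
rewrite coefB !coef_psh ?e// opprD addrACA subrr add0r -mulrBl -mulrBr.
have := lead_coefE p; rewrite e /= => <-.
move/eqP; rewrite !mulf_eq0 lead_coef_eq0 -size_poly_eq0 e orbF.
rewrite pnatr_eq0 /= subr_eq0; apply/negP.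
by rewrite eqz_nat.
Qed.

(** Otherwise two distinct shifts of [q] would differ by a constant, whereas their difference has
    degree one less than [q], hence at least 1. *)
Lemma psh_const_inj p q h1 h2 h' : (2 < size q)%N ->
  (size (psh h1 q - psh h' p)%R <= 1)%N -> (size (psh h2 q - psh h' p)%R <= 1)%N -> h1 = h2.
Proof.
move=> sq s1 s2; apply/eqP/negPn/negP => /size_psh_diff/(_ (ltnW sq)) e.
have := size_polyB_le s1 s2; rewrite opprB addrA subrK e.
by case: (size q) sq => [|[|[]]].
Qed.

(** The weight of polynomial exhaustion: polynomials of degree [j] ([size] is the degree plus one)
    are classed by leading coefficient, so two are equivalent when their difference has smaller
    degree. *)
Definition wt (F : seq {poly int}) (j : nat) : nat :=
  size (undup [seq lead_coef p | p <- F & size p == j.+1]).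

Lemma wt_le F j : (wt F j <= size F)%N.
Proof.
rewrite (leq_trans (size_undup _))// size_map size_filter; exact: count_size.
Qed.

Section Step.
Variables (F F' : seq {poly int}) (qs : {poly int}) (h' e : nat).
Hypotheses (sqs : size qs = e.+1) (Fqs : qs \in F).
Hypothesis Fe : forall p, p \in F -> (e < size p)%N.
Hypothesis FF' : forall p', p' \in F' -> exists p g, p \in F /\ p' = psh g p - psh h' qs.

(** Subtracting a polynomial of degree [e] leaves the leading terms of higher degree untouched. *)
Lemma wt_step_gt j : (e < j)%N -> (wt F' j <= wt F j)%N.
Proof.
move=> ej; apply: uniq_leq_size; first exact: undup_uniq.
move=> c; rewrite !mem_undup => /mapP[p']; rewrite mem_filter => /andP[/eqP sp' /FF'].
move=> [p [g [pF p'E]]] ->.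
have [sp|sp] := ltnP (size qs) (size p).
  rewrite p'E lead_polyB_gt ?size_psh// lead_psh map_f// mem_filter pF andbT.
  by rewrite -sp' p'E size_polyB_gt ?size_psh.
have := @size_polyB_le (psh g p) (psh h' qs) e.+1.
by rewrite !size_psh -sqs sp -p'E sp' sqs leqnn => /(_ isT isT); rewrite ltnS leqNgt ej.
Qed.

(** In degree [e] all leading coefficients move by that of [qs], and the class of [qs] itself drops
    to lower degree. As [e] is the minimal degree, nothing enters from below. *)
Lemma wt_step_eq : (wt F' e < wt F e)%N.
Proof.
pose lq := lead_coef qs.
have lqF : lq \in [seq lead_coef p | p <- F & size p == e.+1].
  by apply: map_f; rewrite mem_filter sqs eqxx.
have lqU : lq \in undup [seq lead_coef p | p <- F & size p == e.+1] by rewrite mem_undup.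
rewrite /wt [ltnRHS](perm_size (perm_to_rem lqU)) /= ltnS.
rewrite -[leqRHS](size_map (fun c => c - lq)); apply: uniq_leq_size; first exact: undup_uniq.
move=> c; rewrite !mem_undup => /mapP[p']; rewrite mem_filter => /andP[/eqP sp' /FF'].
move=> [p [g [pF p'E]]] ->.
have [sp|sp] := ltnP (size qs) (size p).
  have : size p' = size p by rewrite p'E size_polyB_gt ?size_psh.
  by rewrite sp' => e1; move: sp; rewrite sqs -e1 ltnn.
have {}sp : size p = size qs.
  by apply/eqP; rewrite eqn_leq sp sqs Fe.
have [lp|lp] := eqVneq (lead_coef p) lq.
  have := @size_polyB_eq (psh g p) (psh h' qs).
  by rewrite !size_psh !lead_psh -p'E sp' sp sqs => /(_ erefl lp); rewrite ltnn.
have [||_] := @size_polyB_neq (psh g p) (psh h' qs); rewrite ?size_psh ?lead_psh//.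
rewrite -p'E => ->; apply: (map_f (fun c => c - lq)).
rewrite mem_rem_uniq ?undup_uniq// inE lp mem_undup map_f// mem_filter pF.
by rewrite sp sqs eqxx.
Qed.

End Step.

End PolyShift.

(* Induction on the weights [(w d, ..., w 1)], ordered lexicographically with
   the highest degree first. *)
Lemma lex_ind d (P : (nat -> nat) -> Prop) :
  (forall w, (forall w' e, (0 < e <= d)%N -> (w' e < w e)%N ->
     (forall j, (e < j <= d)%N -> w' j = w j) -> P w') -> P w) ->
  forall w, P w.
Proof.
move=> ind.
(* In [Q k] the hypothesis covers only decreases at an index above [k]: [Q 0] is the given induction
   step, and in [Q d] the hypothesis is vacuous. The passage to [k.+1] is an induction on the value
   of [w] there. *)
suff Q k : (k <= d)%N -> forall w, (forall w' e, (k < e <= d)%N -> (w' e < w e)%N ->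
     (forall j, (e < j <= d)%N -> w' j = w j) -> P w') -> P w.
  move=> w; apply: (Q d) => // w' e /andP[de ed].
  by move: (leq_trans de ed); rewrite ltnn.
elim: k => [_|k ih kd]; first exact: ind.
move=> w; move: {2}(w k.+1) (leqnn (w k.+1)) => n.
elim: n w => [|n ihn] w wn hw; apply: (ih (ltnW kd)) => w' e /andP[ke ed] w'e w'w.
  move: ke; rewrite leq_eqVlt => /predU1P[ek|ke].
    by move: w'e; rewrite -ek ltnNge; move: wn; rewrite leqn0 => /eqP ->.
  by apply: hw w'e w'w; rewrite ke.
move: ke; rewrite leq_eqVlt => /predU1P[ek|ke]; last first.
  by apply: hw w'e w'w; rewrite ke.
apply: ihn; first by rewrite -ltnS ek (leq_trans w'e)// -ek.
move=> w'' e' /andP[ke' e'd] w''e' w''w'.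
have ee' : (e < e')%N by rewrite -ek.
apply: (hw w'' e'); first by rewrite ke'.
  by rewrite -w'w// ee'.
move=> j /andP[e'j jd]; rewrite w''w' ?e'j// w'w// jd andbT.
exact: ltn_trans e'j.
Qed.

Lemma sum_unique_le1 (R : realType) (P : pred nat) (s : seq nat) : uniq s ->
  (forall x y, P x -> P y -> x = y) -> \sum_(x <- s) (P x)%:R <= 1 :> R.
Proof.
move=> us Pxy; elim: s us => [|x s ih] /=; first by rewrite big_nil.
rewrite big_cons => /andP[xs /ih {}ih]; case: (boolP (P x)) => Px; last by rewrite add0r.
rewrite big1_seq ?addr0// => y /andP[_ ys]; case: (boolP (P y)) => // Py.
by rewrite (Pxy _ _ Px Py) ys in xs.
Qed.

(** * One van der Corput step on a polynomial family *)

Section PetStep.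
Variables (R : realType) (d : nat) (b : nat -> nat) (u : int -> R[i]).
Hypotheses (d0 : (0 < d)%N) (hb : scales R d b) (u1 : le1 u).
Implicit Types (L : seq ({poly int} * bfam R)) (q : {poly int}).

Lemma le1_conj (v : int -> R[i]) : le1 v -> le1 (conju v).
Proof. by move=> h m; rewrite /conju ncJ. Qed.

Definition bconj (g : bfam R) : bfam R := BFam (fun N => le1_conj (bvalP g N)).

Definition bcst (v : int -> R[i]) (v1 : le1 v) : bfam R := BFam (fun N : nat => v1).

Definition pfilter L := [seq x : {poly int} * bfam R <- L | (1 < size x.1)%N].

(** The factors present after translation by [psh h' qs]. The distinguished factor at shift [h]
    stays apart, while its conjugate at shift [h'] joins the others as an ordinary bounded sequence;
    hence [q] occurs in the second half only. *)
Definition pdiff q L (qs : {poly int}) h h' : seq ({poly int} * bfam R) :=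
  [seq (psh h x.1 - psh h' qs, x.2) | x : {poly int} * bfam R <- L] ++
  [seq (psh h' x.1 - psh h' qs, bconj x.2) | x : {poly int} * bfam R <- (q, bcst u1) :: L].

Definition qdiff q (Ps : seq {poly int}) (qs : {poly int}) h h' : seq {poly int} :=
  [seq psh h p - psh h' qs | p <- Ps] ++ [seq psh h' p - psh h' qs | p <- q :: Ps].

Lemma pdiff_fst q L qs h h' : map fst (pdiff q L qs h h') = qdiff q (map fst L) qs h h'.
Proof. by rewrite /pdiff /qdiff map_cat /= -!map_comp. Qed.

Lemma pfilter_fst L : map fst (pfilter L) = [seq p : {poly int} <- map fst L | (1 < size p)%N].
Proof. by rewrite filter_map. Qed.

Lemma vpol_filter v q L : exists G : nat -> nat -> R[i],
  (forall N m, nc (G N m) <= 1) /\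
  forall N n (m : nat), vpol v q L N n m%:Z = G N m * vpol v q (pfilter L) N n m%:Z.
Proof.
exists (fun N m => \prod_(x <- L | ~~ (1 < size x.1)%N) x.2 N (m%:Z + x.1`_0)); split.
  by move=> N m; apply: nc_prod_le1 => x _; exact: bvalP.
move=> N n m; rewrite /vpol mulrCA; congr (_ * _).
rewrite /pfilter big_filter (bigID (fun x : {poly int} * bfam R => (1 < size x.1)%N)) /=.
rewrite mulrC; congr (_ * _); apply: eq_bigr => x; rewrite -leqNgt => sx.
by rewrite (horner_coef_wide _ sx) big_ord1 expr0 mulr1.
Qed.

Lemma correl_vpol q L qs h h' N B :
  correl N B (fun n => vpol u q L N (n + h)%N) (fun n => vpol u q L N (n + h')%N)
    (fun n => (psh h' qs).[n%:Z]) ^+ 2 <=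
  sqavg N B (vpol u (psh h q - psh h' qs) (pfilter (pdiff q L qs h h')) N).
Proof.
have [G [G1 hG]] := vpol_filter u (psh h q - psh h' qs) (pdiff q L qs h h').
apply: (@correl_drop _ _ _ _ _ _ _ (G N)) => // n m; rewrite -hG /vpol.
have e (p : {poly int}) (t : nat) : m%:Z - (psh h' qs).[n%:Z] + p.[(n + t)%N%:Z] =
    m%:Z + (psh t p - psh h' qs).[n%:Z].
  by rewrite [(_ - psh h' qs).[_]]hornerD hornerN !horner_psh; ring.
rewrite !e /pdiff big_cat /= big_cons !big_map /= /conju.
rewrite (rmorphM (@conjc R)) /= (rmorph_prod (@conjc R)) /=.
under eq_bigr do rewrite e.
rewrite -!mulrA; congr (_ * (_ * (_ * _))).
by apply: eq_bigr => x _; rewrite e.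
Qed.

(** For these pairs the new distinguished polynomial differs by a constant from one of the
    conjugated factors, so the new family is not admissible. *)
Definition bad q (Ps : seq {poly int}) h h' : bool :=
  has (fun p => (size (psh h q - psh h' p)%R <= 1)%N) (q :: Ps).

(** For fixed [h'] each polynomial excludes at most one [h], by [psh_const_inj]; this is where
    degree at least 2 is needed. *)
Lemma bad_count q (Ps : seq {poly int}) H : (2 < size q)%N ->
  cesaro (fun h => cesaro (fun h' => (bad q Ps h h')%:R) H) H <= (size Ps).+1%:R / H%:R :> R.
Proof.
move=> sq; rewrite cesaroC.
have [->|H0] := posnP H; first by rewrite invr0 mulr0 /cesaro invr0 mul0r.
rewrite -[leRHS](cesaro_cst _ H0); apply: ler_cesaro => h' _.
rewrite [leRHS]mulrC ler_wpM2l ?invr_ge0//.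
have -> : (size Ps).+1 = size (q :: Ps) by [].
rewrite /bad; elim: (q :: Ps) => [|p s ih] /=; first by rewrite big1.
rewrite -[in leRHS]addn1 natrD addrC; apply: (le_trans _ (lerD (lexx _) ih)).
apply: (@le_trans _ _ (\sum_(1 <= h < H.+1) (size (psh h q - psh h' p)%R <= 1)%N%:R +
   \sum_(1 <= h < H.+1) (has (fun p0 => (size (psh h q - psh h' p0)%R <= 1)%N) s)%:R)).
  rewrite -big_split /=; apply: ler_sum => h _.
  by rewrite -natrD ler_nat; case: (has _ _); case: (size _ <= 1)%N.
rewrite lerD2r; apply: sum_unique_le1; first exact: iota_uniq.
by move=> h1 h2; exact: psh_const_inj.
Qed.

(** Bad pairs are bounded trivially by [1] and have density [O(1 / H)]; the other pairs tend to zero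
    by hypothesis, and there are finitely many of them once [H] is fixed. *)
Lemma pet_step q L (qs : {poly int}) : (2 < size q)%N -> (size qs <= d.+1)%N ->
  (forall h h', ~~ bad q (map fst L) h h' ->
    sqavg N (b N) (vpol u (psh h q - psh h' qs) (pfilter (pdiff q L qs h h')) N)
      @[N --> \oo] --> (0 : R)) ->
  sqavg N (b N) (vpol u q L N) @[N --> \oo] --> (0 : R).
Proof.
move=> sq sqs hyp; apply: sqavg_cvg0 => e e0.
have e30 : 0 < e / 3 by rewrite divr_gt0.
have [H [H0 hH]] : exists H, (0 < H)%N /\ (size L).+1%:R / H%:R <= e / 3 :> R.
  have [H1 _ hH1] := near_nat_inv ((size L).+1%:R : R) e30.
  by exists H1.+1; split => //; apply: hH1 => /=.
have n1 : \forall N \near \oo, sqavg N (b N) (vpol u q L N) <= _ :=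
  vdc_near hb H0 e30 (fun N n m => vpol_le1 q L N n m u1)
    (c := fun h => psh h qs) (fun h => etrans (congr1 (leq^~ _) (size_psh h qs)) sqs).
have n2 : forall h h', \forall N \near \oo,
    correl N (b N) (fun n => vpol u q L N (n + h)%N) (fun n => vpol u q L N (n + h')%N)
      (fun n => (psh h' qs).[n%:Z]) <= (bad q (map fst L) h h')%:R + e / 3.
  move=> h h'; case: (boolP (bad _ _ h h')) => [_|/hyp].
    apply: nearW => N; rewrite (@le_trans _ _ 1)//; last by rewrite lerDl ltW.
    by apply: correl_le1 => n m; exact: vpol_le1.
  have e2 : 0 < (e / 3) ^+ 2 by rewrite exprn_gt0.
  move=> /cvgr0Pnorm_le/(_ _ e2); apply: filterS => N.
  rewrite ger0_norm ?sqavg_ge0// add0r => hN.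
  rewrite -(ler_pXn2r (n := 2))// ?nnegrE ?correl_ge0 ?(ltW e30)//.
  exact: le_trans (correl_vpol _ _ _ _ _ _ _) hN.
have n3 := near_all H (fun h => near_all H (n2 h)).
apply: filterS2 n1 n3 => N h1 h2; apply: (le_trans h1).
have : cesaro (fun h => cesaro (fun h' => correl N (b N) (fun n => vpol u q L N (n + h)%N)
      (fun n => vpol u q L N (n + h')%N) (fun n => (psh h' qs).[n%:Z])) H) H <=
    cesaro (fun h => cesaro (fun h' => (bad q (map fst L) h h')%:R) H) H + e / 3.
  rewrite -[X in _ + X](cesaro_cst _ H0) -cesaroD; apply: ler_cesaro => h /andP[_ hhH].
  rewrite -[X in _ + X](cesaro_cst _ H0) -cesaroD; apply: ler_cesaro => h' /andP[_ hhH'].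
  exact: h2.
have := bad_count (map fst L) H sq; rewrite size_map.
lra.
Qed.

End PetStep.

(** [w] bounds the weights from above instead of equalling them, because a step controls the new
    weights only through inequalities. *)
Definition pet_claim (d r k : nat) (w : nat -> nat) : Prop :=
  forall (R : realType) (b : nat -> nat) (u : int -> R[i]) (q : {poly int})
    (L : seq ({poly int} * bfam R)),
  scales R d b -> le1 u -> good k.+1 u -> lseminorm k.+1 u = 0 ->
  (size L <= r)%N -> (1 < size q <= d.+1)%N ->
  all (fun p : {poly int} => [&& (1 < size p)%N, (size p <= size q)%N &
    (1 < size (q - p)%R)%N]) (map fst L) ->
  (forall j, (0 < j <= d)%N -> (wt (q :: map fst L) j <= w j)%N) ->
  sqavg N (b N) (vpol u q L N) @[N --> \oo] --> (0 : R).

(* The polynomial [qs] used in the van der Corput step has minimal degree; if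
   possible it is chosen outside the class of [q], so that [q] keeps its degree. *)
Lemma pet_choice (q : {poly int}) (Ps : seq {poly int}) :
  (1 < size q)%N -> all (fun p : {poly int} => (1 < size p <= size q)%N) Ps ->
  exists qs : {poly int}, [/\ qs \in q :: Ps,
    forall p : {poly int}, p \in q :: Ps -> (size qs <= size p)%N &
    forall h h', h != h' -> ((size q).-1 <= size (psh h q - psh h' qs)%R <= size q)%N /\
      forall p g, p \in q :: Ps ->
        (size (psh g p - psh h' qs)%R <= size (psh h q - psh h' qs)%R)%N].
Proof.
move=> q1 Pq.
have Fq p : p \in q :: Ps -> (1 < size p <= size q)%N.
  by rewrite inE => /predU1P[->|/(allP Pq)//]; rewrite q1 leqnn.
have ex : exists n, has (fun p : {poly int} => size p == n) (q :: Ps).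
  by exists (size q); rewrite /= eqxx.
case: (ex_minnP ex) => n /hasP[p0 p0F /eqP sp0] nmin.
have {}nmin (p : {poly int}) : p \in q :: Ps -> (n <= size p)%N.
  by move=> pF; apply: nmin; apply/hasP; exists p.
(* Minimal degree and not in the class of [q]: subtracting such a polynomial preserves the degree of
   [q]. *)
pose other (p : {poly int}) := (size p == n) && ((size p < size q)%N || (lead_coef p != lead_coef q)).
have [/hasP[/= qs qsF /andP[/eqP sqs qsq]]|no] := boolP (has other (q :: Ps)).
  exists qs; split => // [p /nmin|h h' _]; first by rewrite sqs.
  have e : size (psh h q - psh h' qs) = size q.
    case/orP: qsq => [sl|ll]; first by rewrite size_polyB_gt ?size_psh.
    have := Fq _ qsF; case/andP=> _; rewrite leq_eqVlt => /predU1P[sl|sl].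
      by have [||->] := @size_polyB_neq (psh h q) (psh h' qs); rewrite ?size_psh ?lead_psh// eq_sym.
    by rewrite size_polyB_gt ?size_psh.
  rewrite e leqnn leq_pred; split => // p g pF.
  by rewrite size_polyB_le ?size_psh//; [case/andP: (Fq _ pF)|case/andP: (Fq _ qsF)].
(* Otherwise the whole family lies in the class of [q]. Then [qs = q] works: the degree of [q] drops
   by exactly one and no other polynomial ends up with a higher degree. *)
have all_n p : p \in q :: Ps -> size p = size q /\ lead_coef p = lead_coef q.
  have qn : size q = n.
    move: no; rewrite -all_predC => /allP/(_ _ p0F)/=; rewrite /other sp0 eqxx /= negb_or.
    move=> /andP[]; rewrite -leqNgt => qn _.
    by apply/eqP; rewrite eqn_leq qn nmin// mem_head.
  move=> pF; have sp : size p = n.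
    apply/eqP; rewrite eqn_leq nmin// andbT -qn.
    by case/andP: (Fq _ pF).
  split; first by rewrite sp.
  move: no; rewrite -all_predC => /allP/(_ _ pF)/=; rewrite /other sp eqxx qn ltnn /=.
  by rewrite negbK => /eqP.
exists q; split; first exact: mem_head.
  by move=> p /all_n[->].
move=> h h' hh; rewrite size_psh_diff// leqnn leq_pred; split => // p g pF.
have [sp lp] := all_n _ pF.
by rewrite -sp -(size_psh g p) size_polyB_eq ?size_psh ?lead_psh.
Qed.

(** The thresholds are collected before the family is known: only the minimal degree [e] decides
    which lower weight is reached, and there are at most [d] possibilities for it. *)
Lemma pet_max d : (0 < d)%N -> forall w r,
  exists k0, forall k, (k0 <= k)%N -> pet_claim d r k w.
Proof.
move=> d0; apply: (@lex_ind d) => w IH r.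
(* [r] factors at shift [h], and [r] with the conjugated distinguished one at shift [h']. *)
pose r' := (r + r).+1.
(* The weights after a step of degree [e]: one less at [e], unchanged above, and below [e] only the
   trivial bound by the size of the family. *)
pose we e j := if (j < e)%N then r'.+1 else if j == e then (w e).-1 else w j.
have /choice[K hK] e : exists k0, (0 < e <= d)%N -> (0 < w e)%N ->
    forall k, (k0 <= k)%N -> pet_claim d r' k (we e).
  have [ed|] := boolP ((0 < e <= d)%N); last by exists 0%N.
  have [w0|] := boolP (0 < w e)%N; last by exists 0%N.
  have [k0 hk0] : exists k0, forall k, (k0 <= k)%N -> pet_claim d r' k (we e).
    apply: (IH _ e) => //.
      by rewrite /we ltnn eqxx prednK.
    by move=> j /andP[ej _]; rewrite /we ltnNge (ltnW ej) /= gtn_eqF.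
  by exists k0.
(* The term [r] serves the linear case, where [k] must be at least the number of other factors. *)
exists (maxn r (\max_(e < d.+1) K e)) => k; rewrite geq_max => /andP[rk Kk].
move=> R b u q L hb u1 gu u0 sL /andP[q1 qd] qL wL.
have [q2|q3] := leqP (size q) 2.
  apply: (pet_linear d0 hb (leq_trans sL rk)) => //; first by rewrite q1.
  move: qL; rewrite all_map; apply: sub_all => x /= /and3P[_ xq ->].
  by rewrite (leq_trans xq q2).
have qL' : all (fun p : {poly int} => (1 < size p <= size q)%N) (map fst L).
  by apply: sub_all qL => p /and3P[-> ->].
have [qs [qsF qsmin qsd]] := pet_choice q1 qL'.
have F1 p : p \in q :: map fst L -> (1 < size p <= size q)%N.
  by rewrite inE => /predU1P[->|/(allP qL')//]; rewrite q1 leqnn.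
have [qs1 qsq] : (1 < size qs)%N /\ (size qs <= d.+1)%N.
  by have /andP[? h] := F1 _ qsF; split=> //; exact: leq_trans h qd.
apply: (@pet_step R d b u hb u1 q L qs q3 qsq) => h h' nbad.
pose e := (size qs).-1.
have sqs : size qs = e.+1 by rewrite prednK// ltnW.
have e0 : (0 < e <= d)%N by move: qs1 qsq; rewrite sqs !ltnS => -> ->.
have Fe p : p \in q :: map fst L -> (e < size p)%N by move=> /qsmin; rewrite sqs.
have hh : h != h'.
  apply: contra nbad => /eqP ->; apply/hasP; exists q; first exact: mem_head.
  by rewrite subrr size_poly0.
have [/andP[sq'1 sq'2] sq'] := qsd _ _ hh.
set q' := psh h q - psh h' qs in sq'1 sq'2 sq' *.
set L' := pfilter _.
pose F' := q' :: map fst L'.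
have FF' p' : p' \in F' -> exists p g, p \in q :: map fst L /\ p' = psh g p - psh h' qs.
  rewrite inE => /predU1P[->|]; first by exists q, h; rewrite mem_head.
  rewrite /L' pfilter_fst pdiff_fst mem_filter mem_cat => /andP[_ /orP[]] /mapP[p pF ->].
    by exists p, h; rewrite inE pF orbT.
  by exists p, h'.
have sL' : (size L' <= r')%N.
  rewrite size_filter (leq_trans (count_size _ _))// size_cat !size_map /= addnS ltnS.
  by rewrite leq_add.
have we_gt0 : (0 < w e)%N.
  by apply: leq_trans (wL _ e0); apply: leq_ltn_trans (wt_step_eq sqs qsF Fe FF').
have Kek : (K e <= k)%N.
  apply: leq_trans Kk; have ed : (e < d.+1)%N by case/andP: e0.
  exact: (leq_bigmax (F := fun i : 'I_d.+1 => K i) (Ordinal ed)).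
apply: (hK e e0 we_gt0 k Kek R b u q' L' hb u1 gu u0 sL').
- rewrite (leq_trans _ sq'1) ?(leq_trans sq'2)//.
  by case: (size q) q3 => [|[|[]]].
- rewrite /L' pfilter_fst pdiff_fst all_filter; apply/allP => p' p'F; apply/implyP => p'1.
  have p'F' : p' \in F'.
    by rewrite inE /L' pfilter_fst pdiff_fst mem_filter p'1 p'F orbT.
  have [p [g [pF p'E]]] := FF' _ p'F'.
  rewrite p'1 {1}p'E sq'//=.
  (* The translation cancels in differences with [q']. At shift [h] they are shifts of [q - p], not
     constant by assumption; at shift [h'] they are not constant because the pair is not bad. *)
  have tele (A B C : {poly int}) : A - C - (B - C) = A - B by rewrite opprB addrA subrK.
  move: p'F; rewrite mem_cat => /orP[] /mapP[p2 p2F ->]; rewrite /q' tele.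
    rewrite -pshB size_psh.
    by have /and3P[] := allP qL _ p2F.
  by rewrite ltnNge; apply: contra nbad => hs; apply/hasP; exists p2.
- move=> j jd; rewrite /we; case: ltngtP => ej.
  + apply: (leq_trans (wt_le _ _)); rewrite /= ltnS size_map; exact: sL'.
  + exact: leq_trans (wt_step_gt sqs FF' ej) (wL _ jd).
  + rewrite ej -ltnS prednK//; apply: leq_trans (wL _ e0).
    exact: wt_step_eq sqs qsF Fe FF'.
Qed.

(** With [p0] of maximal degree, the extra factor [A] acquires the polynomial [- p0] and [q] becomes
    [q - p0], of the degree of [p0]. Differences with the distinguished polynomial do not change,
    and the one with [- p0] is [q] itself, which is not constant. *)
Lemma pet d r : (0 < d)%N -> exists k0, forall k, (k0 <= k)%N ->
  forall (R : realType) (b : nat -> nat) (u : int -> R[i]) (q : {poly int})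
    (L : seq ({poly int} * bfam R)),
  scales R d b -> le1 u -> good k.+1 u -> lseminorm k.+1 u = 0 ->
  (size L <= r)%N -> (1 < size q <= d.+1)%N ->
  all (fun p : {poly int} => (1 < size p <= d.+1)%N && (1 < size (q - p)%R)%N) (map fst L) ->
  sqavg N (b N) (vpol u q L N) @[N --> \oo] --> (0 : R).
Proof.
(* One factor more than in [L], for [A]; together with the distinguished one this makes [r.+2], a
   trivial bound for every weight. *)
move=> d0; have [k0 hk0] := pet_max d0 (fun=> r.+2) r.+1.
exists k0 => k /hk0 {hk0}hk R b u q L hb u1 gu u0 sL qd qL.
have [qmax|] := boolP (all (fun p : {poly int} => (size p <= size q)%N) (map fst L)).
  apply: hk => //; first exact: leqW.
    apply/allP => p pL; have /andP[/andP[-> _] ->] := allP qL _ pL.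
    by rewrite (allP qmax).
  by move=> j _; rewrite (leq_trans (wt_le _ _))//= size_map ltnS leqW.
rewrite -has_predC => /hasP[/= p1 p1L]; rewrite -ltnNge => qp1.
have ex : exists n, has (fun p : {poly int} => size p == n) (map fst L).
  by exists (size p1); apply/hasP; exists p1.
have bnd n : has (fun p : {poly int} => size p == n) (map fst L) -> (n <= d.+1)%N.
  by move=> /hasP[p pL /eqP <-]; have /andP[/andP[]] := allP qL _ pL.
case: (ex_maxnP ex bnd) => n /hasP[/= p0 p0L /eqP sp0] nmax.
have {}nmax (p : {poly int}) : p \in map fst L -> (size p <= size p0)%N.
  by move=> pL; rewrite sp0; apply: nmax; apply/hasP; exists p.
have qp0 : (size q < size p0)%N by apply: leq_trans qp1 (nmax _ p1L).
have /andP[/andP[p01 p0d] _] := allP qL _ p0L.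
pose A N (m : int) := ccesaro (fun n => conjc (vpol u q L N n m)) (b N).
have A1 N : le1 (A N).
  by move=> m; apply: nc_ccesaro_le => // i _; rewrite ncJ; exact: vpol_le1.
pose L1 : seq ({poly int} * bfam R) := (- p0, BFam A1) ::
   [seq (x.1 - p0, x.2) | x : {poly int} * bfam R <- L].
have L1E : map fst L1 = - p0 :: [seq p - p0 | p <- map fst L].
  by rewrite /= -!map_comp.
have sqp0 : size (q - p0) = size p0 by rewrite -opprB size_polyN size_polyB_gt.
have [G [G1 hG]] := vpol_filter u (q - p0) L1.
have sL1 : (size (pfilter L1) <= r.+1)%N.
  by rewrite size_filter (leq_trans (count_size _ _))//= size_map ltnS.
have : sqavg N (b N) (vpol u (q - p0) (pfilter L1) N) @[N --> \oo] --> (0 : R).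
  apply: hk => //.
  - by rewrite sqp0 p01.
  - rewrite pfilter_fst L1E all_filter; apply/allP => p; rewrite inE => /predU1P[->|/mapP[p2 p2L ->]].
      rewrite size_polyN sqp0 leqnn opprK subrK p01 /=; by case/andP: qd => ->.
    apply/implyP => -> /=; rewrite sqp0 size_polyB_le ?nmax//=.
    rewrite opprB addrA subrK.
    by have /andP[] := allP qL _ p2L.
  - move=> j _; apply: (leq_trans (wt_le _ _)).
    by rewrite -[X in (X <= _)%N]/((size (map fst (pfilter L1))).+1) size_map ltnS.
have [C [C0 hC]] := poly_growth R p0d.
move=> conv; apply: sqavg_cvg0 => e e0.
have e20 : 0 < e / 2 by rewrite divr_gt0.
have e22 : 0 < (e / 2) ^+ 2 by rewrite exprn_gt0.
have [b0 _ _] := hb.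
have n1 := near_bd_inv hb (2 * C) e20.
have n2 : \forall N \near \oo, (0 < N)%N by exists 1%N.
move/cvgr0Pnorm_le: conv => /(_ _ e22) n3.
apply: filterS3 n1 n2 n3 => N h1 /b0 bN; rewrite ger0_norm ?sqavg_ge0// => h3.
pose y n m := vpol u q L N n m * A N m.
have y1 i m : nc (y i m) <= 1 by rewrite ncM mulr_ile1 ?nc_ge0 ?vpol_le1//; exact: A1.
have := @avg_translate R N (b N) (C * (b N)%:R ^+ d) y (fun n => p0.[n%:Z]) bN y1.
move=> /(_ (fun n hn => hC n _ hn)).
have -> : cesaro (fun n => cesaro (fun m => Re (y n m%:Z)) N) (b N) =
    sqavg N (b N) (vpol u q L N).
  rewrite cesaroC; congr cesaro; apply/funext => m; rewrite -Re_ccesaro.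
  rewrite /y; under eq_fun do rewrite mulrC.
  rewrite ccesaroZ -[RHS]/(Re (_ %:C)%C) nc_sqrE conj_ccesaro mulrC.
  by [].
move=> /le_trans; apply; rewrite [leRHS]splitr lerD//.
  rewrite -(ler_pXn2r (n := 2))// ?nnegrE ?nc_ge0 ?(ltW e20)//.
  apply: le_trans h3; apply: (@nc_avg_drop R N (b N) (fun i m => y i (m%:Z - p0.[i%:Z])) _ (G N)) => // i m.
  rewrite -hG /y /vpol /L1 big_cons big_map /= hornerN !hornerD hornerN.
  rewrite (mulrC _ (A N _)) mulrCA; congr (_ * (_ * _)); first by congr (u _); ring.
  by apply: eq_bigr => x _; congr (x.2 N _); rewrite hornerD hornerN; ring.
by rewrite (mulrA 2) -(mulrA (2 * C)).
Qed.

(** * Birkhoff's theorem and ergodic components *)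

Section MaximalErgodic.
Context {R : realType} {dX : measure_display} {X : measurableType dX}
  {mu : probability X R} (T : invertible_mpt mu).

Lemma bdd_integrable d' (Y : measurableType d') (nu : probability Y R) (f : Y -> R) (A : set Y) :
  measurable A -> measurable_fun setT f -> bdd f -> nu.-integrable A (EFin \o f).
Proof.
move=> mA mf [M fM]; apply: measurable_bounded_integrable => //.
- by rewrite (le_lt_trans (probability_le1 nu mA))// ltry.
- exact: measurable_funTS.
- exists M; split; first exact: num_real.
  by move=> x Mx y Ay; apply: le_trans (ltW Mx); exact: fM.
Qed.

Lemma cst_integrable (A : set X) (r : R) : measurable A -> mu.-integrable A (cst r%:E).
Proof.
move=> mA; apply: (@bdd_integrable _ X mu (cst r) A) => //.
by exists `|r|.
Qed.

Lemma measurable_iter n : measurable_fun setT (iter n T).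
Proof.
elim: n => [|n ih]; first exact: measurable_id.
by apply: measurableT_comp ih; exact: measurable_mpt_fun.
Qed.

Lemma Rintegral_mpt (f : X -> R) (B : set X) : measurable_fun setT f -> bdd f ->
  measurable B -> T @^-1` B = B ->
  \int[mu]_(x in B) f (T x) = \int[mu]_(x in B) f x.
Proof.
move=> mf bf mB TB; congr fine.
have mT := measurable_mpt_fun T.
have bfT : bdd (f \o T) by exact: bdd_comp bf.
have mfT : measurable_fun setT (f \o T) by exact: measurableT_comp.
transitivity (\int[pushforward mu T]_(x in B) (f x)%:E)%E.
  rewrite integral_pushforward ?TB//; first exact/measurable_EFinP.
  exact: bdd_integrable.
apply: eq_measure_integral => A mA _; exact: mpt_preserving.
Qed.

Definition bsum (f : X -> R) N x := \sum_(i < N) f (iter i T x).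

Lemma bsumS f N x : bsum f N.+1 x = f x + bsum f N (T x).
Proof. by rewrite /bsum big_ord_recl; congr (_ + _); apply: eq_bigr => i _; rewrite -iterSr. Qed.

Lemma measurable_bsum f N : measurable_fun setT f -> measurable_fun setT (bsum f N).
Proof.
move=> mf; apply: measurable_sum => i.
by apply: measurableT_comp => //; exact: measurable_iter.
Qed.

(** The maximum of the sums [bsum f k x] for [k <= n], in the recursive form used by Garsia's proof
    of the maximal inequality. *)
Fixpoint maxsum (f : X -> R) n x : R :=
  if n is n'.+1 then Num.max 0 (f x + maxsum f n' (T x)) else 0.

Lemma maxsum_ge0 f n x : 0 <= maxsum f n x.
Proof. by case: n => //= n; rewrite le_max lexx. Qed.

Lemma maxsumS f n x : maxsum f n x <= maxsum f n.+1 x.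
Proof.
elim: n x => [|n ih] x; first by rewrite maxsum_ge0.
by rewrite /= ge_max !le_max lexx /= lerD2l ih orbT.
Qed.

Lemma bsum_le_maxsum f n x : bsum f n x <= maxsum f n x.
Proof.
elim: n x => [|n ih] x; first by rewrite /bsum big_ord0.
by rewrite bsumS /= le_max lerD2l ih orbT.
Qed.

Lemma measurable_maxsum f n : measurable_fun setT f -> measurable_fun setT (maxsum f n).
Proof.
move=> mf; elim: n => [|n ih] /=; first exact: measurable_cst.
apply: measurable_maxr; first exact: measurable_cst.
apply: measurable_funD => //; apply: measurableT_comp => //.
exact: measurable_mpt_fun.
Qed.

Lemma maxsum_bdd f n : bdd f -> bdd (maxsum f n).
Proof.
move=> [M fM]; elim: n => [|n [K hK]] /=; first exact: bdd_cst.
exists (M + K) => x; rewrite ger0_norm ?le_max ?lexx// ge_max.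
rewrite (le_trans _ (lerD (le_trans (normr_ge0 _) (fM x)) (le_trans (normr_ge0 _) (hK (T x)))))//=.
by rewrite lerD// (le_trans (ler_norm _)).
Qed.

Lemma measurable_gt (f : X -> R) c : measurable_fun setT f -> measurable [set x | c < f x].
Proof.
move=> mf; rewrite [X in measurable X](_ : _ = setT `&` f @^-1` `]c, +oo[%classic).
  exact: mf.
by apply/seteqP; split => x /=; rewrite in_itv /= andbT; [|case].
Qed.

(** Garsia's argument: where [maxsum f n.+1] is positive, [f] is at least
    [maxsum f n.+1 - maxsum f n.+1 \o T], and elsewhere this difference is nonpositive. Its integral
    over an invariant set is zero, and the sets of positivity increase to cover [B]. *)
Lemma maximal_ergodic (f : X -> R) (B : set X) : measurable_fun setT f -> bdd f ->
  measurable B -> T @^-1` B = B -> (forall x, B x -> exists N, 0 < bsum f N x) ->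
  0 <= \int[mu]_(x in B) f x.
Proof.
move=> mf bf mB TB BS.
pose P n := [set x | 0 < maxsum f n x].
have mP n : measurable (P n) by apply: measurable_gt; exact: measurable_maxsum.
have mfP n : measurable_fun setT (fun x => f x * \1_(P n) x).
  by apply: measurable_funM => //; exact: measurable_indic.
have b1 n : bdd (\1_(P n) : X -> R).
  by exists 1 => x; rewrite indicE; case: (_ \in _); rewrite ?normr1 ?normr0.
have bfP n : bdd (fun x => f x * \1_(P n) x) by exact: bddM.
have pos n : 0 <= \int[mu]_(x in B) (f x * \1_(P n.+1) x).
  have mm := measurable_maxsum n.+1 mf; have bm := maxsum_bdd n.+1 bf.
  have bmT : bdd (fun x => maxsum f n.+1 (T x)) by exact: bdd_comp bm.
  have mmT : measurable_fun setT (fun x => maxsum f n.+1 (T x)).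
    by apply: measurableT_comp => //; exact: measurable_mpt_fun.
  apply: (@le_trans _ _ (\int[mu]_(x in B) (maxsum f n.+1 x - maxsum f n.+1 (T x)))).
    rewrite RintegralB//; [|exact: bdd_integrable|exact: bdd_integrable].
    by rewrite Rintegral_mpt// subrr.
  apply: le_Rintegral => //.
  - apply: bdd_integrable => //; first exact: measurable_funB.
    by apply: bddD => //; exact: bddN.
  - exact: bdd_integrable.
  - move=> x _; rewrite indicE; have [xP|xP] := boolP (x \in P n.+1).
      rewrite mulr1 lerBlDr; move: xP; rewrite inE => h.
      have {}h : 0 < maxsum f n.+1 x by [].
      have -> : maxsum f n.+1 x = f x + maxsum f n (T x).
        by move: h; rewrite /= lt_max ltxx /= => h; rewrite max_r// ltW.
      by rewrite lerD2l; exact: maxsumS.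
    rewrite mulr0 subr_le0; apply: (le_trans _ (maxsum_ge0 _ _ _)).
    by rewrite leNgt; apply: contra xP => h; rewrite inE.
have [M fM] := bf.
have [] := @dominated_convergence _ _ _ mu B mB
    (fun n x => (f x * \1_(P n.+1) x)%:E) (EFin \o f) (cst M%:E).
- by move=> n; apply/measurable_EFinP; exact: measurable_funTS.
- by apply/measurable_EFinP; exact: measurable_funTS.
- apply: aeW => x /BS[N SN].
  apply: (@cvg_trans _ ((fun _ : nat => (f x)%:E) @ \oo)); last exact: cvg_cst.
  apply: near_eq_cvg; exists N => // n /= Nn.
  rewrite indicE mem_set ?mulr1//= /P.
  have h m : (0 : R) < maxsum f m x -> 0 < maxsum f m.+1 x.
    by move=> /lt_le_trans; apply; exact: maxsumS.
  have hN : 0 < maxsum f N x by apply: lt_le_trans SN (bsum_le_maxsum _ _ _).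
  rewrite -(subnK (leqW Nn)); elim: (_ - _)%N => [//|m ih].
  by rewrite addSn; exact: h.
- exact: cst_integrable.
- apply: aeW => x n _; rewrite /= lee_fin normrM (le_trans _ (fM x))//.
  by rewrite ler_piMr// indicE; case: (_ \in _); rewrite ?normr1 ?normr0.
move=> _ _ cv; rewrite /Rintegral fine_ge0// -(cvg_lim _ cv)//.
apply: lime_ge; first by apply/cvg_ex; eexists; exact: cv.
apply: nearW => n; have := pos n; rewrite -lee_fin /Rintegral fineK//.
by apply: integrable_fin_num => //; exact: bdd_integrable.
Qed.

Lemma ae_mpt (P : X -> Prop) : {ae mu, forall x, P x} -> {ae mu, forall x, P (T x)}.
Proof.
move=> [A [mA A0 PA]]; exists (T @^-1` A); split.
- by rewrite -[X in measurable X]setTI; apply: measurable_mpt_fun.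
- by rewrite mpt_preserving.
- by move=> x /= nP; exact: PA.
Qed.

Lemma ae_iter (P : X -> Prop) : {ae mu, forall x, P x} ->
  {ae mu, forall x, forall n, P (iter n T x)}.
Proof.
move=> hP; apply: ae_foralln; elim=> [//|n ih].
by apply: filterS (ae_mpt ih) => x; rewrite -iterSr.
Qed.

(** The integral of [g - e - eps] over the set [B] where its sums are unbounded above is
    [- eps * mu B], and the maximal inequality forces [mu B = 0]. Off [B] a bound on these sums is
    the claim, since [e] is constant along almost every orbit. *)
Lemma birkhoff_ub (g e : X -> R) (eps : R) : measurable_fun setT g -> bdd g ->
  measurable_fun setT e -> bdd e -> {ae mu, forall x, e (T x) = e x} ->
  (forall B, measurable B -> T @^-1` B = B ->
    \int[mu]_(x in B) e x = \int[mu]_(x in B) g x) -> 0 < eps ->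
  {ae mu, forall x, exists K : R, forall N, bsum g N x <= N%:R * (e x + eps) + K}.
Proof.
move=> mg bg me be eT eg eps0.
pose f x := g x - e x - eps.
have mge : measurable_fun setT (fun x => g x - e x) by exact: measurable_funB.
have bge : bdd (fun x => g x - e x) by apply: bddD => //; exact: bddN.
have mf : measurable_fun setT f by apply: measurable_funB => //; exact: measurable_cst.
have bf : bdd f by apply: bddD => //; exact/bddN/bdd_cst.
(* One more summand does not affect unboundedness, so [B] is invariant exactly and not merely up to
   a null set. *)
pose B := [set x | forall k : nat, exists N, k%:R < bsum f N x].
have mB : measurable B.
  rewrite [X in measurable X](_ : _ = \bigcap_k \bigcup_N [set x | k%:R < bsum f N x]).
    apply: bigcapT_measurable => k; apply: bigcupT_measurable => N.
    by apply: measurable_gt; exact: measurable_bsum.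
  apply/seteqP; split => x.
    by move=> Bx k _; have [N hN] := Bx k; exists N.
  by move=> Bx k; have [N _ hN] := Bx k I; exists N.
have arch (r : R) : exists k : nat, r < k%:R.
  by exists (Num.truncn r).+1; exact: truncnS_gt.
have TB : T @^-1` B = B.
  apply/seteqP; split => x /= Bx k.
    have [k' hk'] := arch (k%:R - f x).
    have [N hN] := Bx k'; exists N.+1; rewrite bsumS.
    by rewrite -ltrBlDl (lt_trans hk').
  have [k' hk'] := arch (k%:R + f x).
  have [[|N] hN] := Bx k'; first by move: hN; rewrite /bsum big_ord0 ltNge ler0n.
  by exists N; move: hN; rewrite bsumS; lra.
have : 0 <= \int[mu]_(x in B) f x.
  apply: maximal_ergodic => // x Bx; have [N hN] := Bx 0%N; by exists N.
rewrite RintegralB//; last 2 first.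
- exact: bdd_integrable.
- exact: cst_integrable.
rewrite RintegralB//; [|exact: bdd_integrable|exact: bdd_integrable].
rewrite eg// subrr sub0r Rintegral_cst// oppr_ge0 => h.
have muB : mu B = 0%E.
  have : fine (mu B) <= 0 by rewrite -(pmulr_rle0 _ eps0).
  have := fine_ge0 (measure_ge0 mu B) => h1 h2.
  have : fine (mu B) = 0 by apply/eqP; rewrite eq_le h2.
  by move=> h3; rewrite -[LHS]fineK ?h3// fin_num_measure.
have aeB : {ae mu, forall x, ~ B x} by exists B; split => // x /= /contrapT.
have aeT := ae_iter eT.
apply: filterS2 aeB aeT => x nB eTx.
have {}eTx n : e (iter n T x) = e x.
  by elim: n => [//|n ih]; rewrite -ih -(eTx n).
move/existsNP: nB => [k /forallNP hk]; exists k%:R => N.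
have /negP := hk N; rewrite -leNgt.
have -> : bsum f N x = bsum g N x - N%:R * (e x + eps).
  rewrite /bsum; elim: N => [|N ih]; first by rewrite !big_ord0 mul0r subrr.
  by rewrite !big_ord_recr /= ih /f eTx -natr1; ring.
by rewrite lerBlDl.
Qed.

(** The limit [e] is given in advance and recognised by its integrals over strictly invariant sets;
    the upper bounds for [g] and [- g], with [eps] running through [1 / (n + 1)], then enclose the
    averages. *)
Lemma birkhoff (g e : X -> R) : measurable_fun setT g -> bdd g ->
  measurable_fun setT e -> bdd e -> {ae mu, forall x, e (T x) = e x} ->
  (forall B, measurable B -> T @^-1` B = B ->
    \int[mu]_(x in B) e x = \int[mu]_(x in B) g x) ->
  {ae mu, forall x, cesaro (fun n => g (iter n T x)) N @[N --> \oo] --> e x}.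
Proof.
move=> mg bg me be eT eg.
have mNg : measurable_fun setT (fun x => - g x) by exact: measurableT_comp.
have mNe : measurable_fun setT (fun x => - e x) by exact: measurableT_comp.
have eNT : {ae mu, forall x, - e (T x) = - e x} by apply: filterS eT => x ->.
have egN B : measurable B -> T @^-1` B = B ->
    \int[mu]_(x in B) (- e x) = \int[mu]_(x in B) (- g x).
  move=> mB TB; under eq_Rintegral do rewrite -mulN1r.
  under [RHS]eq_Rintegral do rewrite -mulN1r.
  by rewrite !RintegralZl//; [rewrite eg|exact: bdd_integrable|exact: bdd_integrable].
have dn n (n0 : 0 < n.+1%:R^-1 :> R) := birkhoff_ub mNg (bddN bg) mNe (bddN be) eNT egN n0.
have {}up : {ae mu, forall x, forall n, exists K : R, forall N,
    bsum g N x <= N%:R * (e x + n.+1%:R^-1) + K}.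
  by apply: ae_foralln => n; apply: birkhoff_ub => //; rewrite invr_gt0.
have {}dn : {ae mu, forall x, forall n, exists K : R, forall N,
    bsum (fun x => - g x) N x <= N%:R * (- e x + n.+1%:R^-1) + K}.
  by apply: ae_foralln => n; apply: dn; rewrite invr_gt0.
have [M gM] := bg.
apply: filterS2 up dn => x up dn.
apply/cvgrPdist_le => d d0; have d20 : 0 < d / 2 by rewrite divr_gt0.
have [n hn] : exists n : nat, n.+1%:R^-1 <= d / 2 :> R.
  have [n _ /(_ n.+1 (leqnSn n))] := near_nat_inv (1 : R) d20.
  by rewrite div1r => h; exists n.
have [K1 up1] := up n; have [K2 dn2] := dn n.
near=> N.
have N0 : (0 < N)%N by near: N; exists 1%N.
have Nr : 0 < N%:R :> R by rewrite ltr0n.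
(* [cesaro] runs over [1..N] and [bsum] over [0..N-1], which leaves two boundary terms. *)
have e1 : N%:R * cesaro (fun i => g (iter i T x)) N = bsum g N x + (g (iter N T x) - g x).
  rewrite /cesaro mulrA divff ?mul1r ?gt_eqF// /bsum.
  have aux (a : nat -> R) k : \sum_(1 <= n < k.+1) a n = \sum_(i < k) a i + (a k - a 0%N).
    elim: k => [|k ih]; first by rewrite big_geq// big_ord0 add0r subrr.
    by rewrite big_nat_recr//= ih big_ord_recr /=; ring.
  by rewrite aux.
have h1 : (K1 + 2 * M) / N%:R <= d / 2 by near: N; exact: near_nat_inv.
have h2 : (K2 + 2 * M) / N%:R <= d / 2 by near: N; exact: near_nat_inv.
move: h1 h2; rewrite !ler_pdivrMr// => h1 h2.
have g1 := gM x; have g2 := gM (iter N T x).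
have {}up1 := up1 N; have {}dn2 := dn2 N.
have bN : bsum (fun x => - g x) N x = - bsum g N x by rewrite /bsum sumrN.
rewrite bN in dn2; move: g1 g2; rewrite !ler_norml => /andP[g1 g2] /andP[g3 g4].
have hn' : N%:R * n.+1%:R^-1 <= N%:R * (d / 2) by rewrite ler_wpM2l.
have dN : N%:R * (d / 2) = N%:R * d / 2 by ring.
have dN' : d / 2 * N%:R = N%:R * d / 2 by ring.
rewrite dN in hn'; rewrite dN' in h1 h2.
have lin (a c s y z i D K K' : R) : i <= D / 2 -> K + 2 * M <= D / 2 -> K' + 2 * M <= D / 2 ->
    - s <= - a + i + K -> s <= a + i + K' -> - M <= y <= M -> - M <= z <= M ->
    c = s + (y - z) -> a - c <= D /\ c - a <= D.
  by move=> ? ? ? ? ? ? ? ->; split; lra.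
rewrite mulrDr in up1; rewrite mulrDr mulrN in dn2.
have [key1 key2] := lin _ _ _ _ _ _ _ _ _ hn' h2 h1 dn2 up1
  (introT andP (conj g3 g4)) (introT andP (conj g1 g2)) e1.
rewrite -mulrBr in key1; rewrite -mulrBr in key2.
move: key1 key2; rewrite !ler_pM2l// => k1 k2; lra.
Unshelve. all: by end_near. Qed.

End MaximalErgodic.

Section NullSets.
Context {d : measure_display} {Y : measurableType d} {R : realType}.
Variables (nu : {measure set Y -> \bar R}) (N0 : set Y).
Hypotheses (mN0 : measurable N0) (nuN0 : nu N0 = 0%E).
Import HBNNSimple.
Local Open Scope ereal_scope.

(** The integral of a nonnegative function, measurable or not, is a supremum over simple functions
    below it. Such a function below [f] lies below [g] once it is set to zero on [N0], and this does
    not change its integral. *)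
Let ge0_le (f g : Y -> \bar R) : (forall y, 0 <= f y) -> (forall y, 0 <= g y) ->
  (forall y, ~ N0 y -> f y = g y) -> \int[nu]_y f y <= \int[nu]_y g y.
Proof.
move=> f0 g0 fg; rewrite !ge0_integralTE//.
have mN : measurable (~` N0) by exact: measurableC.
apply: ge_ereal_sup => _ [h /= hf <-]; apply: ereal_sup_ubound.
exists (proj_nnsfun h mN).
  move=> y; rewrite -mrestrict patchE; case: ifPn => [|_]; last exact: g0.
  by rewrite inE => ny; rewrite -fg.
rewrite -mrestrict -(integral_nnsfun nu mN).
have -> : sintegral nu h = \int[nu]_y (h y)%:E by rewrite integral_nnsfun// patch_setT.
rewrite [LHS]integral_mkcond; apply: ge0_ae_eq_integral => //.
- apply/(measurable_restrictT _ mN).1; apply: measurable_funTS.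
  exact/measurable_EFinP.
- exact/measurable_EFinP.
- by move=> y _; rewrite patchE; case: ifP => // _; rewrite lee_fin.
- by move=> y _; rewrite lee_fin.
- exists N0; split => // y /= /not_implyP[_]; rewrite patchE.
  by case: ifPn => // /negP; rewrite in_setC => /negP; rewrite negbK inE.
Qed.

(* No measurability is assumed: an integral against an ergodic component, as a
   function of the base point, is only almost everywhere equal to a measurable
   function. *)
Lemma integral_eq_off_null (f g : Y -> \bar R) : (forall y, ~ N0 y -> f y = g y) ->
  \int[nu]_y f y = \int[nu]_y g y.
Proof.
move=> fg; rewrite integralE [RHS]integralE.
have e (f1 g1 : Y -> \bar R) : (forall y, 0 <= f1 y) -> (forall y, 0 <= g1 y) ->
    (forall y, ~ N0 y -> f1 y = g1 y) -> \int[nu]_y f1 y = \int[nu]_y g1 y.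
  move=> f0 g0 fg1; apply/eqP; rewrite eq_le !ge0_le// => y /fg1 //.
by congr (_ - _); apply: e => // y ny; rewrite ?funeposE ?funenegE fg.
Qed.

End NullSets.

Lemma Rintegral_probability_cst d (Y : measurableType d) (R : realType)
  (nu : probability Y R) (c : R) : \int[nu]_y c = c.
Proof.
transitivity (c * fine (nu setT)); first exact: Rintegral_cst.
by rewrite probability_setT mulr1.
Qed.

Lemma measurable_fun_subsigma d (X : measurableType d) d' (Y : measurableType d')
    (G : set (set X)) (h : X -> Y) : G `<=` measurable ->
  measurable_fun [set: g_sigma_algebraType G] h -> measurable_fun [set: X] h.
Proof.
move=> Gm mh _ A mA; have /= := mh measurableT A mA.
apply: smallest_sub; first exact: sigma_algebra_measurable.
exact: Gm.
Qed.

(** * Disintegration over the invariant sigma-algebra *)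

Section ErgodicDecomposition.
Context {R : realType} {dX : measure_display} {X : measurableType dX}
  {mu : probability X R} (T : invertible_mpt mu) (D : ergodic_decomposition T).

Notation XB := (g_sigma_algebraType (erg_base D)).
Notation XI := (g_sigma_algebraType (invariant_sets T)).

Lemma invariant_measurable : invariant_sets T `<=` measurable.
Proof. by move=> A []. Qed.

Lemma base_measurable A : <<s erg_base D >> A -> measurable A.
Proof.
apply: smallest_sub; first exact: sigma_algebra_measurable.
exact: erg_base_measurable.
Qed.

Let mTpre (A : set X) : measurable A -> measurable (T @^-1` A).
Proof. by move=> mA; rewrite -[X in measurable X]setTI; apply: measurable_mpt_fun. Qed.

Lemma sigma_algebra_invariant : sigma_algebra setT (invariant_sets T).
Proof.
split.
- by split => //; rewrite preimage_set0 setYK measure0.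
- move=> A [mA A0]; split; first exact: measurableD.
  rewrite -[RHS]A0; congr (mu _); apply/seteqP; split => x /=; by case: (pselect (A x)); case: (pselect (A (T x))); rewrite /setY /setU /setD /=; tauto.
- move=> A hA; split; first by apply: bigcupT_measurable => k; case: (hA k).
  have mA k : measurable (A k) by case: (hA k).
  apply/eqP; rewrite eq_le measure_ge0 andbT.
  have mY k : measurable ((T @^-1` A k) `+` A k).
    by apply: measurableU; apply: measurableD => //; exact: mTpre.
  apply: (@le_trans _ _ (mu (\bigcup_k ((T @^-1` A k) `+` A k)))).
    apply: le_measure; rewrite ?inE.
    + have mU : measurable (\bigcup_k A k) by exact: bigcupT_measurable.
      by apply: measurableU; apply: measurableD => //; exact: mTpre.
    + exact: bigcupT_measurable.
    + move=> x /= [[[k _ Tk] nx]|[[k _ xk] nx]].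
        by exists k => //; left; split => // xk; apply: nx; exists k.
      by exists k => //; right; split => // Tk; apply: nx; exists k.
  have : mu.-negligible (\bigcup_k ((T @^-1` A k) `+` A k)).
    apply: negligible_bigcup => k; apply/negligibleP => //.
    by case: (hA k).
  by move/measure_negligible => ->//; exact: bigcupT_measurable.
Qed.

Lemma sub_invariant A : <<s invariant_sets T >> A -> invariant_sets T A.
Proof. by apply: smallest_sub => //; exact: sigma_algebra_invariant. Qed.

(** Each rational superlevel set is invariant up to a null set; off countably many null sets no
    rational separates [e (T x)] from [e x]. *)
Lemma ae_invariant (e : X -> R) : measurable_fun [set: XI] e ->
  {ae mu, forall x, e (T x) = e x}.
Proof.
move=> me.
pose r (n : nat) : R := ratr (odflt 0%Q (unpickle n)).
pose A n := [set x | r n < e x].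
have hA n : invariant_sets T (A n).
  apply: sub_invariant; have := me measurableT `]r n, +oo[%classic (measurable_itv _).
  rewrite (_ : _ `&` _ = A n)//; apply/seteqP.
  by split => x /=; rewrite in_itv /= andbT; [case|].
have aeA n : {ae mu, forall x, ~ ((T @^-1` A n) `+` A n) x}.
  have [mA A0] := hA n; exists ((T @^-1` A n) `+` A n); split => //.
    by apply: measurableU; apply: measurableD => //; exact: mTpre.
  by move=> x /= /contrapT.
have dense (a b : R) : a < b -> exists n, a <= r n < b.
  move=> ab; have [q] := rat_in_itvoo ab; rewrite in_itv /= => /andP[aq qb].
  by exists (pickle q); rewrite /r pickleK /= qb ltW.
apply: filterS (ae_foralln aeA) => x hx.
apply/eqP; rewrite eq_le; apply/andP; split; rewrite leNgt; apply/negP => /dense[n /andP[h1 h2]];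
  apply: (hx n).
- by left; split => //=; rewrite /A /=; apply/negP; rewrite -leNgt.
- by right; split => //=; rewrite /A /=; apply/negP; rewrite -leNgt.
Qed.

Import HBNNSimple.

Let integral_erg_nnsfun (B : set X) (h : {nnsfun XB >-> R}) : invariant_sets T B ->
  (\int[mu]_(x in B) \int[D x]_y (h y)%:E = \int[mu]_(x in B) (h x)%:E)%E.
Proof.
move=> iB; have [mB _] := iB.
have mhr r : <<s erg_base D>> (h @^-1` [set r]) by exact: (measurable_funPTI h).
under eq_integral.
  move=> x _; under eq_integral do rewrite fimfunE -fsumEFin//.
  rewrite ge0_integral_fsum//; last 2 first.
    - by move=> r; exact/measurable_EFinP/measurableT_comp.
    - by move=> r z _; rewrite EFinM nnfun_muleindic_ge0.
  under eq_fsbigr.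
    move=> r _; rewrite (integralZl_indic _ (fun r => h @^-1` [set r]))//; last first.
      by move=> r0; rewrite preimage_nnfun0.
    rewrite integral_indic// setIT; over.
  over.
have mD r : measurable_fun setT (fun x => D x (h @^-1` [set r])).
  exact: (measurable_fun_subsigma invariant_measurable (erg_invariant (mhr r))).
rewrite /= ge0_integral_fsum//; last 2 first.
- by move=> r; apply: measurable_funeM; exact: measurable_funTS.
- move=> r x _; have := mulemu_ge0 (fun n => h @^-1` [set n]).
  by apply; exact: preimage_nnfun0.
rewrite -[RHS]/(\int[mu]_(x in B) (EFin \o h) x)%E.
under [in RHS]eq_integral do rewrite /= fimfunE -fsumEFin//.
rewrite [RHS]ge0_integral_fsum//; last 2 first.
- move=> r; apply: measurable_funTS; apply/measurable_EFinP.
  apply: measurable_funM; first exact: measurable_cst.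
  by apply: measurable_indic; exact: base_measurable.
- by move=> r z _; rewrite EFinM nnfun_muleindic_ge0.
apply: eq_fsbigr => r _.
have [r0|r0] := leP 0 r; last first.
  rewrite preimage_nnfun0//; rewrite !integral0_eq// => x _.
    by rewrite indic0 mulr0.
  by rewrite measure0 mule0.
have mhrX : @measurable _ X (h @^-1` [set r]) := base_measurable (mhr r).
rewrite ge0_integralZl//; last exact: measurable_funTS.
under [RHS]eq_integral do rewrite EFinM.
rewrite ge0_integralZl//; last first.
  by apply: measurable_funTS; apply/measurable_EFinP; exact: measurable_indic.
by rewrite integral_indic// erg_conditional.
Qed.

Lemma measurable_integral_erg (k : X -> \bar R) : (forall y, 0 <= k y)%E ->
  measurable_fun [set: XB] k -> measurable_fun [set: XI] (fun x => \int[D x]_y k y)%E.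
Proof.
move=> k0 mk; apply: (@measurable_fun_integral_kernel _ _ XI XB R (fun x => D x)) => //.
by move=> U mU; exact: (erg_invariant mU).
Qed.

Lemma integral_erg (B : set X) (k : X -> \bar R) : invariant_sets T B ->
  (forall y, 0 <= k y)%E -> measurable_fun [set: XB] k ->
  (\int[mu]_(x in B) \int[D x]_y k y = \int[mu]_(x in B) k x)%E.
Proof.
move=> iB k0 mk; have [mB _] := iB.
pose k_ := nnsfun_approx measurableT mk.
have mk_ n : measurable_fun [set: X] (fun x => (k_ n x)%:E).
  apply/measurable_EFinP; apply: (measurable_fun_subsigma (G := erg_base D)) => //.
  exact: erg_base_measurable.
transitivity (\int[mu]_(x in B) limn (fun n => \int[D x]_y (k_ n y)%:E))%E.
  apply: eq_integral => x _; rewrite -monotone_convergence//; last 3 first.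
  - by move=> n; exact/measurable_EFinP.
  - by move=> n z _; rewrite lee_fin.
  - by move=> z _ a b ab; rewrite lee_fin; exact/lefP/nd_nnsfun_approx.
  by apply: eq_integral => y _; apply/esym/cvg_lim => //=; exact: cvg_nnsfun_approx.
rewrite monotone_convergence//; last 3 first.
- move=> n; apply: measurable_funTS.
  apply: (measurable_fun_subsigma invariant_measurable).
  apply: measurable_integral_erg => [y|]; first by rewrite lee_fin.
  exact/measurable_EFinP.
- by move=> n x _; apply: integral_ge0 => y _; rewrite lee_fin.
- move=> x _ a b ab; apply: ge0_le_integral => //.
  + by move=> z _; rewrite lee_fin.
  + exact/measurable_EFinP.
  + exact/measurable_EFinP.
  + by move=> z _; rewrite lee_fin; exact/lefP/nd_nnsfun_approx.
transitivity (limn (fun n => \int[mu]_(x in B) (k_ n x)%:E))%E.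
  by congr (limn _); apply/funext => n; exact: integral_erg_nnsfun.
rewrite -monotone_convergence//; last 3 first.
- by move=> n; apply: measurable_funTS; exact: mk_.
- by move=> n z _; rewrite lee_fin.
- by move=> z _ a b ab; rewrite lee_fin; have /lefP/(_ z) := nd_nnsfun_approx measurableT mk ab.
by apply: eq_integral => x _; apply/cvg_lim => //; exact: cvg_nnsfun_approx.
Qed.

Lemma condexp (g : X -> R) : measurable_fun [set: XB] g -> bdd g ->
  let e := fun x => \int[D x]_y g y in
  [/\ measurable_fun [set: XI] e, bdd e &
     forall B, invariant_sets T B -> \int[mu]_(x in B) e x = \int[mu]_(x in B) g x].
Proof.
move=> mg bg e; have [M gM] := bg.
have mgX : measurable_fun [set: X] g.
  by apply: measurable_fun_subsigma mg; exact: erg_base_measurable.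
(* Adding [|M|] reduces the claim to nonnegative functions, for which [integral_erg] holds. *)
pose K x := (\int[D x]_y (g y + `|M|)%:E)%E.
have gM' y : - `|M| <= g y <= `|M| by rewrite -ler_norml (le_trans (gM y))// ler_norm.
have k0 y : (0 <= (g y + `|M|)%:E)%E by rewrite lee_fin; have := gM' y; lra.
have mk : measurable_fun [set: XB] (fun y => (g y + `|M|)%:E).
  by apply/measurable_EFinP; apply: measurable_funD.
have K0 x : (0 <= K x)%E by apply: integral_ge0 => y _; exact: k0.
have KM x : (K x <= (2 * `|M|)%:E)%E.
  apply: (@le_trans _ _ (\int[D x]_y (cst (2 * `|M|)%:E) y)%E).
    apply: ge0_le_integral => //.
    by move=> y _; rewrite lee_fin; have := gM' y; lra.
  rewrite integral_cst//.
  apply: (@le_trans _ _ ((2 * `|M|)%:E * 1)%E); last by rewrite mule1.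
  by apply: lee_wpmul2l; [rewrite lee_fin|exact: probability_le1].
have Kfin x : K x \is a fin_num.
  by rewrite ge0_fin_numE// (le_lt_trans (KM x))// ltry.
have eK x : e x = fine (K x) - `|M|.
  rewrite -[fine _]/(\int[D x]_y (g y + `|M|)) RintegralD//; last 2 first.
  - by apply: bdd_integrable.
  - by apply: cst_integrable.
  by rewrite Rintegral_probability_cst addrK.
have me : measurable_fun [set: XI] e.
  rewrite (funext eK); apply: measurable_funB => //.
  by apply: measurableT_comp => //; exact: measurable_integral_erg.
have be : bdd e.
  exists `|M| => x; rewrite eK ler_norml.
  by have := KM x; have := K0 x; rewrite -(fineK (Kfin x)) !lee_fin; lra.
split=> // B iB; have [mB _] := iB.
have meX := measurable_fun_subsigma invariant_measurable me.
have h : \int[mu]_(x in B) (e x + `|M|) = \int[mu]_(x in B) (g x + `|M|).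
  rewrite /Rintegral -(integral_erg iB k0 mk); congr fine.
  by apply: eq_integral => x _; rewrite eK subrK fineK.
move: h; rewrite !RintegralD//; [by move/addIr|..].
- by apply: bdd_integrable.
- by apply: cst_integrable.
- by apply: bdd_integrable.
- by apply: cst_integrable.
Qed.

(* The ergodic components only measure [<<s erg_base D>>]. *)
Lemma base_approx (f : X -> R) M : measurable_fun setT f ->
  {ae mu, forall x, `|f x| <= M} ->
  exists (N0 : set X) (g : X -> R), [/\ <<s erg_base D >> N0, mu N0 = 0%E,
    measurable_fun [set: XB] g, bdd g & forall x, ~ N0 x -> f x = g x].
Proof.
move=> mf [A0 [mA0 muA0 fA0]].
have [B0 [C0 [bB0 bC0 BA0 AC0 BC0]]] := erg_base_dense D mA0.
pose r (n : nat) : R := ratr (odflt 0%Q (unpickle n)).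
pose A n := [set x | r n < f x].
have mA n : measurable (A n) by exact: measurable_gt.
have /choice[B hB] n : exists B, <<s erg_base D >> B /\ exists C, [/\ <<s erg_base D >> C,
    B `<=` A n, A n `<=` C & mu (C `\` B) = 0%E].
  by have [B [C [? ? ? ? ?]]] := erg_base_dense D (mA n); exists B; split => //; exists C.
have /choice[C hC] n : exists C, [/\ <<s erg_base D >> C,
    B n `<=` A n, A n `<=` C & mu (C `\` B n) = 0%E].
  by case: (hB n).
have bB n : @measurable _ XB (B n) by case: (hB n).
have bC n : @measurable _ XB (C n) by case: (hC n).
have bCB n : @measurable _ XB (C n `\` B n) by exact: measurableD.
(* [C0] contains the points where the bound by [M] fails; the other sets are the gaps between inner
   and outer approximations of the rational superlevel sets. *)
pose N0 : set X := C0 `|` \bigcup_n (C n `\` B n).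
have bN0 : @measurable _ XB N0 by apply: measurableU => //; exact: bigcupT_measurable.
have muC0 : mu.-negligible C0.
  apply: (@negligibleS _ _ _ mu (A0 `|` (C0 `\` B0))).
    by move=> x Cx; have [Bx|nB] := pselect (B0 x); [left; exact: BA0|right].
  apply: negligibleU; apply/negligibleP => //.
  by apply: measurableD; exact: base_measurable.
have muN0 : mu N0 = 0%E.
  have : mu.-negligible N0.
    apply: negligibleU => //; apply: negligible_bigcup => n; apply/negligibleP.
      exact: base_measurable (bCB n).
    by case: (hC n).
  by move/measure_negligible => ->//; exact: base_measurable.
exists N0, (fun x => if x \in N0 then 0 else f x).
have off x : ~ N0 x -> (x \in N0) = false by move=> nx; apply/negbTE; rewrite notin_setE.
split => //.
- move=> mT; apply: (measurability _ (RGenOInfty.measurableE R)) => // _ [_ [q ->] <-].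
  rewrite setTI.
  (* Off [N0] the superlevel sets of [f] are unions of inner approximations; on [N0] the new
     function is 0, which exceeds [q] exactly when [q < 0]. *)
  rewrite [X in measurable X](_ : _ = (\bigcup_n (if q <= r n then B n `\` N0 else set0))
     `|` (if q < 0 then N0 else set0)); last first.
    apply/seteqP; split => x /=; rewrite in_itv /= andbT.
      case: ifPn => [/set_mem xN q0|]; first by right; rewrite q0.
      rewrite notin_setE => nx qf; left.
      have [w] := rat_in_itvoo qf; rewrite in_itv /= => /andP[qw wf].
      exists (pickle w) => //=; have rw : r (pickle w) = ratr w by rewrite /r pickleK.
      rewrite rw (ltW qw); split => //; apply: contrapT => nB; apply: nx; right.
      exists (pickle w) => //; split => //; have [_ _ AC _] := hC (pickle w).
      by apply: AC; rewrite /A /= rw.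
    case => [[n _]|].
      case: ifP => // qr [Bx nx]; rewrite off//; apply: (le_lt_trans qr).
      by have [_ BA _ _] := hC n; exact: BA.
    by case: ifP => // q0 xN; rewrite mem_set.
  apply: measurableU; last by case: ifP.
  by apply: bigcupT_measurable => n; case: ifP => // _; exact: measurableD.
- exists `|M| => x; case: ifPn => [_|]; first by rewrite normr0.
  rewrite notin_setE => nx; apply: le_trans (ler_norm M); apply: contrapT => h.
  by apply: nx; left; apply: AC0; apply: fA0.
- by move=> x nx; rewrite off.
Qed.

End ErgodicDecomposition.

(** * Seminorms along orbits *)

Section BoundedSequences.
Context {R : realType}.
Implicit Types (u : int -> R[i]) (c : R).

Lemma scaleu_unit c u : 0 < c -> (forall m, nc (u m) <= c) ->
  exists2 v, le1 v & u = scaleu c v.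
Proof.
move=> c0 uc; exists (scaleu c^-1 u).
  by move=> m; rewrite ncM ncC ger0_norm ?invr_ge0 ?(ltW c0)// ler_pdivrMl// mulr1.
apply/funext => m; rewrite /scaleu mulrA -(rmorphM (real_complex R)) divff ?gt_eqF//.
by rewrite mul1r.
Qed.

Lemma good_unit k c u v : 0 < c -> u = scaleu c v -> good k u -> good k v.
Proof.
move=> c0 -> /(good_scale c^-1); congr good; apply/funext => m.
by rewrite /scaleu mulrA -(rmorphM (real_complex R)) mulVf ?gt_eqF// mul1r.
Qed.

Lemma lseminorm_bound k c u : 0 < c -> (forall m, nc (u m) <= c) -> good k u ->
  0 <= lseminorm k u <= c ^+ (2 ^ k.+1).
Proof.
move=> c0 uc gu; have [v v1 uv] := scaleu_unit c0 uc.
have gv := good_unit c0 uv gu.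
have cn : 0 <= c ^+ (2 ^ k.+1) by rewrite exprn_ge0// ltW.
rewrite uv lseminorm_scale// mulr_ge0 ?lseminorm_ge0//=.
by rewrite ler_piMr ?lseminorm_le1.
Qed.

Lemma lseminorm_cvg_bound k c u : 0 < c -> (forall m, nc (u m) <= c) -> good k.+1 u ->
  cvgn (cesaro (fun n => lseminorm k (delta n%:Z 0 u))).
Proof.
move=> c0 uc gu; have [v v1 uv] := scaleu_unit c0 uc.
have gv : good k.+1 v := good_unit c0 uv gu.
rewrite (_ : cesaro _ = fun N => (c ^+ 2) ^+ (2 ^ k.+1) *
    cesaro (fun n => lseminorm k (delta n%:Z 0 v)) N).
  by apply: is_cvgMr; exact: lseminorm_cvg.
apply/funext => N; rewrite -cesaroZ; congr cesaro; apply/funext => n.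
by rewrite uv delta_scale (lseminorm_scale _ (le1_delta _ _ v1) (gv _ _)).
Qed.

End BoundedSequences.

Section Iterates.
Context {R : realType} {dX : measure_display} {X : measurableType dX}
  {mu : probability X R}.
Implicit Type T : invertible_mpt mu.

Lemma mpt_inv_preserving T A : measurable A -> mu (mpt_inv T @^-1` A) = mu A.
Proof.
move=> mA; rewrite -(mpt_preserving T).
  by congr (mu _); apply/funext => x /=; rewrite mpt_funK.
by rewrite -[X in measurable X]setTI; apply: measurable_mpt_inv.
Qed.

Definition mpt_inverse T : invertible_mpt mu :=
  InvertibleMpt (@mpt_invK _ _ _ _ T) (@mpt_funK _ _ _ _ T) (measurable_mpt_inv T)
    (measurable_mpt_fun T) (@mpt_inv_preserving T).

Lemma mpt_iterS T z x : mpt_iter T (z + 1) x = T (mpt_iter T z x).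
Proof.
case: z => [n|[|n]]; first by rewrite -PoszD addn1.
  by rewrite /= mpt_invK.
by rewrite (_ : Negz n.+1 + 1 = Negz n) /= ?mpt_invK// !NegzE; lia.
Qed.

Lemma mpt_iterP T z x : mpt_iter T (z - 1) x = mpt_inv T (mpt_iter T z x).
Proof. by rewrite -[in RHS](subrK 1 z) mpt_iterS mpt_funK. Qed.

Lemma mpt_iterD T z w x : mpt_iter T (z + w) x = mpt_iter T z (mpt_iter T w x).
Proof.
elim: z => [|n ih|n ih]; first by rewrite add0r.
  by rewrite -addn1 PoszD addrAC mpt_iterS ih -mpt_iterS.
rewrite -[n.+1]addn1 PoszD opprD addrAC mpt_iterP ih.
by rewrite -mpt_iterP.
Qed.

Lemma measurable_mpt_iter T z : measurable_fun setT (mpt_iter T z).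
Proof. by case: z => n; [exact: measurable_iter|exact: (measurable_iter (mpt_inverse T))]. Qed.

Lemma ae_mpt_iter T (P : X -> Prop) : {ae mu, forall x, P x} ->
  {ae mu, forall x, forall z, P (mpt_iter T z x)}.
Proof.
move=> hP; apply: filterS2 (ae_iter T hP) (ae_iter (mpt_inverse T) hP) => x h1 h2.
by case=> n; [exact: h1|exact: h2].
Qed.

Lemma ae_int (P : int -> X -> Prop) : (forall z, {ae mu, forall x, P z x}) ->
  {ae mu, forall x, forall z, P z x}.
Proof.
move=> hP; have := @ae_foralln _ _ _ mu (fun n x => P (Posz n) x) (fun n => hP n).
have := @ae_foralln _ _ _ mu (fun n x => P (Negz n) x) (fun n => hP (Negz n)).
by apply: filterS2 => x h1 h2 [n|n].
Qed.

End Iterates.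

Definition ess_bounded (R : realType) (dX : measure_display) (X : measurableType dX)
    (mu : probability X R) (M : R) (f : X -> R[i]) :=
  [/\ measurable_fun setT (fun x => Re (f x)), measurable_fun setT (fun x => Im (f x)) &
     {ae mu, forall x, nc (f x) <= M}].

Section EssentiallyBounded.
Context {R : realType} {dX : measure_display} {X : measurableType dX}
  {mu : probability X R}.
Implicit Type f : X -> R[i].

Lemma Lfun_oo_bound (f : X -> R) : f \in Lfun mu +oo%E ->
  measurable_fun setT f /\ exists M, {ae mu, forall x, `|f x| <= M}.
Proof.
rewrite /Lfun !inE /= => /andP[/set_mem /= mf /set_mem /=].
move=> hN; split => //; move: hN; rewrite /finite_norm unlock /=.
rewrite probability_setT lte01 => hs.
exists (fine (ess_sup_inf.ess_sup mu (abse \o (EFin \o f)))).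
apply: filterS (ess_sup_inf.ess_sup_ge mu (abse \o (EFin \o f))) => x /=.
by move: hs; case: (ess_sup_inf.ess_sup _ _).
Qed.

Lemma nc_le_ReIm (x : R[i]) : nc x <= `|Re x| + `|Im x|.
Proof.
rewrite -(ler_pXn2r (n := 2))// ?nnegrE ?nc_ge0 ?addr_ge0// nc_sqr.
rewrite sqrrD !real_normK ?num_real//.
have : 0 <= `|Re x| * `|Im x| by rewrite mulr_ge0.
lra.
Qed.

Lemma complex_Linfty_bounded f : complex_Linfty mu f -> exists2 M, 1 <= M & ess_bounded mu M f.
Proof.
case=> /Lfun_oo_bound[mR [M1 h1]] /Lfun_oo_bound[mI [M2 h2]].
exists (1 + (`|M1| + `|M2|)); first by rewrite lerDl addr_ge0.
split => //; apply: filterS2 h1 h2 => x h1 h2; apply: (le_trans (nc_le_ReIm _)).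
have := ler_norm M1; have := ler_norm M2; lra.
Qed.


Lemma ess_bounded_comp (S : invertible_mpt mu) z M f : ess_bounded mu M f ->
  ess_bounded mu M (fun x => f (mpt_iter S z x)).
Proof.
case=> mR mI fM; have mz := measurable_mpt_iter S z; split.
- exact: (measurableT_comp mR mz).
- exact: (measurableT_comp mI mz).
- by apply: filterS (ae_mpt_iter S fM).
Qed.

Lemma ess_boundedMJ M f g : ess_bounded mu M f -> ess_bounded mu M g ->
  ess_bounded mu (M ^+ 2) (fun x => f x * conjc (g x)).
Proof.
case=> fR fI fM [gR gI gM]; split.
- rewrite (_ : (fun _ => _) = fun x => Re (f x) * Re (g x) + Im (f x) * Im (g x)).
    by apply: measurable_funD; apply: measurable_funM.
  by apply/funext => x; rewrite ReM ReJ ImJ; ring.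
- rewrite (_ : (fun _ => _) = fun x => Im (f x) * Re (g x) - Re (f x) * Im (g x)).
    by apply: measurable_funB; apply: measurable_funM.
  by apply/funext => x; rewrite ImM ReJ ImJ; ring.
- apply: filterS2 fM gM => x h1 h2; rewrite ncM ncJ expr2.
  by apply: ler_pM; rewrite ?nc_ge0.
Qed.

End EssentiallyBounded.

Lemma powR_rootK (R : realType) (n : nat) (x : R) : (0 < n)%N -> 0 <= x ->
  (x `^ n%:R^-1) ^+ n = x.
Proof.
move=> n0 x0; rewrite -powR_mulrn ?powR_ge0// -powRrM mulVf ?powRr1//.
by rewrite pnatr_eq0 -lt0n.
Qed.

(** * Integrals of local seminorms *)

Section Orbits.
Context {R : realType} {dX : measure_display} {X : measurableType dX}
  {mu : probability X R} (T : invertible_mpt mu) (D : ergodic_decomposition T).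
Implicit Type f : X -> R[i].

(** [D x N0] integrates to [mu N0 = 0], so almost every component ignores the set where [f] was
    changed. This ties the integral of [f] against [D x] to a measurable function and to the orbit
    averages at once. *)
Lemma birkhoff_ess (f : X -> R) M : measurable_fun setT f ->
  {ae mu, forall x, `|f x| <= M} ->
  exists e : X -> R, [/\ measurable_fun setT e,
    {ae mu, forall x, \int[D x]_y f y = e x} &
    {ae mu, forall x, cesaro (fun n => f (iter n T x)) N @[N --> \oo] --> e x}].
Proof.
move=> mf fM; have [N0 [g [bN0 muN0 mg bg fg]]] := base_approx D mf fM.
have [mXe be eg] := condexp mg bg.
pose e x := \int[D x]_y g y.
have me : measurable_fun setT e.
  by apply: measurable_fun_subsigma mXe; exact: invariant_measurable.
have mgX : measurable_fun setT g.
  by apply: measurable_fun_subsigma mg; exact: erg_base_measurable.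
exists e; split => //.
- have mD : measurable_fun setT (fun x => D x N0).
    exact: (measurable_fun_subsigma (@invariant_measurable _ _ _ _ T) (erg_invariant bN0)).
  have /(ae_eq_integral_abs mu measurableT mD) : (\int[mu]_x `|D x N0| = 0)%E.
    under eq_integral do rewrite gee0_abs//.
    rewrite (@erg_conditional _ _ _ _ _ D _ setT bN0); first by rewrite setIT.
    by split => //; rewrite preimage_setT setYK measure0.
  apply: filterS => x /(_ I) /= DN; rewrite /e /Rintegral; congr fine.
  by apply: (@integral_eq_off_null _ (g_sigma_algebraType (erg_base D)) R (D x) N0 bN0 DN) => y ny; rewrite fg.
- have mA : measurable N0 := base_measurable bN0.
  have aeN : {ae mu, forall x, ~ N0 x}.
    by exists N0; split => // x /= /contrapT.
  have hB B : measurable B -> T @^-1` B = B -> \int[mu]_(x in B) e x = \int[mu]_(x in B) g x.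
    by move=> mB TB; apply: eg; split => //; rewrite TB setYK measure0.
  have := birkhoff mgX bg me be (ae_invariant mXe) hB.
  apply: filterS2 (ae_iter T aeN) => x hx.
  suff -> : cesaro (fun n => f (iter n T x)) = cesaro (fun n => g (iter n T x)) by [].
  by congr cesaro; apply/funext => n; rewrite fg.
Qed.

Lemma ae_integral_eq (f g : X -> \bar R) : {ae mu, forall x, f x = g x} ->
  (\int[mu]_x f x = \int[mu]_x g x)%E.
Proof.
move=> [A [mA A0 fg]]; apply: (integral_eq_off_null mA A0) => x.
by apply: contra_notP => ?; exact: fg.
Qed.

Definition seqof f x : int -> R[i] := fun z => f (mpt_iter T z x).

Definition deltaf (h h' : int) f : X -> R[i] :=
  fun y => f (mpt_iter T h y) * conjc (f (mpt_iter T h' y)).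

Lemma delta_seqof h h' f x : delta h h' (seqof f x) = seqof (deltaf h h' f) x.
Proof.
apply/funext => m; rewrite /delta /seqof /deltaf -!mpt_iterD.
by rewrite (addrC m) (addrC m).
Qed.

Lemma ess_bounded_deltaf h h' M f : ess_bounded mu M f -> ess_bounded mu (M ^+ 2) (deltaf h h' f).
Proof. by move=> hf; apply: ess_boundedMJ; exact: ess_bounded_comp. Qed.

Lemma ae_seqof_bound M f : ess_bounded mu M f ->
  {ae mu, forall x, forall m, nc (seqof f x m) <= M}.
Proof. by case=> _ _; exact: ae_mpt_iter. Qed.

Lemma birkhoff_complex M f : ess_bounded mu M f -> exists e1 e2 : X -> R,
  [/\ measurable_fun setT e1, measurable_fun setT e2,
    {ae mu, forall x, complex_integral (D x) f = Complex (e1 x) (e2 x)},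
    {ae mu, forall x, cesaro (fun n => Re (seqof f x n%:Z)) N @[N --> \oo] --> e1 x} &
    {ae mu, forall x, cesaro (fun n => Im (seqof f x n%:Z)) N @[N --> \oo] --> e2 x}].
Proof.
case=> mR mI fM.
have [|e1 [m1 h1 c1]] := @birkhoff_ess _ M mR.
  by apply: filterS fM => x; apply: le_trans; exact: nc_Re.
have [|e2 [m2 h2 c2]] := @birkhoff_ess _ M mI.
  by apply: filterS fM => x; apply: le_trans; exact: nc_Im.
exists e1, e2; split => //.
by apply: filterS2 h1 h2 => x h1 h2; rewrite /complex_integral h1 h2.
Qed.

Lemma ae_good k M f : ess_bounded mu M f -> {ae mu, forall x, good k (seqof f x)}.
Proof.
elim: k M f => [|k ih] M f hf.
  have [e1 [e2 [_ _ _ c1 c2]]] := birkhoff_complex hf.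
  by apply: filterS2 c1 c2 => x c1 c2; split; apply/cvg_ex; eexists; eassumption.
apply: ae_int => h; apply: ae_int => h'.
apply: filterS (ih _ _ (ess_bounded_deltaf h h' hf)) => x.
by rewrite delta_seqof.
Qed.

Lemma ae_clip (psi F : X -> R) B : 0 <= B -> measurable_fun setT psi ->
  {ae mu, forall x, psi x = F x} -> {ae mu, forall x, 0 <= F x <= B} ->
  exists psi' : X -> R, [/\ measurable_fun setT psi', forall x, 0 <= psi' x <= B &
    {ae mu, forall x, psi' x = F x}].
Proof.
move=> B0 mpsi pF FB; exists (fun x => Num.min B (Num.max 0 (psi x))); split.
- by apply: measurable_minr => //; apply: measurable_maxr.
- by move=> x; rewrite le_min B0 le_max lexx /= ge_min lexx.
- apply: filterS2 pF FB => x -> /andP[F0 FB]; rewrite max_r// min_r//.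
Qed.

Lemma bdd_interval (Y : Type) (psi : Y -> R) (B : R) :
  (forall x, 0 <= psi x <= B) -> bdd psi.
Proof. by move=> h; exists B => x; have /andP[? ?] := h x; rewrite ger0_norm. Qed.

Lemma Rintegral_cesaro (psi : nat -> X -> R) N : (forall n, measurable_fun setT (psi n)) ->
  (forall n, bdd (psi n)) ->
  \int[mu]_x cesaro (psi ^~ x) N = cesaro (fun n => \int[mu]_x psi n x) N.
Proof.
move=> mpsi bpsi.
have ms m : measurable_fun setT (fun x => \sum_(1 <= n < m) psi n x).
  by apply: measurable_sum.
have bs m : bdd (fun x => \sum_(1 <= n < m) psi n x) by exact: bdd_sum.
rewrite /cesaro RintegralZl//; last by apply: bdd_integrable.
congr (_ * _); elim: N => [|N ih].
  rewrite big_geq//; under eq_Rintegral do rewrite big_geq//.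
  exact: Rintegral_probability_cst.
rewrite big_nat_recr//= -ih.
under eq_Rintegral do rewrite big_nat_recr//=.
by rewrite RintegralD//; apply: bdd_integrable.
Qed.

Lemma Rintegral_cvg (F : nat -> X -> R) (G : X -> R) B : (forall n, measurable_fun setT (F n)) ->
  (forall n x, `|F n x| <= B) -> measurable_fun setT G ->
  (forall x, F n x @[n --> \oo] --> G x) ->
  \int[mu]_x F n x @[n --> \oo] --> \int[mu]_x G x.
Proof.
move=> mF FB mG FG.
have [] := @dominated_convergence _ _ _ mu setT measurableT
    (fun n x => (F n x)%:E) (EFin \o G) (cst B%:E).
- by move=> n; apply/measurable_EFinP.
- exact/measurable_EFinP.
- by apply: aeW => x _; apply/fine_cvgP; split; [exact: nearW|exact: FG].
- exact: cst_integrable.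
- by apply: aeW => x n _; rewrite /= lee_fin.
move=> iG _; have -> : (\int[mu]_x (EFin \o G) x = (\int[mu]_x G x)%:E)%E.
  by rewrite fineK//; exact: integrable_fin_num.
by move=> /fine_cvgP[_]; exact.
Qed.

(** The local seminorm is the desired limit only at almost every point; [psi] is a version to which
    measurability of limits and dominated convergence apply. *)
Lemma seminorm_integral k M f : 0 < M -> ess_bounded mu M f ->
  exists psi : X -> R, [/\ measurable_fun setT psi, forall x, 0 <= psi x <= M ^+ (2 ^ k.+1),
    {ae mu, forall x, psi x = lseminorm k (seqof f x)} &
    ergodic_seminorm D k.+1 f ^+ (2 ^ k.+1) = \int[mu]_x psi x].
Proof.
elim: k M f => [|k ih] M f M0 hf.
  have [e1 [e2 [m1 m2 h c1 c2]]] := birkhoff_complex hf.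
  have c12 : {ae mu, forall x, e1 x ^+ 2 + e2 x ^+ 2 = lseminorm 0 (seqof f x)}.
    by apply: filterS2 c1 c2 => x c1 c2; rewrite /= (cvg_lim _ c1)// (cvg_lim _ c2).
  have m12 : measurable_fun setT (fun x => e1 x ^+ 2 + e2 x ^+ 2).
    by apply: measurable_funD; apply: measurable_funX.
  have M2 : 0 <= M ^+ (2 ^ 1) by rewrite exprn_ge0// ltW.
  have [|psi [mpsi bpsi hpsi]] := ae_clip M2 m12 c12.
    apply: filterS2 (@ae_good 0 _ _ hf) (ae_seqof_bound hf) => x g0 xM.
    exact: lseminorm_bound.
  exists psi; split => //.
  have -> : ergodic_seminorm D 1 f = (\int[mu]_x psi x) `^ 2^-1.
    rewrite /= unlock.
    have -> : (\int[mu]_x (`|(EFin \o (fun x => nc (complex_integral (D x) f))) x| `^ 2)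
        = (\int[mu]_x psi x)%:E)%E.
      rewrite /Rintegral fineK; last first.
        by apply: integrable_fin_num => //; apply: bdd_integrable => //; exact: bdd_interval bpsi.
      apply: ae_integral_eq; apply: filterS3 h c12 hpsi => x h c12 hpsi.
      rewrite hpsi -c12 -[(EFin \o _) x]/((nc (complex_integral (D x) f))%:E) h.
      rewrite gee0_abs ?lee_fin ?nc_ge0// poweR_EFin.
      by rewrite (powR_mulrn 2) ?nc_ge0// nc_sqr.
    by rewrite poweR_EFin.
  rewrite expn1 powR_rootK// /Rintegral fine_ge0// integral_ge0// => x _.
  by rewrite lee_fin; have /andP[] := bpsi x.
have hd n := ess_bounded_deltaf n%:Z 0 hf.
have M2 : 0 < M ^+ 2 by rewrite exprn_gt0.
have /choice[psi hpsi] n := ih _ _ M2 (hd n).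
have mpsi n : measurable_fun setT (psi n) by case: (hpsi n).
have bpsi n x : 0 <= psi n x <= M ^+ (2 ^ k.+2) by case: (hpsi n) => _ + _ _; rewrite -exprM -expnS.
have hP n : {ae mu, forall x, psi n x = lseminorm k (seqof (deltaf n 0 f) x)}.
  by case: (hpsi n).
have eP n : ergodic_seminorm D k.+1 (deltaf n%:Z 0 f) ^+ (2 ^ k.+1) = \int[mu]_x psi n x.
  by case: (hpsi n).
have [A [mA A0 hA]] : {ae mu, forall x, [/\ forall n, psi n x = lseminorm k (seqof (deltaf n 0 f) x),
    good k.+1 (seqof f x) & forall m, nc (seqof f x m) <= M]}.
  by apply: filterS3 (ae_foralln hP) (@ae_good k.+1 _ _ hf) (ae_seqof_bound hf) => x.
pose phi n x := psi n x * \1_(~` A) x.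
have {}hA x : ~ A x -> [/\ forall n, phi n x = lseminorm k (delta n%:Z 0 (seqof f x)),
    good k.+1 (seqof f x) & forall m, nc (seqof f x m) <= M].
  move=> nA; have [h1 h2 h3] : [/\ forall n, psi n x = lseminorm k (seqof (deltaf n 0 f) x),
    good k.+1 (seqof f x) & forall m, nc (seqof f x m) <= M].
    by apply: contra_notP nA => ?; exact: hA.
  by split=> // n; rewrite /phi indicE mem_set// mulr1 h1 -delta_seqof.
have mC : measurable (~` A) by exact: measurableC.
have mphi n : measurable_fun setT (phi n).
  by apply: measurable_funM => //; exact: measurable_indic.
have bphi n x : 0 <= phi n x <= M ^+ (2 ^ k.+2).
  have /andP[h1 h2] := bpsi n x; rewrite /phi indicE; case: (_ \in _).
    by rewrite mulr1 h1.
  by rewrite mulr0 lexx (le_trans h1).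
have hcvg x : cvgn (cesaro (phi ^~ x)).
  have [xA|nA] := pselect (A x).
    rewrite (_ : cesaro _ = fun=> 0); first exact: is_cvg_cst.
    apply/funext => N; rewrite /cesaro big1 ?mulr0// => n _.
    by rewrite /phi indicE memNset ?mulr0//= => /(_ xA).
  have [h1 h2 h3] := hA _ nA; rewrite (_ : phi^~ x = fun n => lseminorm k (delta n%:Z 0 (seqof f x))).
    exact: lseminorm_cvg_bound M0 h3 h2.
  by apply/funext => n; exact: h1.
pose Psi x := limn (cesaro (phi ^~ x)).
have B0 : 0 <= M ^+ (2 ^ k.+2) by rewrite exprn_ge0// ltW.
have cB N x : `|cesaro (phi^~ x) N| <= M ^+ (2 ^ k.+2).
  by apply: cesaro_norm_le => // n _; have /andP[p0 pM] := bphi n x; rewrite ger0_norm.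
have mces N : measurable_fun setT (fun x => cesaro (phi^~ x) N).
  by apply: measurable_funM => //; exact: measurable_sum.
have mPsi : measurable_fun setT Psi.
  by apply: (measurable_fun_cvg mces) => x _; exact: hcvg.
have bP n : bdd (phi n) := bdd_interval (bphi n).
exists Psi; split => //.
- move=> x; apply/andP; split.
    apply: limr_ge; [exact: hcvg|apply: nearW => N].
    by apply: cesaro_ge0 => n _; have /andP[] := bphi n x.
  apply: limr_le; [exact: hcvg|apply: nearW => N].
  exact: le_trans (ler_norm _) (cB N x).
- exists A; split => // x; apply: contra_notP => /hA[h1 _ _].
  by rewrite /Psi /=; congr (limn (cesaro _)); apply/funext => n; exact: h1.
- have -> : ergodic_seminorm D k.+2 f = (\int[mu]_x Psi x) `^ (2 ^ k.+2)%:R^-1.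
    transitivity (limn (cesaro (fun n => ergodic_seminorm D k.+1
        (fun x => conjc (f x) * f (iter n T x)) ^+ (2 ^ k.+1))) `^ (2 ^ k.+2)%:R^-1) => //.
    congr (_ `^ _).
    rewrite -(cvg_lim _ (Rintegral_cvg mces cB mPsi hcvg))//; congr (limn _).
    apply/funext => N; rewrite Rintegral_cesaro//; congr cesaro; apply/funext => n.
    rewrite (_ : (fun x => _) = deltaf n%:Z 0 f).
      rewrite eP; congr fine; apply: ae_integral_eq; exists A; split => // x /=.
      by apply: contra_notP => nA; rewrite /phi indicE mem_set// mulr1.
    by apply/funext => x; rewrite mulrC.
  rewrite powR_rootK ?expn_gt0// /Rintegral fine_ge0// integral_ge0// => x _.
  rewrite lee_fin; apply: limr_ge; [exact: hcvg|apply: nearW => N].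
  by apply: cesaro_ge0 => n _; have /andP[] := bphi n x.
Qed.

Lemma lseminorm_eq0 k M f : 0 < M -> ess_bounded mu M f -> ergodic_seminorm D k.+1 f = 0 ->
  {ae mu, forall x, lseminorm k (seqof f x) = 0}.
Proof.
move=> M0 hf sf; have [psi [mpsi bpsi hpsi]] := seminorm_integral k M0 hf.
rewrite sf expr0n gtn_eqF ?expn_gt0//= => /esym I0.
have mE : measurable_fun setT (EFin \o psi) by exact/measurable_EFinP.
have : (\int[mu]_x `|(EFin \o psi) x| = 0)%E.
  under eq_integral do rewrite gee0_abs ?lee_fin ?(andP (bpsi _)).1//.
  rewrite -[LHS]fineK; first by rewrite -[fine _]/(\int[mu]_x psi x) I0.
  apply: integrable_fin_num => //; apply: bdd_integrable => //; exact: bdd_interval bpsi.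
move=> /(ae_eq_integral_abs mu measurableT mE).
by apply: filterS2 hpsi => x <- /(_ I) [].
Qed.

End Orbits.

Lemma scales_powR (R : realType) (d : nat) (b : nat -> nat) : (0 < d)%N ->
  (forall N : nat, (0 < N)%N -> (0 < b N)%N) -> b N @[N --> \oo] --> \oo ->
  (b N)%:R / (N%:R `^ (d%:R^-1)) @[N --> \oo] --> (0 : R) -> scales R d b.
Proof.
move=> d0 b0 boo bd; split => //.
rewrite (_ : (fun N => _) = fun N => ((b N)%:R / (N%:R `^ (d%:R^-1))) ^+ d); last first.
  by apply/funext => N; rewrite expr_div_n powR_rootK.
have := cvg_comp _ _ bd (@exprn_continuous _ d (0 : R)).
by rewrite expr0n gtn_eqF.
Qed.

(** Rescaling by [c] puts all sequences in the unit disc; homogeneity of the local seminorm keeps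
    its vanishing. *)
Lemma pet_product (l d : nat) : (0 < d)%N -> exists k, forall (R : realType)
    (b : nat -> nat) (c : R) (u : 'I_l -> int -> R[i]) (p : 'I_l -> {poly int}) (i : 'I_l),
  scales R d b -> 0 < c -> (forall j m, nc (u j m) <= c) ->
  good k.+1 (u i) -> lseminorm k.+1 (u i) = 0 ->
  (forall j, (1 < size (p j) <= d.+1)%N) ->
  (forall i j, i != j -> (1 < size (p i - p j)%R)%N) ->
  sqavg N (b N) (fun n m => \prod_(j < l) u j (m + (p j).[n%:Z])) @[N --> \oo] --> (0 : R).
Proof.
move=> d0; have [k hk] := pet l d0; exists k => R b c u p i hb c0 uc gu su hp pp.
have /choice[v hv] j : exists v, le1 v /\ u j = scaleu c v.
  by have [v v1 uv] := scaleu_unit c0 (uc j); exists v.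
have v1 j : le1 (v j) by case: (hv j).
have uv j : u j = scaleu c (v j) by case: (hv j).
have gv : good k.+1 (v i) := good_unit c0 (uv i) gu.
have sv : lseminorm k.+1 (v i) = 0.
  move: su; rewrite uv lseminorm_scale// => /eqP; rewrite mulf_eq0 expf_eq0 (gt_eqF c0) andbF.
  by move/eqP.
pose L := [seq (p j, bcst (v1 j)) | j <- enum (predC1 i)].
have := hk _ (leqnn k) R b (v i) (p i) L hb (v1 i) gv sv.
have -> : (size L <= l)%N by rewrite size_map -cardE (leq_trans (max_card _))// card_ord.
move=> /(_ isT (hp i)).
have -> : all (fun p0 : {poly int} => (1 < size p0 <= d.+1)%N && (1 < size (p i - p0)%R)%N) (map fst L).
  rewrite !all_map; apply/allP => j /=; rewrite mem_enum => ji.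
  by rewrite hp pp// eq_sym.
move=> /(_ isT) h.
rewrite [X in X @ _](_ : _ = fun N => (c ^+ l) ^+ 2 * sqavg N (b N) (vpol (v i) (p i) L N)).
  by rewrite -(mulr0 ((c ^+ l) ^+ 2)); exact: cvgMr.
apply/funext => N; rewrite /sqavg -cesaroZ; congr cesaro; apply/funext => m.
have -> : ccesaro (fun n => \prod_(j < l) u j (m%:Z + (p j).[n%:Z])) (b N) =
    (c ^+ l)%:C%C * ccesaro (fun n => vpol (v i) (p i) L N n m%:Z) (b N).
  rewrite /ccesaro mulrCA; congr (_ * _); rewrite mulr_sumr; apply: eq_bigr => n _.
  rewrite /vpol big_map big_enum /= (rmorphXn (real_complex R)).
  under eq_bigr do rewrite uv /scaleu.
  by rewrite big_split /= prodr_const card_ord; congr (_ * _); rewrite (bigD1 i).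
by rewrite ncM exprMn ncC ger0_norm// exprn_ge0// ltW.
Qed.

Theorem theorem1p4 (l d : nat) (hl : (0 < l)%N) (hd : (0 < d)%N) :
  exists k : nat, (0 < k)%N /\
  forall (R : realType) (dX : measure_display) (X : measurableType dX)
    (mu : probability X R) (T : 'I_l -> invertible_mpt mu)
    (D : forall i : 'I_l, ergodic_decomposition (T i))
    (f : 'I_l -> X -> R[i]) (p : 'I_l -> {poly int}) (b : nat -> nat),
  lebesgue_space mu ->
  (forall i, complex_Linfty mu (f i)) ->
  (forall i, (1 < size (p i))%N) ->
  (forall i j, i != j -> (1 < size (p i - p j)%R)%N) ->
  \max_(i < l) (size (p i)).-1 = d ->
  (forall N : nat, (0 < N)%N -> (0 < b N)%N) ->
  b N @[N --> \oo] --> \oo ->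
  (b N)%:R / (N%:R `^ (d%:R^-1)) @[N --> \oo] --> (0 : R) ->
  (exists i, ergodic_seminorm (D i) k (f i) = 0) ->
  {ae mu, forall x : X,
    N%:R^-1 * (\sum_(1 <= m < N.+1)
      ComplexField.Normc.normc ((b N)%:R^-1 * \sum_(1 <= n < (b N).+1)
        \prod_(i < l) f i (mpt_iter (T i) (m%:Z + (p i).[n%:Z]) x)) ^+ 2)
    @[N --> \oo] --> (0 : R)}.
Proof.
(* The index of [lseminorm] lags behind the order by one, so [lseminorm k.+1] belongs to the
   seminorm of order [k.+2]. *)
have [k hk] := pet_product l hd; exists k.+2; split => // R dX X mu T D f p b _ fb p1 pp pd b0 boo bd [i si].
have hb := scales_powR hd b0 boo bd.
have /choice[M hM] j : exists M, 1 <= M /\ ess_bounded mu M (f j).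
  by have [M M1 hf] := complex_Linfty_bounded (fb j); exists M.
have M0 j : 0 < M j by rewrite (lt_le_trans ltr01)//; case: (hM j).
have hf j : ess_bounded mu (M j) (f j) by case: (hM j).
have ps j : (1 < size (p j) <= d.+1)%N.
  have : ((size (p j)).-1 <= d)%N by rewrite -pd; exact: (leq_bigmax (F := fun j => (size (p j)).-1)).
  by rewrite p1; case: (size (p j)).
(* The sum of the individual bounds serves as the common bound [c]. *)
have c0 : 0 < \sum_j M j.
  by rewrite (bigD1 i)//= ltr_pwDl// sumr_ge0// => j _; exact: ltW.
have Mc j : M j <= \sum_j M j.
  by rewrite (bigD1 j)//= lerDl sumr_ge0// => j' _; exact: ltW.
have aeM : {ae mu, forall x, forall j m, nc (seqof (T j) (f j) x m) <= M j}.
  by apply: filter_forall => j; exact: ae_seqof_bound.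
apply: filterS3 aeM (ae_good (D i) k.+1 (hf i)) (lseminorm_eq0 (M0 i) (hf i) si) => x hx gx sx.
apply: (hk _ _ _ (fun j => seqof (T j) (f j) x) _ _ hb c0 _ gx sx ps pp).
by move=> j m; exact: le_trans (hx j m) (Mc j).
Qed.
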